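(* Let $W:[0,1]\to\mathbb C$ be $(\sigma_*,2)$-Gevrey regular and $0<\sigma<\sigma_*$. Suppose $\psi$ is a smooth solution on $t\ge0$, $x\in(0,1]$ of $\frac{\partial}{\partial x}\big(x^2\frac{\partial\psi}{\partial x}\big)+\frac{\partial^2\psi}{\partial x\partial t}-W(x)\psi=0$ with Dirichlet condition $\psi(t,1)=0$. If $\psi(0,\cdot)\in X^\sigma$, then $\psi(t,\cdot)\in X^\sigma$ for all $t\ge0$, and there is a constant $c\ge0$ (independent of $\psi$) such that for all $0\le t_1\le t_2$: $\|\psi(t_2)\|_{X^\sigma}-\|\psi(t_1)\|_{X^\sigma}\le c\int_{t_1}^{t_2}\|\psi(t)\|_{X^\sigma}dt$.
   Context: Let $I=(0,1)$. A function $u\in C^\infty(\overline I)$ is $(\sigma,k)$-Gevrey regular ($\sigma,k>0$) if there is $C>0$ with $\sup_{x\in I}|u^{(n)}(x)|\le C\sigma^{-n}(n!)^k$ for all $n\ge0$. For $\sigma>0$, $u\in C^\infty(\overline I)$, integers $0\le N\le M$, $k\in\{0,1,2\}$, $l\in\{0,1\}$, set $|u|^{N,M}_{\sigma,k,l}=\big(\sum_{n=N}^M\frac{\sigma^{2n}}{n!^2(n+1)!^2}n^{k+l}\int_0^1(x/\sigma)^k|\partial_x^nu|^2dx\big)^{1/2}$ (with $0^0:=1$), $|u|^N_{\sigma,k,l}$ the same with $M=\infty$; $\|u\|_{\sigma,0,0}=|u|^0_{\sigma,0,0}$. Boundary seminorms: $[u]^{N,M}_\sigma=(\sum_{n=N}^M\frac{\sigma^{2n+1}}{n!^2(n+1)!^2}|u^{(n)}(0)|^2)^{1/2}$,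 $[u]^N_\sigma$ the same with $M=\infty$. $X^\sigma=\{u\in C^\infty(\overline I):u(1)=0,\ \|\partial_xu\|_{\sigma,0,0}+|\partial_xu|^0_{\sigma,1,0}+|\partial_xu|^0_{\sigma,2,0}+[\partial_xu]^0_\sigma<\infty\}$, a Hilbert space with norm $\|u\|_{X^\sigma}=(\|\partial_xu\|_{\sigma,0,0}^2+(|\partial_xu|^0_{\sigma,1,0})^2+(|\partial_xu|^0_{\sigma,2,0})^2+([\partial_xu]^0_\sigma)^2)^{1/2}$. *)

(* Defs.v *)
From Stdlib Require Import Reals Lra Arith ClassicalEpsilon.
Open Scope R_scope.

Definition Cx := (R * R)%type.
Definition Cmul (z w : Cx) : Cx :=
  (fst z * fst w - snd z * snd w, fst z * snd w + snd z * fst w).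
Definition Csub (z w : Cx) : Cx := (fst z - fst w, snd z - snd w).
Definition Cmod2 (z : Cx) : R := fst z ^ 2 + snd z ^ 2.
Definition Cmod (z : Cx) : R := sqrt (Cmod2 z).

Definition Rderiv_within (f f' : R -> R) (S : R -> Prop) (x : R) : Prop :=
  limit1_in (fun h => (f (x + h) - f x) / h) (fun h => h <> 0 /\ S (x + h)) (f' x) 0.

Definition Cderiv_within (f f' : R -> Cx) (S : R -> Prop) (x : R) : Prop :=
  Rderiv_within (fun y => fst (f y)) (fun y => fst (f' y)) S x /\
  Rderiv_within (fun y => snd (f y)) (fun y => snd (f' y)) S x.

Definition closed01 (x : R) : Prop := 0 <= x <= 1.
Definition open01 (x : R) : Prop := 0 < x < 1.

(** [D] is the family of derivatives of [u] in C^infinity([0,1]):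
    [D 0] agrees with [u] on (0,1] (the value at 0 is the continuous extension),
    and [D (S n)] is the derivative of [D n] within [0,1], at every point of [0,1]. *)
Definition smooth_cl (u : R -> Cx) (D : nat -> R -> Cx) : Prop :=
  (forall x, 0 < x <= 1 -> D 0%nat x = u x) /\
  (forall n x, closed01 x -> Cderiv_within (D n) (D (S n)) closed01 x).

Definition gevrey (sig : R) (k : nat) (W : R -> Cx) : Prop :=
  exists G : nat -> R -> Cx,
    (forall x, closed01 x -> G 0%nat x = W x) /\
    (forall n x, closed01 x -> Cderiv_within (G n) (G (S n)) closed01 x) /\
    exists Cst : R, 0 < Cst /\
      forall (n : nat) (x : R), open01 x ->
        Cmod (G n x) <= Cst * / (sig ^ n) * (INR (fact n)) ^ k.
(* k is taken natural (only k = 2 is used). *)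

(** * A total Riemann integral (0 if not Riemann integrable; integrands used
    below are continuous, hence integrable) *)
Definition RInt (f : R -> R) (a b : R) : R :=
  match excluded_middle_informative (exists pr : Riemann_integrable f a b, True) with
  | left H => RiemannInt (proj1_sig (constructive_indefinite_description _ H))
  | right _ => 0
  end.

Definition series_sum (a : nat -> R) (s : R) : Prop :=
  Un_cv (fun M => sum_f_R0 a M) s.

(** * The weighted Gevrey seminorms, squared, for N = 0, M = infinity.
    [v] is the family of derivatives of the function under consideration
    (v n = its n-th derivative). Note [pow 0 0 = 1], matching 0^0 := 1. *)
Definition gweight (sig : R) (n : nat) : R :=
  sig ^ (2 * n) / ((INR (fact n)) ^ 2 * (INR (fact (S n))) ^ 2).

Definition seminorm_term (sig : R) (k l : nat) (v : nat -> R -> Cx) (n : nat) : R :=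
  gweight sig n * (INR n) ^ (k + l) *
  RInt (fun x => (x / sig) ^ k * Cmod2 (v n x)) 0 1.

Definition boundary_term (sig : R) (v : nat -> R -> Cx) (n : nat) : R :=
  sig ^ (2 * n + 1) / ((INR (fact n)) ^ 2 * (INR (fact (S n))) ^ 2) * Cmod2 (v n 0).

(** [Xnorm_is sig u N]: u belongs to X^sigma and ||u||_{X^sigma} = N.
    The derivative family of d_x u is (fun n => D (S n)). *)
Definition Xnorm_is (sig : R) (u : R -> Cx) (N : R) : Prop :=
  exists (D : nat -> R -> Cx) (S0 S1 S2 Sb : R),
    smooth_cl u D /\
    D 0%nat 1 = (0, 0) /\
    series_sum (seminorm_term sig 0 0 (fun n => D (S n))) S0 /\
    series_sum (seminorm_term sig 1 0 (fun n => D (S n))) S1 /\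
    series_sum (seminorm_term sig 2 0 (fun n => D (S n))) S2 /\
    series_sum (boundary_term sig (fun n => D (S n))) Sb /\
    N = sqrt (S0 + S1 + S2 + Sb).

Definition Omega (t x : R) : Prop := 0 <= t /\ 0 < x <= 1.

Definition smooth_family_Omega (psi : R -> R -> Cx) (P : nat -> nat -> R -> R -> Cx) : Prop :=
  (forall t x, Omega t x -> P 0%nat 0%nat t x = psi t x) /\
  (forall i j t x, Omega t x ->
     Cderiv_within (fun s => P i j s x) (fun s => P (S i) j s x) (fun s => Omega s x) t /\
     Cderiv_within (fun y => P i j t y) (fun y => P i (S j) t y) (fun y => Omega t y) x /\
     (forall eps, 0 < eps -> exists delta, 0 < delta /\
        forall t' x', Omega t' x' -> Rabs (t' - t) < delta -> Rabs (x' - x) < delta ->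
          Cmod (Csub (P i j t' x') (P i j t x)) < eps)).

(* Main.v *)
(** Write phi_n for the n-th x-derivative of d_x psi. Differentiating the equation n times gives
    d_t phi_n + x^2 d_x phi_n = - 2(n+1) x phi_n - n(n+1) phi_(n-1) + d_x^n (W psi), a transport
    equation with characteristics x' = x^2. Let g_n be the Gevrey weights and
    kap_n(x) = 1 + n x/sigma + (n x/sigma)^2 + sigma k(x), where k(x) = (m+1)(1-x)^m tends to the
    Dirac mass at 0. The ratio of consecutive weights turns n(n+1) phi_(n-1) into a bounded
    operator, and the Gevrey bound on W with sigma < sigma_* turns d_x^n (W psi) into a
    convolution with a geometric sequence. Hence the energy sum_(n <= M) g_n kap_n |phi_n|^2,
    integrated against a cutoff supported in x >= a and constant along the characteristics,
    grows at most exponentially, with a rate independent of M, m and a; the boundary term at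
    x = 1 has the good sign. Letting a -> 0 bounds every phi_n in L^2(0,1), so that psi(t)
    extends smoothly to x = 0; m -> oo produces the boundary seminorm and M -> oo the full norm.
    Thus N(t2) <= exp(c (t2 - t1)) N(t1) for the norm N, which implies the integral inequality. *)
From Coquelicot Require Import Coquelicot.
From Stdlib Require Import Reals Lra Lia Psatz Arith ClassicalEpsilon.
Require Import Defs.
Open Scope R_scope.

(** * Leibniz sums and geometric convolutions *)

(** The obstacle is the degenerate end x = 0: for t > 0 nothing is known there in advance, neither
    smoothness nor integrability, so every integration by parts has to stay away from it.
    Characteristics move away from 0, since x' = x^2 >= 0. Hence a cutoff transported by the flow
    costs nothing, and a nonincreasing weight k is harmless, which is why an approximate Dirac mass
    at 0 may enter the energy. Dissipation comes from the commutator: -2(n+1) x phi_n contributes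
    -4(n+1) x to the rate of |phi_n|^2, and this pays for the divergence 2x of the field x^2 and for
    x^2 kap_n', because x kap_n' <= 2 kap_n. The system is triangular: apart from transport, the
    equation of phi_n involves only psi and phi_0, ..., phi_n, so the sum over n <= M closes for
    every M. The function psi is not part of the energy; it is recovered from phi_0 by the Dirichlet
    condition. It comes multiplied by kap_0, so only the integral of k matters, not its size, and
    the rate does not depend on m. *)

Lemma sum_f_R0_le_le (a b : nat -> R) (M : nat) :
  (forall n, (n <= M)%nat -> a n <= b n) -> sum_f_R0 a M <= sum_f_R0 b M.
Proof.
  intros H; induction M as [|M IH]; simpl.
  - apply H; lia.
  - apply Rplus_le_compat; [apply IH; intros; apply H; lia | apply H; lia].
Qed.

Lemma sum_f_R0_nonneg (a : nat -> R) (M : nat) :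
  (forall n, (n <= M)%nat -> 0 <= a n) -> 0 <= sum_f_R0 a M.
Proof.
  intros H; induction M as [|M IH]; simpl.
  - apply H; lia.
  - apply Rplus_le_le_0_compat; [apply IH; intros; apply H; lia | apply H; lia].
Qed.

Lemma sum_f_R0_mult_l (c : R) (a : nat -> R) (M : nat) :
  sum_f_R0 (fun n => c * a n) M = c * sum_f_R0 a M.
Proof. induction M as [|M IH]; simpl; [reflexivity | rewrite IH; ring]. Qed.

(** Pascal's rule as the definition, with value 0 for k > n, makes the Leibniz rule a direct
    induction; the factorial formula is recovered in [binom_fact]. *)
Fixpoint binom (n k : nat) : R :=
  match n, k with
  | _, O => 1
  | O, S _ => 0
  | S n', S k' => binom n' k' + binom n' (S k')
  end.

Lemma binom_0 (n : nat) : binom n 0 = 1.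
Proof. destruct n; reflexivity. Qed.

Lemma binom_gt (n : nat) : forall k, (n < k)%nat -> binom n k = 0.
Proof.
  induction n as [|n IH]; intros [|k] Hk; simpl; try lia; try reflexivity.
  rewrite !IH by lia; ring.
Qed.

Lemma binom_nonneg (n : nat) : forall k, 0 <= binom n k.
Proof.
  induction n as [|n IH]; intros [|k]; simpl; try lra.
  generalize (IH k) (IH (S k)); lra.
Qed.

Lemma binom_fact (n : nat) : forall k, (k <= n)%nat ->
  binom n k * (INR (fact k) * INR (fact (n - k))) = INR (fact n).
Proof.
  induction n as [|n IH]; intros k Hk.
  - replace k with 0%nat by lia; simpl; ring.
  - destruct k as [|k].
    + rewrite binom_0, Nat.sub_0_r; simpl (fact 0); rewrite INR_1; ring.
    + assert (Hn : INR (fact (S n)) = (INR n + 1) * INR (fact n))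
        by (rewrite fact_simpl, mult_INR, S_INR; ring).
      assert (Hk' : INR (fact (S k)) = (INR k + 1) * INR (fact k))
        by (rewrite fact_simpl, mult_INR, S_INR; ring).
      change (binom (S n) (S k)) with (binom n k + binom n (S k)).
      replace (S n - S k)%nat with (n - k)%nat by lia.
      pose proof (IH k ltac:(lia)) as I1.
      destruct (Nat.eq_dec k n) as [->|Hne].
      * rewrite (binom_gt n (S n)) by lia. rewrite Hn.
        transitivity ((INR n + 1) * (binom n n * (INR (fact n) * INR (fact (n - n)))));
          [ring | rewrite I1; ring].
      * pose proof (IH (S k) ltac:(lia)) as I2.
        replace (n - k)%nat with (S (n - S k)) in I1 |- * by lia.
        assert (Hd : INR (fact (S (n - S k))) = (INR n - INR k) * INR (fact (n - S k))).
        { rewrite fact_simpl, mult_INR.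
          replace (S (n - S k)) with (n - k)%nat by lia.
          rewrite minus_INR by lia; ring. }
        rewrite Hn. rewrite Hd in *. rewrite Hk' in *.
        replace ((INR n + 1) * INR (fact n))
          with ((INR k + 1) * INR (fact n) + (INR n - INR k) * INR (fact n)) by ring.
        transitivity ((INR k + 1) * (binom n k * (INR (fact k) * ((INR n - INR k) * INR (fact (n - S k)))))
          + (INR n - INR k) * (binom n (S k) * ((INR k + 1) * INR (fact k) * INR (fact (n - S k))))).
        { ring. }
        rewrite I1, I2. ring.
Qed.

Definition leibniz (n : nat) (g p : nat -> R) : R :=
  sum_f_R0 (fun k => binom n k * g (n - k)%nat * p k) n.

(** Pascal's rule: this is the combinatorial content of differentiating a Leibniz sum once more. *)
Lemma leibniz_succ (n : nat) (g p : nat -> R) :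
  leibniz (S n) g p = leibniz n (fun i => g (S i)) p + leibniz n g (fun i => p (S i)).
Proof.
  unfold leibniz.
  rewrite (decomp_sum _ (S n)) by lia. simpl pred.
  rewrite (sum_eq (fun i => binom (S n) (S i) * g (S n - S i)%nat * p (S i))
    (fun i => binom n (S i) * g (S n - S i)%nat * p (S i)
              + binom n i * g (n - i)%nat * p (S i))).
  2: { intros i Hi. simpl (binom (S n) (S i)).
       replace (S n - S i)%nat with (n - i)%nat by lia. ring. }
  rewrite plus_sum.
  (* The extra top term carries [binom n (S n)] = 0, so both sums can be given the same length. *)
  assert (E : sum_f_R0 (fun k => binom n k * g (S n - k)%nat * p k) (S n)
     = sum_f_R0 (fun k => binom n k * g (S (n - k)) * p k) n).
  { rewrite tech5, (binom_gt n (S n)) by lia.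
    rewrite (sum_eq _ (fun k => binom n k * g (S (n - k)) * p k)).
    - ring.
    - intros i Hi. replace (S n - i)%nat with (S (n - i)) by lia. reflexivity. }
  rewrite <- E, (decomp_sum _ (S n)) by lia. simpl pred.
  rewrite !binom_0. ring.
Qed.

Lemma Rabs_leibniz (n : nat) (g p gam b : nat -> R) :
  (forall i, Rabs (g i) <= gam i) -> (forall i, Rabs (p i) <= b i) ->
  Rabs (leibniz n g p) <= leibniz n gam b.
Proof.
  intros Hg Hp. unfold leibniz. eapply Rle_trans; [apply Rsum_abs|].
  apply sum_f_R0_le_le; intros k _.
  rewrite !Rabs_mult, (Rabs_right (binom n k)) by (apply Rle_ge, binom_nonneg).
  rewrite !Rmult_assoc. apply Rmult_le_compat_l; [apply binom_nonneg|].
  apply Rmult_le_compat; try apply Rabs_pos; auto.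
Qed.

Lemma leibniz_plus_r (n : nat) (g p q : nat -> R) :
  leibniz n g (fun i => p i + q i) = leibniz n g p + leibniz n g q.
Proof.
  unfold leibniz. rewrite <- plus_sum. apply sum_eq; intros; ring.
Qed.

Definition geom_conv (r : R) (z : nat -> R) (n : nat) : R :=
  sum_f_R0 (fun k => r ^ (n - k) * z k) n.

Lemma geom_conv_succ (r : R) (z : nat -> R) (n : nat) :
  geom_conv r z (S n) = r * geom_conv r z n + z (S n).
Proof.
  unfold geom_conv. rewrite tech5, Nat.sub_diag, <- sum_f_R0_mult_l.
  simpl (r ^ 0). rewrite Rmult_1_l. f_equal. apply sum_eq; intros k Hk.
  replace (S n - k)%nat with (S (n - k)) by lia.
  simpl; ring.
Qed.

(** Young's inequality for the convolution of an l^1 and an l^2 sequence, truncated at M: the l^1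
    norm of r^n is 1/(1 - r). *)
Lemma geom_conv_sqr_sum (r : R) (z : nat -> R) (M : nat) : 0 <= r < 1 ->
  sum_f_R0 (fun n => geom_conv r z n ^ 2) M
    <= / (1 - r) ^ 2 * sum_f_R0 (fun n => z n ^ 2) M.
Proof.
  intros Hr. set (d := 1 - r). assert (Hd : 0 < d) by (unfold d; lra).
  (* Strengthened for the induction by the term in the last convolution value c. The step is the
     convexity of the square for r c + w = r c + d (w/d), with r + d = 1. *)
  assert (H : d * (d * sum_f_R0 (fun n => geom_conv r z n ^ 2) M
                    + r * geom_conv r z M ^ 2) <= sum_f_R0 (fun n => z n ^ 2) M).
  { induction M as [|M IH].
    - simpl. unfold geom_conv; simpl. rewrite !Rmult_1_l, !Rmult_1_r.
      replace (d * (d * (z 0%nat * z 0%nat) + r * (z 0%nat * z 0%nat)))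
        with (d * (z 0%nat * z 0%nat)) by (unfold d; ring).
      pose proof (Rle_0_sqr (z 0%nat)); unfold Rsqr in *; unfold d; nra.
    - change (sum_f_R0 (fun n => geom_conv r z n ^ 2) (S M)) with
        (sum_f_R0 (fun n => geom_conv r z n ^ 2) M + geom_conv r z (S M) ^ 2).
      change (sum_f_R0 (fun n => z n ^ 2) (S M)) with
        (sum_f_R0 (fun n => z n ^ 2) M + z (S M) ^ 2).
      rewrite geom_conv_succ.
      set (c := geom_conv r z M) in *. set (w := z (S M)).
      set (A := sum_f_R0 (fun n => geom_conv r z n ^ 2) M) in *.
      (* The convexity defect: d (r c + w)^2 = d r c^2 + w^2 - r (d c - w)^2. *)
      assert (0 <= r * (d * c - w) ^ 2) by (apply Rmult_le_pos; [lra | apply pow2_ge_0]).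
      replace (d * (d * (A + (r * c + w) ^ 2) + r * (r * c + w) ^ 2))
        with (d * (d * A + r * c ^ 2) + w ^ 2 - r * (d * c - w) ^ 2)
        by (unfold d; ring).
      lra. }
  apply (Rmult_le_reg_l (d ^ 2)); [apply pow_lt, Hd|].
  rewrite <- Rmult_assoc, Rinv_r, Rmult_1_l by (apply pow_nonzero; lra).
  assert (0 <= d * (r * geom_conv r z M ^ 2)).
  { apply Rmult_le_pos; [lra|]. apply Rmult_le_pos; [lra | apply pow2_ge_0]. }
  simpl (d ^ 2); lra.
Qed.

(** * Pointwise energy estimate *)

Definition sqrt_gweight (s : R) (n : nat) : R :=
  s ^ n / (INR (fact n) * INR (fact (S n))).

Lemma gweight_sqr (s : R) (n : nat) : gweight s n = sqrt_gweight s n ^ 2.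
Proof.
  unfold gweight, sqrt_gweight.
  replace (2 * n)%nat with (n * 2)%nat by lia. rewrite pow_mult.
  pose proof (INR_fact_neq_0 n); pose proof (INR_fact_neq_0 (S n)).
  field; auto.
Qed.

Lemma sqrt_gweight_pos (s : R) (n : nat) : 0 < s -> 0 < sqrt_gweight s n.
Proof.
  intros Hs. apply Rdiv_lt_0_compat; [apply pow_lt, Hs|].
  apply Rmult_lt_0_compat; apply INR_fact_lt_0.
Qed.

Lemma gweight_pos (s : R) (n : nat) : 0 < s -> 0 < gweight s n.
Proof. intros Hs. rewrite gweight_sqr. apply pow_lt, sqrt_gweight_pos, Hs. Qed.

Lemma INR_fact_succ (n : nat) : INR (fact (S n)) = (INR n + 1) * INR (fact n).
Proof. rewrite fact_simpl, mult_INR, S_INR; ring. Qed.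

(** This exact ratio is the purpose of the factorials in the weights: the coefficient n(n+1) of
    phi_(n-1) is absorbed when the weight of index n is traded for that of index n-1, leaving only
    the factor s. *)
Lemma sqrt_gweight_succ (s : R) (n : nat) :
  sqrt_gweight s (S n) * ((INR n + 1) * (INR n + 2)) = s * sqrt_gweight s n.
Proof.
  unfold sqrt_gweight. rewrite (INR_fact_succ (S n)), (INR_fact_succ n), S_INR.
  pose proof (INR_fact_neq_0 n). pose proof (pos_INR n). simpl (s ^ S n).
  field. repeat split; lra.
Qed.

(* [k] is the value at [x] of an approximation of the Dirac mass at [0], which
   produces the boundary seminorm in the limit. *)
Definition kap (s k x : R) (n : nat) : R :=
  1 + INR n * (x / s) + (INR n * (x / s)) ^ 2 + s * k.

(** The x-derivative of [kap], with a number k' in place of the derivative of k, so that the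
    pointwise estimate remains pure algebra. *)
Definition kap_deriv (s k' x : R) (n : nat) : R :=
  INR n / s + 2 * (INR n / s) ^ 2 * x + s * k'.

(** Chosen from x/s <= 1/s and n + 1 <= 2n for n >= 1; its square bounds both kap_(n+1)/kap_n and
    kap_n/((n+1)^2 kap_0). *)
Definition kap_const (s : R) : R := 2 * (1 + / s).

Lemma kap_0 (s k x : R) : kap s k x 0 = 1 + s * k.
Proof. unfold kap; simpl; ring. Qed.

Section KapBounds.
Context (s k x : R) (Hs : 0 < s) (Hk : 0 <= k) (Hx : 0 <= x <= 1).

Lemma kap_const_ge_2 : 2 <= kap_const s.
Proof. unfold kap_const. pose proof (Rinv_0_lt_compat s Hs). lra. Qed.

Lemma div_bounds : 0 <= x / s <= / s.
Proof.
  pose proof (Rinv_0_lt_compat s Hs). unfold Rdiv. split; nra.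
Qed.

Lemma kap_0_le (n : nat) : kap s k x 0 <= kap s k x n.
Proof.
  rewrite kap_0. unfold kap. pose proof div_bounds. pose proof (pos_INR n).
  pose proof (pow2_ge_0 (INR n * (x / s))).
  assert (0 <= INR n * (x / s)) by (apply Rmult_le_pos; lra). lra.
Qed.

Lemma kap_ge_1 (n : nat) : 1 <= kap s k x n.
Proof.
  eapply Rle_trans; [|apply kap_0_le]. rewrite kap_0.
  assert (0 <= s * k) by (apply Rmult_le_pos; lra). lra.
Qed.

(** Quadratic growth in n is affordable: after a square root it costs a factor n + 1, which the
    factorials of the Gevrey estimate give back. *)
Lemma kap_le_mult_0 (n : nat) :
  kap s k x n <= (kap_const s * (INR n + 1)) ^ 2 * kap s k x 0.
Proof.
  rewrite kap_0. unfold kap, kap_const.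
  pose proof div_bounds as Hd. pose proof (pos_INR n) as Hn.
  pose proof (Rinv_0_lt_compat s Hs).
  assert (0 <= s * k) by (apply Rmult_le_pos; lra).
  set (a := INR n) in *. set (d := x / s) in *. set (i := / s) in *.
  assert (Hz : 0 <= a * d <= a * i).
  { split; [apply Rmult_le_pos; lra | apply Rmult_le_compat_l; lra]. }
  assert (Hq : 1 + a * d + (a * d) ^ 2 <= (2 * (1 + i) * (a + 1)) ^ 2).
  { assert (0 <= a * i) by lra.
    assert (1 + a * d + (a * d) ^ 2 <= (1 + a * d) ^ 2) by nra.
    assert ((1 + a * d) ^ 2 <= (2 * (1 + i) * (a + 1)) ^ 2).
    { apply pow_incr. split; nra. }
    lra. }
  assert (H1 : 1 <= (2 * (1 + i) * (a + 1)) ^ 2).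
  { eapply Rle_trans; [|exact Hq]. pose proof (pow2_ge_0 (a * d)). lra. }
  set (Q := (2 * (1 + i) * (a + 1)) ^ 2) in *. nra.
Qed.

(** For n >= 1 doubling n x/s covers the step to n + 1, at the cost of a factor 4. For n = 0 there
    is nothing to double, and x/s <= 1/s is used instead. *)
Lemma kap_succ_le (n : nat) : kap s k x (S n) <= kap_const s ^ 2 * kap s k x n.
Proof.
  unfold kap, kap_const. rewrite S_INR.
  pose proof div_bounds as Hd. pose proof (pos_INR n) as Hn.
  pose proof (Rinv_0_lt_compat s Hs) as Hi.
  assert (Hsk : 0 <= s * k) by (apply Rmult_le_pos; lra).
  set (d := x / s) in *. set (i := / s) in *. set (sk := s * k) in *.
  assert (H4 : 4 <= (2 * (1 + i)) ^ 2) by nra.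
  destruct n as [|m].
  - simpl INR. replace (0 + 1) with 1 by ring.
    assert (1 + d + d ^ 2 <= (2 * (1 + i)) ^ 2).
    { assert (d ^ 2 <= i ^ 2) by (apply pow_incr; lra). nra. }
    nra.
  - assert (H1 : 1 <= INR (S m)) by (rewrite S_INR; pose proof (pos_INR m); lra).
    set (a := INR (S m)) in *.
    assert (Had : 0 <= a * d) by (apply Rmult_le_pos; lra).
    assert (H2 : 0 <= (a + 1) * d <= 2 * (a * d)) by (split; nra).
    assert (H3 : ((a + 1) * d) ^ 2 <= (2 * (a * d)) ^ 2) by (apply pow_incr; lra).
    assert (0 <= (a * d) ^ 2) by apply pow2_ge_0.
    set (K := (2 * (1 + i)) ^ 2) in *.
    assert (4 * (1 + a * d + (a * d) ^ 2 + sk) <= K * (1 + a * d + (a * d) ^ 2 + sk))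
      by (apply Rmult_le_compat_r; lra).
    nra.
Qed.

Lemma sqrt_kap_le_mult_0 (n : nat) :
  sqrt (kap s k x n) <= kap_const s * (INR n + 1) * sqrt (kap s k x 0).
Proof.
  pose proof kap_const_ge_2. pose proof (pos_INR n).
  rewrite <- (sqrt_pow2 (kap_const s * (INR n + 1))) by nra.
  rewrite <- sqrt_mult_alt by (apply pow2_ge_0).
  apply sqrt_le_1_alt, kap_le_mult_0.
Qed.

Lemma sqrt_kap_succ_le (n : nat) :
  sqrt (kap s k x (S n)) <= kap_const s * sqrt (kap s k x n).
Proof.
  pose proof kap_const_ge_2.
  rewrite <- (sqrt_pow2 (kap_const s)) by lra.
  rewrite <- sqrt_mult_alt by (apply pow2_ge_0).
  apply sqrt_le_1_alt, kap_succ_le.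
Qed.

(** Apart from k, [kap] is a polynomial of degree 2 in x with nonnegative coefficients, and k does
    not increase; so x kap' <= 2 kap. The right side is exactly the damping available from the
    commutator, and the inequality already closes at n = 0. *)
Lemma kap_transport (k' : R) (n : nat) : k' <= 0 ->
  2 * x * kap s k x n + x ^ 2 * kap_deriv s k' x n
    <= 4 * (INR n + 1) * x * kap s k x n.
Proof.
  intros Hk'. pose proof (kap_ge_1 n) as H1. pose proof (pos_INR n).
  pose proof (Rinv_0_lt_compat s Hs).
  assert (E : x ^ 2 * kap_deriv s k' x n <= 2 * x * kap s k x n).
  { unfold kap_deriv, kap. pose proof div_bounds as Hd.
    assert (Ha : 0 <= INR n * (x / s)) by (apply Rmult_le_pos; lra).
    replace (x ^ 2 * (INR n / s + 2 * (INR n / s) ^ 2 * x + s * k'))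
      with (x * (INR n * (x / s)) + 2 * x * (INR n * (x / s)) ^ 2 + x ^ 2 * s * k')
      by (field; lra).
    assert (0 <= x * (INR n * (x / s))) by (apply Rmult_le_pos; lra).
    assert (0 <= s * k) by (apply Rmult_le_pos; lra).
    assert (0 <= x * (s * k)) by (apply Rmult_le_pos; lra).
    assert (0 <= x ^ 2 * s) by (apply Rmult_le_pos; [apply pow2_ge_0 | lra]).
    nra. }
  assert (0 <= x * kap s k x n) by (apply Rmult_le_pos; lra).
  assert (0 <= INR n * (x * kap s k x n)) by (apply Rmult_le_pos; lra).
  nra.
Qed.

End KapBounds.

(** * Gevrey bounds on the potential against the weights *)

Lemma binom_ge_1 (n : nat) : forall k, (k <= n)%nat -> 1 <= binom n k.
Proof.
  induction n as [|n IH]; intros [|k] Hk; simpl; try lia; try lra.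
  pose proof (IH k ltac:(lia)). pose proof (binom_nonneg n (S k)). lra.
Qed.

Definition gevrey_bound (C0 sigs : R) (i : nat) : R :=
  C0 * / sigs ^ i * INR (fact i) ^ 2.

Lemma sqrt_gweight_gevrey_0 (C0 sigs s : R) (n : nat) : 0 < sigs -> 0 < s ->
  sqrt_gweight s n * gevrey_bound C0 sigs n = C0 * (s / sigs) ^ n / (INR n + 1).
Proof.
  intros Hg Hs. unfold sqrt_gweight, gevrey_bound, Rdiv.
  rewrite Rpow_mult_distr, pow_inv, INR_fact_succ.
  pose proof (INR_fact_neq_0 n). pose proof (pos_INR n).
  pose proof (pow_lt sigs n Hg). field. repeat split; lra.
Qed.

(** After cancellation the quotient of the two sides is j! (n-j-1)!/n!, which is at most 1. The
    factor 1/(n+1) on the right is a true gain, kept to compensate the growth of [kap] in n. *)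
Lemma sqrt_gweight_gevrey_succ (C0 sigs s : R) (n j : nat) :
  0 < C0 -> 0 < sigs -> 0 < s -> (S j <= n)%nat ->
  sqrt_gweight s n * (binom n (S j) * gevrey_bound C0 sigs (n - S j))
    <= C0 * s * (s / sigs) ^ (n - S j) * sqrt_gweight s j / (INR n + 1).
Proof.
  intros HC Hg Hs Hj.
  assert (Hf : INR (fact j) * INR (fact (n - S j)) <= INR (fact n)).
  { rewrite <- (binom_fact n (S j) Hj), INR_fact_succ.
    pose proof (binom_ge_1 n (S j) Hj). pose proof (pos_INR j).
    pose proof (INR_fact_lt_0 j). pose proof (INR_fact_lt_0 (n - S j)).
    assert (0 < INR (fact j) * INR (fact (n - S j))) by (apply Rmult_lt_0_compat; lra).
    set (A := INR (fact j) * INR (fact (n - S j))) in *.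
    replace (binom n (S j) * ((INR j + 1) * INR (fact j) * INR (fact (n - S j))))
      with (binom n (S j) * (INR j + 1) * A) by (unfold A; ring).
    assert (1 <= binom n (S j) * (INR j + 1)) by nra. nra. }
  unfold sqrt_gweight, gevrey_bound, Rdiv.
  rewrite Rpow_mult_distr, pow_inv, (INR_fact_succ n).
  pose proof (binom_fact n (S j) Hj) as Hb. rewrite INR_fact_succ in Hb |- *.
  replace (s ^ n) with (s ^ (n - S j) * s ^ j * s)
    by (rewrite Rmult_assoc, (Rmult_comm (s ^ j)), tech_pow_Rmult, <- pow_add; f_equal; lia).
  pose proof (INR_fact_lt_0 j) as F1. pose proof (INR_fact_lt_0 (n - S j)) as F2.
  pose proof (INR_fact_lt_0 n) as F3. pose proof (pos_INR n). pose proof (pos_INR j).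
  pose proof (pow_lt sigs (n - S j) Hg). pose proof (pow_lt s (n - S j) Hs).
  pose proof (pow_lt s j Hs).
  set (fj := INR (fact j)) in *. set (fd := INR (fact (n - S j))) in *.
  set (fn := INR (fact n)) in *.
  assert (Eb : binom n (S j) = fn / ((INR j + 1) * fj * fd)).
  { rewrite <- Hb. field. repeat split; lra. }
  rewrite Eb.
  match goal with |- ?L <= ?Rr =>
    replace L with (Rr * (fj * fd / fn)) by (field; repeat split; lra);
    assert (0 <= Rr) end.
  { assert (0 < / (INR n + 1)) by (apply Rinv_0_lt_compat; lra).
    assert (0 < / (fj * ((INR j + 1) * fj)))
      by (apply Rinv_0_lt_compat; repeat apply Rmult_lt_0_compat; lra).
    assert (0 < / sigs ^ (n - S j)) by (apply Rinv_0_lt_compat; lra).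
    repeat apply Rmult_le_pos; lra. }
  rewrite <- (Rmult_1_r (C0 * _ * _ * _ * _)) at 2.
  apply Rmult_le_compat_l; [assumption|].
  apply (Rmult_le_reg_r fn); [lra|]. field_simplify; lra.
Qed.

(* The weighted sequence [z] of the pointwise estimate: [z 0] stands for psi, and
   [z (S n)] for the [n]-th derivative of d_x psi. *)
Definition zseq (s k x : R) (b : nat -> R) (n : nat) : R :=
  match n with
  | O => sqrt (kap s k x 0) * b 0%nat
  | S m => sqrt_gweight s m * sqrt (kap s k x m) * b (S m)
  end.

Lemma zseq_nonneg (s k x : R) (b : nat -> R) (n : nat) :
  0 < s -> (forall i, 0 <= b i) -> 0 <= zseq s k x b n.
Proof.
  intros Hs Hb. destruct n as [|m]; simpl.
  - apply Rmult_le_pos; [apply sqrt_pos | apply Hb].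
  - pose proof (sqrt_gweight_pos s m Hs). pose proof (sqrt_pos (kap s k x m)).
    apply Rmult_le_pos; [apply Rmult_le_pos; lra | apply Hb].
Qed.

Lemma zseq_0_sqr (s k x : R) (b : nat -> R) : 0 < s -> 0 <= k -> 0 <= x <= 1 ->
  zseq s k x b 0 ^ 2 = kap s k x 0 * b 0%nat ^ 2.
Proof.
  intros Hs Hk Hx. pose proof (kap_ge_1 s k x Hs Hk Hx 0). unfold zseq.
  rewrite Rpow_mult_distr, pow2_sqrt by lra. reflexivity.
Qed.

Lemma zseq_succ_sqr (s k x : R) (b : nat -> R) (n : nat) : 0 < s -> 0 <= k -> 0 <= x <= 1 ->
  zseq s k x b (S n) ^ 2 = gweight s n * kap s k x n * b (S n) ^ 2.
Proof.
  intros Hs Hk Hx. pose proof (kap_ge_1 s k x Hs Hk Hx n). unfold zseq.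
  rewrite !Rpow_mult_distr, pow2_sqrt, gweight_sqr by lra. reflexivity.
Qed.

#[local] Opaque kap_const sqrt_gweight gweight kap.

(** The gain 1/(n+1) cancels the n + 1 of [sqrt_kap_le_mult_0], and the powers of s/sigs that remain
    form a geometric convolution. The index of [zseq] counts the x-derivatives of psi, so psi itself
    enters at index 0 through kap_0, and kap_0 <= kap_j serves the other indices. *)
Lemma leibniz_weighted (C0 sigs s k x : R) (b : nat -> R) (n : nat) :
  0 < C0 -> 0 < sigs -> 0 < s -> 0 <= k -> 0 <= x <= 1 -> (forall i, 0 <= b i) ->
  sqrt_gweight s n * sqrt (kap s k x n) * leibniz n (gevrey_bound C0 sigs) b
    <= C0 * kap_const s * (1 + s) * geom_conv (s / sigs) (zseq s k x b) n.
Proof.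
  intros HC Hg Hs Hk Hx Hb. unfold leibniz, geom_conv.
  rewrite <- !sum_f_R0_mult_l. apply sum_f_R0_le_le. intros [|j] Hj.
  - rewrite binom_0, Nat.sub_0_r. simpl zseq.
    replace (sqrt_gweight s n * sqrt (kap s k x n) * (1 * gevrey_bound C0 sigs n * b 0%nat))
      with (sqrt_gweight s n * gevrey_bound C0 sigs n * (sqrt (kap s k x n) * b 0%nat)) by ring.
    rewrite sqrt_gweight_gevrey_0 by assumption.
    pose proof (sqrt_kap_le_mult_0 s k x Hs Hk Hx n) as Hq.
    pose proof (pos_INR n) as Hn. pose proof (Hb 0%nat).
    assert (Hr : 0 < (s / sigs) ^ n) by (apply pow_lt, Rdiv_lt_0_compat; assumption).
    pose proof (sqrt_pos (kap s k x 0)). pose proof (kap_const_ge_2 s Hs).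
    set (r := (s / sigs) ^ n) in *. set (q := sqrt (kap s k x n)) in *.
    set (q0 := sqrt (kap s k x 0)) in *.
    apply Rle_trans with (C0 * r / (INR n + 1) * (kap_const s * (INR n + 1) * q0 * b 0%nat)).
    + apply Rmult_le_compat_l.
      * apply Rdiv_le_0_compat; [apply Rmult_le_pos; lra | lra].
      * apply Rmult_le_compat_r; assumption.
    + replace (C0 * r / (INR n + 1) * (kap_const s * (INR n + 1) * q0 * b 0%nat))
        with (C0 * kap_const s * r * (q0 * b 0%nat)) by (field; lra).
      assert (0 <= C0 * kap_const s * r * (q0 * b 0%nat))
        by (repeat apply Rmult_le_pos; lra).
      nra.
  - simpl zseq.
    replace (sqrt_gweight s n * sqrt (kap s k x n) *
              (binom n (S j) * gevrey_bound C0 sigs (n - S j) * b (S j)))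
      with (sqrt_gweight s n * (binom n (S j) * gevrey_bound C0 sigs (n - S j)) *
              (sqrt (kap s k x n) * b (S j))) by ring.
    pose proof (sqrt_gweight_gevrey_succ C0 sigs s n j HC Hg Hs Hj) as Hw.
    pose proof (sqrt_kap_le_mult_0 s k x Hs Hk Hx n) as Hq.
    pose proof (sqrt_le_1_alt _ _ (kap_0_le s k x Hs Hx j)) as Hq'.
    pose proof (pos_INR n) as Hn. pose proof (Hb (S j)).
    assert (Hr : 0 < (s / sigs) ^ (n - S j)) by (apply pow_lt, Rdiv_lt_0_compat; assumption).
    pose proof (sqrt_pos (kap s k x 0)). pose proof (kap_const_ge_2 s Hs).
    pose proof (sqrt_pos (kap s k x n)). pose proof (sqrt_pos (kap s k x j)).
    pose proof (sqrt_gweight_pos s j Hs).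
    set (r := (s / sigs) ^ (n - S j)) in *. set (q := sqrt (kap s k x n)) in *.
    set (q0 := sqrt (kap s k x 0)) in *. set (qj := sqrt (kap s k x j)) in *.
    set (hj := sqrt_gweight s j) in *.
    eapply Rle_trans.
    { apply Rmult_le_compat_r; [|exact Hw]. apply Rmult_le_pos; assumption. }
    apply Rle_trans with
      (C0 * s * r * hj / (INR n + 1) * (kap_const s * (INR n + 1) * qj * b (S j))).
    + apply Rmult_le_compat_l.
      * apply Rdiv_le_0_compat; [repeat apply Rmult_le_pos; lra | lra].
      * apply Rmult_le_compat_r; [assumption|]. eapply Rle_trans; [exact Hq|].
        apply Rmult_le_compat_l; [apply Rmult_le_pos; lra | assumption].
    + replace (C0 * s * r * hj / (INR n + 1) * (kap_const s * (INR n + 1) * qj * b (S j)))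
        with (C0 * kap_const s * s * (r * (hj * qj * b (S j)))) by (field; lra).
      assert (0 <= C0 * kap_const s * (r * (hj * qj * b (S j))))
        by (repeat apply Rmult_le_pos; lra).
      nra.
Qed.

(** The part with s alone comes from n(n+1) phi_(n-1), the part with C0 from the potential, where
    the inverse square is the constant of Young's inequality. The outer 2 passes from (|p| + |q|)^2
    to p^2 + q^2. *)
Definition energy_const (C0 sigs s : R) : R :=
  2 * (2 * s * kap_const s + 2 * (C0 * kap_const s * (1 + s)) * (1 + / (1 - s / sigs) ^ 2)).

Lemma sum_shift_le (z : nat -> R) (M : nat) :
  sum_f_R0 (fun n => z n ^ 2) M <= z 0%nat ^ 2 + sum_f_R0 (fun n => z (S n) ^ 2) M.
Proof.
  pose proof (decomp_sum (fun n => z n ^ 2) (S M) ltac:(lia)) as H. simpl pred in H.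
  rewrite tech5 in H. pose proof (pow2_ge_0 (z (S M))). lra.
Qed.

(** Algebra at a single point: p n + i q n stands for the n-th x-derivative of psi, and pt n + i qt
    n for the time derivative of phi_n. Adding x^2 phi_(n+1) to the latter removes the only term of
    higher order, so nothing beyond the index M of the energy is left over. *)
Lemma pointwise_energy (C0 sigs s : R) : 0 < C0 -> 0 < sigs -> 0 < s -> s < sigs ->
  forall (M : nat) (x k k' : R) (p q gr gi pt qt : nat -> R),
  0 <= x <= 1 -> 0 <= k -> k' <= 0 ->
  (forall i, Rabs (gr i) <= gevrey_bound C0 sigs i) ->
  (forall i, Rabs (gi i) <= gevrey_bound C0 sigs i) ->
  (forall n, pt n = - (x ^ 2 * p (S (S n)) + 2 * (INR n + 1) * x * p (S n)
                       + INR n * (INR n + 1) * p n)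
                    + (leibniz n gr p - leibniz n gi q)) ->
  (forall n, qt n = - (x ^ 2 * q (S (S n)) + 2 * (INR n + 1) * x * q (S n)
                       + INR n * (INR n + 1) * q n)
                    + (leibniz n gr q + leibniz n gi p)) ->
  sum_f_R0 (fun n => gweight s n *
     ((2 * x * kap s k x n + x ^ 2 * kap_deriv s k' x n) * (p (S n) ^ 2 + q (S n) ^ 2)
      + kap s k x n * (2 * p (S n) * (pt n + x ^ 2 * p (S (S n)))
                     + 2 * q (S n) * (qt n + x ^ 2 * q (S (S n)))))) M
  <= energy_const C0 sigs s *
     (sum_f_R0 (fun n => gweight s n * kap s k x n * (p (S n) ^ 2 + q (S n) ^ 2)) M
      + kap s k x 0 * (p 0%nat ^ 2 + q 0%nat ^ 2)).
Proof.
  intros HC Hg Hs Hsg M x k k' p q gr gi pt qt Hx Hk Hk' Hgr Hgi Hpt Hqt.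
  set (b := fun j => Rabs (p j) + Rabs (q j)).
  assert (Hb : forall j, 0 <= b j)
    by (intro j; unfold b; pose proof (Rabs_pos (p j)); pose proof (Rabs_pos (q j)); lra).
  assert (Hb2 : forall j, b j ^ 2 <= 2 * (p j ^ 2 + q j ^ 2)).
  { intro j. unfold b. rewrite <- (pow2_abs (p j)), <- (pow2_abs (q j)).
    pose proof (pow2_ge_0 (Rabs (p j) - Rabs (q j))). lra. }
  set (z := zseq s k x b). set (c := geom_conv (s / sigs) z).
  set (K := kap_const s). set (C1 := C0 * K * (1 + s)).
  assert (HK : 2 <= K) by (apply kap_const_ge_2; assumption).
  assert (HC1 : 0 <= C1) by (unfold C1; repeat apply Rmult_le_pos; lra).
  assert (Hz : forall n, 0 <= z n) by (intro; apply zseq_nonneg; assumption).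
  assert (Hcomb : forall u v u' v' : R,
     Rabs (u * u' + v * v') <= (Rabs u + Rabs v) * (Rabs u' + Rabs v')).
  { intros. eapply Rle_trans; [apply Rabs_triang|]. rewrite !Rabs_mult.
    pose proof (Rabs_pos u); pose proof (Rabs_pos v);
    pose proof (Rabs_pos u'); pose proof (Rabs_pos v'). nra. }
  assert (Hterm : forall n, gweight s n *
     ((2 * x * kap s k x n + x ^ 2 * kap_deriv s k' x n) * (p (S n) ^ 2 + q (S n) ^ 2)
      + kap s k x n * (2 * p (S n) * (pt n + x ^ 2 * p (S (S n)))
                     + 2 * q (S n) * (qt n + x ^ 2 * q (S (S n)))))
     <= (s * K + 2 * C1) * z (S n) ^ 2 + s * K * z n ^ 2 + 2 * C1 * c n ^ 2).
  { intros n.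
    pose proof (kap_transport s k x Hs Hk Hx k' n Hk') as Htr.
    pose proof (kap_ge_1 s k x Hs Hk Hx n) as Hk1.
    pose proof (gweight_pos s n Hs) as Hgw.
    set (L := leibniz n (gevrey_bound C0 sigs) b).
    assert (HL : Rabs (p (S n) * (leibniz n gr p - leibniz n gi q)
                    + q (S n) * (leibniz n gr q + leibniz n gi p)) <= 2 * (b (S n) * L)).
    { assert (Ha : forall u v, Rabs (u * (leibniz n gr p - leibniz n gi q)
                    + v * (leibniz n gr q + leibniz n gi p))
          <= (Rabs u + Rabs v) * (2 * L)).
      { intros u v. eapply Rle_trans; [apply Hcomb|].
        apply Rmult_le_compat_l; [pose proof (Rabs_pos u); pose proof (Rabs_pos v); lra|].
        assert (HLs : L = leibniz n (gevrey_bound C0 sigs) (fun j => Rabs (p j))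
                        + leibniz n (gevrey_bound C0 sigs) (fun j => Rabs (q j)))
          by (unfold L, b; apply leibniz_plus_r).
        pose proof (Rabs_leibniz n gr p _ (fun j => Rabs (p j)) Hgr (fun j => Rle_refl _)).
        pose proof (Rabs_leibniz n gr q _ (fun j => Rabs (q j)) Hgr (fun j => Rle_refl _)).
        pose proof (Rabs_leibniz n gi p _ (fun j => Rabs (p j)) Hgi (fun j => Rle_refl _)).
        pose proof (Rabs_leibniz n gi q _ (fun j => Rabs (q j)) Hgi (fun j => Rle_refl _)).
        pose proof (Rabs_triang (leibniz n gr p) (- leibniz n gi q)) as T1.
        rewrite Rabs_Ropp in T1.
        pose proof (Rabs_triang (leibniz n gr q) (leibniz n gi p)) as T2.
        unfold Rminus. lra. }
      eapply Rle_trans; [apply Ha|]. unfold b. lra. }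
    assert (HX : Rabs (p (S n) * p n + q (S n) * q n) <= b (S n) * b n) by apply Hcomb.
    (* The weight is split into two equal square roots: one turns b (S n) into z (S n), the other
       goes to the Leibniz sum. *)
    assert (HW : gweight s n * kap s k x n * (b (S n) * L) <= z (S n) * (C1 * c n)).
    { pose proof (leibniz_weighted C0 sigs s k x b n HC Hg Hs Hk Hx Hb) as Hl.
      replace (gweight s n * kap s k x n * (b (S n) * L)) with
        (z (S n) * (sqrt_gweight s n * sqrt (kap s k x n) * L)).
      - apply Rmult_le_compat_l; [apply Hz | exact Hl].
      - unfold z, zseq. assert (Hrt := pow2_sqrt (kap s k x n) ltac:(lra)).
        set (rt := sqrt (kap s k x n)) in *. rewrite <- Hrt, gweight_sqr. ring. }
    (* For n = 0 the factor n kills the term. Otherwise [sqrt_gweight_succ] moves the weight from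
       index n to n - 1, at the cost of s and of one comparison of neighbouring values of [kap]. *)
    assert (HY : gweight s n * kap s k x n * (INR n * (INR n + 1)) * (b (S n) * b n)
                 <= s * K * (z (S n) * z n)).
    { destruct n as [|m].
      - simpl INR. rewrite Rmult_0_l, Rmult_0_r, Rmult_0_l.
        apply Rmult_le_pos; [apply Rmult_le_pos; lra | apply Rmult_le_pos; apply Hz].
      - pose proof (sqrt_kap_succ_le s k x Hs Hk Hx m) as Hq.
        pose proof (sqrt_gweight_succ s m) as Hh.
        pose proof (sqrt_gweight_pos s m Hs). pose proof (Hb (S m)).
        replace (gweight s (S m) * kap s k x (S m) * (INR (S m) * (INR (S m) + 1)) *
                   (b (S (S m)) * b (S m)))
          with (z (S (S m)) * (s * sqrt_gweight s m * b (S m)) * sqrt (kap s k x (S m))).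
        + replace (s * K * (z (S (S m)) * z (S m))) with
            (z (S (S m)) * (s * sqrt_gweight s m * b (S m)) * (K * sqrt (kap s k x m)))
            by (unfold z, zseq; ring).
          apply Rmult_le_compat_l; [|exact Hq].
          apply Rmult_le_pos; [apply Hz|]. repeat apply Rmult_le_pos; lra.
        + rewrite <- Hh. unfold z, zseq.
          assert (Hrt := pow2_sqrt (kap s k x (S m)) ltac:(lra)).
          set (rt := sqrt (kap s k x (S m))) in *.
          rewrite <- Hrt, gweight_sqr, S_INR. ring. }
    rewrite Hpt, Hqt.
    set (G := gweight s n) in *. set (Kn := kap s k x n) in *.
    set (Lr := leibniz n gr p - leibniz n gi q) in *.
    set (Li := leibniz n gr q + leibniz n gi p) in *.
    set (A := p (S n) ^ 2 + q (S n) ^ 2).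
    set (X := p (S n) * p n + q (S n) * q n) in *.
    set (Y := p (S n) * Lr + q (S n) * Li) in *.
    match goal with |- ?lhs <= _ =>
      replace lhs with
        (G * A * (2 * x * Kn + x ^ 2 * kap_deriv s k' x n - 4 * (INR n + 1) * x * Kn)
         - 2 * (G * Kn * (INR n * (INR n + 1))) * X + 2 * (G * Kn) * Y)
        by (unfold A, X, Y; ring) end.
    assert (0 <= A) by (unfold A; pose proof (pow2_ge_0 (p (S n)));
                        pose proof (pow2_ge_0 (q (S n))); lra).
    assert (HGA : 0 <= G * A) by (apply Rmult_le_pos; lra).
    assert (HGK : 0 <= G * Kn) by (apply Rmult_le_pos; lra).
    assert (HGn : 0 <= G * Kn * (INR n * (INR n + 1))).
    { pose proof (pos_INR n). apply Rmult_le_pos; [assumption|]. apply Rmult_le_pos; lra. }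
    (* The damping dominates the divergence of x^2 and the derivative of the weight; this whole
       group is dropped. *)
    assert (S1 : G * A * (2 * x * Kn + x ^ 2 * kap_deriv s k' x n
                          - 4 * (INR n + 1) * x * Kn) <= 0) by nra.
    pose proof (Rle_abs Y). pose proof (Rle_abs (- X)) as HnX. rewrite Rabs_Ropp in HnX.
    assert (S2 : - (G * Kn * (INR n * (INR n + 1)) * X) <= s * K * (z (S n) * z n)).
    { eapply Rle_trans; [|exact HY]. rewrite Ropp_mult_distr_r.
      apply Rmult_le_compat_l; lra. }
    assert (S3 : G * Kn * Y <= 2 * (z (S n) * (C1 * c n))).
    { apply Rle_trans with (G * Kn * (2 * (b (S n) * L))).
      - apply Rmult_le_compat_l; lra.
      - lra. }
    assert (S4 : 2 * (s * K * (z (S n) * z n)) <= s * K * (z (S n) ^ 2 + z n ^ 2)).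
    { assert (0 <= s * K) by (apply Rmult_le_pos; lra).
      pose proof (pow2_ge_0 (z (S n) - z n)). nra. }
    assert (S5 : 2 * (z (S n) * (C1 * c n)) <= C1 * (z (S n) ^ 2 + c n ^ 2)).
    { pose proof (pow2_ge_0 (z (S n) - c n)). nra. }
    lra. }
  eapply Rle_trans; [apply sum_f_R0_le_le; intros n _; apply Hterm|].
  rewrite !plus_sum, !sum_f_R0_mult_l.
  pose proof (sum_shift_le z M) as Hsh.
  assert (Hr : 0 <= s / sigs < 1).
  { split; [apply Rlt_le, Rdiv_lt_0_compat; assumption|].
    apply (Rmult_lt_reg_r sigs); [assumption|]. unfold Rdiv.
    rewrite Rmult_assoc, Rinv_l by lra. lra. }
  pose proof (geom_conv_sqr_sum (s / sigs) z M Hr) as Hgc. fold c in Hgc.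
  set (Z1 := sum_f_R0 (fun n => z (S n) ^ 2) M) in *.
  set (Z0 := sum_f_R0 (fun n => z n ^ 2) M) in *.
  set (Zc := sum_f_R0 (fun n => c n ^ 2) M) in *.
  assert (HZ1 : Z1 <= 2 * sum_f_R0 (fun n => gweight s n * kap s k x n * (p (S n) ^ 2 + q (S n) ^ 2)) M).
  { unfold Z1. rewrite <- sum_f_R0_mult_l. apply sum_f_R0_le_le. intros n _.
    unfold z. rewrite zseq_succ_sqr by assumption.
    pose proof (kap_ge_1 s k x Hs Hk Hx n). pose proof (gweight_pos s n Hs).
    replace (2 * (gweight s n * kap s k x n * (p (S n) ^ 2 + q (S n) ^ 2)))
      with (gweight s n * kap s k x n * (2 * (p (S n) ^ 2 + q (S n) ^ 2))) by ring.
    apply Rmult_le_compat_l; [apply Rmult_le_pos; lra | apply Hb2]. }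
  assert (HZ0 : z 0%nat ^ 2 <= 2 * (kap s k x 0 * (p 0%nat ^ 2 + q 0%nat ^ 2))).
  { unfold z. rewrite zseq_0_sqr by assumption.
    pose proof (kap_ge_1 s k x Hs Hk Hx 0). pose proof (Hb2 0%nat). nra. }
  set (Q := sum_f_R0 (fun n => gweight s n * kap s k x n * (p (S n) ^ 2 + q (S n) ^ 2)) M) in *.
  set (Q0 := kap s k x 0 * (p 0%nat ^ 2 + q 0%nat ^ 2)) in *.
  set (d := / (1 - s / sigs) ^ 2) in *.
  assert (Hd : 0 < d) by (apply Rinv_0_lt_compat, pow_lt; lra).
  set (Z := z 0%nat ^ 2 + Z1) in *.
  assert (HZ1' : Z1 <= Z) by (unfold Z; pose proof (pow2_ge_0 (z 0%nat)); lra).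
  assert (HsK : 0 <= s * K) by (apply Rmult_le_pos; lra).
  assert (T1 : (s * K + 2 * C1) * Z1 <= (s * K + 2 * C1) * Z)
    by (apply Rmult_le_compat_l; lra).
  assert (T2 : s * K * Z0 <= s * K * Z) by (apply Rmult_le_compat_l; lra).
  assert (T3 : 2 * C1 * Zc <= 2 * C1 * (d * Z)).
  { apply Rmult_le_compat_l; [lra|]. eapply Rle_trans; [exact Hgc|].
    apply Rmult_le_compat_l; lra. }
  assert (HZ : Z <= 2 * (Q + Q0)) by (unfold Z; lra).
  apply Rle_trans with ((2 * s * K + 2 * C1 * (1 + d)) * Z).
  { lra. }
  replace (energy_const C0 sigs s * (Q + Q0)) with
    ((2 * s * K + 2 * C1 * (1 + d)) * (2 * (Q + Q0)))
    by (unfold energy_const, C1, K, d; ring).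
  apply Rmult_le_compat_l; [|exact HZ].
  assert (0 <= C1 * (1 + d)) by (apply Rmult_le_pos; lra). lra.
Qed.

#[local] Transparent kap_const sqrt_gweight gweight kap.

(** * Calculus on clamped functions *)

Notation Rint := Coquelicot.RInt.RInt.

(** Retraction of the line onto [a, 1]. Composing with it makes functions continuous everywhere, so
    that integrals and joint continuity need no side conditions. *)
Definition clamp (a x : R) : R := Rmax a (Rmin 1 x).

Lemma clamp_id (a x : R) : a <= x <= 1 -> clamp a x = x.
Proof.
  intros H. unfold clamp. rewrite Rmin_right, Rmax_right by lra. reflexivity.
Qed.

Lemma clamp_bounds (a x : R) : a <= 1 -> a <= clamp a x <= 1.
Proof.
  intros H. unfold clamp. split; [apply Rmax_l|].
  apply Rmax_lub; [assumption | apply Rmin_l].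
Qed.

Lemma clamp_lipschitz (a x y : R) : Rabs (clamp a x - clamp a y) <= Rabs (x - y).
Proof.
  unfold clamp, Rmax, Rmin.
  repeat destruct Rle_dec; apply Rabs_le_between'; unfold Rabs; destruct Rcase_abs; lra.
Qed.

Lemma continuous_clamp (a x : R) : continuous (clamp a) x.
Proof.
  apply filterlim_locally. intros eps. exists eps. intros y Hy.
  eapply Rle_lt_trans; [apply clamp_lipschitz | exact Hy].
Qed.

Lemma is_derive_sum_f_R0 (f : nat -> R -> R) (d : nat -> R) (M : nat) (x : R) :
  (forall n, is_derive (f n) x (d n)) ->
  is_derive (fun y => sum_f_R0 (fun n => f n y) M) x (sum_f_R0 d M).
Proof.
  intros H. induction M as [|M IH]; simpl; [apply H|].
  apply (is_derive_plus (fun y => sum_f_R0 (fun n => f n y) M) (f (S M)));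
    [exact IH | apply H].
Qed.

Lemma continuous_sum_f_R0 (f : nat -> R -> R) (M : nat) (x : R) :
  (forall n, continuous (f n) x) ->
  continuous (fun y => sum_f_R0 (fun n => f n y) M) x.
Proof.
  intros H. induction M as [|M IH]; simpl; [apply H|].
  apply (continuous_plus (fun y => sum_f_R0 (fun n => f n y) M) (f (S M)));
    [exact IH | apply H].
Qed.

Definition cont2 (f : R -> R -> R) : Prop := forall t x, continuity_2d_pt f t x.

Lemma cont2_const (c : R) : cont2 (fun _ _ => c).
Proof. intros t x; apply continuity_2d_pt_const. Qed.

Lemma cont2_plus (f g : R -> R -> R) :
  cont2 f -> cont2 g -> cont2 (fun t x => f t x + g t x).
Proof. intros Hf Hg t x; apply continuity_2d_pt_plus; auto. Qed.

Lemma cont2_mult (f g : R -> R -> R) :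
  cont2 f -> cont2 g -> cont2 (fun t x => f t x * g t x).
Proof. intros Hf Hg t x; apply continuity_2d_pt_mult; auto. Qed.

Lemma cont2_pow (f : R -> R -> R) (n : nat) : cont2 f -> cont2 (fun t x => f t x ^ n).
Proof.
  intros Hf. induction n as [|n IH]; simpl; [apply cont2_const | apply cont2_mult; auto].
Qed.

Lemma cont2_sum (f : nat -> R -> R -> R) (M : nat) : (forall n, cont2 (f n)) ->
  cont2 (fun t x => sum_f_R0 (fun n => f n t x) M).
Proof.
  intros H. induction M as [|M IH]; simpl; [apply H | apply cont2_plus; auto].
Qed.

Lemma cont2_t : cont2 (fun t _ => t).
Proof. intros t x; apply continuity_2d_pt_id1. Qed.

Lemma cont2_comp (g : R -> R) (f : R -> R -> R) : (forall y, continuous g y) ->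
  cont2 f -> cont2 (fun t x => g (f t x)).
Proof.
  intros Hg Hf t x. apply continuity_1d_2d_pt_comp; [|apply Hf].
  apply continuity_pt_filterlim, Hg.
Qed.

Lemma cont2_x (g : R -> R) : (forall y, continuous g y) -> cont2 (fun _ x => g x).
Proof.
  intros Hg. apply (cont2_comp g (fun _ x => x)); [assumption|].
  intros t x; apply continuity_2d_pt_id2.
Qed.

Lemma cont2_slice (f : R -> R -> R) : cont2 f -> forall t x, continuous (f t) x.
Proof.
  intros Hf t x. apply filterlim_locally. intros eps.
  destruct (Hf t x eps) as [d Hd]. exists d. intros y Hy. apply Hd.
  - rewrite Rminus_diag. rewrite Rabs_R0. apply cond_pos.
  - exact Hy.
Qed.

Lemma ex_RInt_cont (f : R -> R) (a b : R) : (forall x, continuous f x) -> ex_RInt f a b.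
Proof. intros H. apply (ex_RInt_continuous (V := R_CompleteNormedModule)). auto. Qed.

Lemma RInt_mono_bounds (f : R -> R) (a b a' b' : R) :
  a <= a' -> a' <= b' -> b' <= b -> (forall x, continuous f x) ->
  (forall x, a < x < b -> 0 <= f x) -> Rint f a' b' <= Rint f a b.
Proof.
  intros H1 H2 H3 Hc Hp.
  rewrite <- (RInt_Chasles f a a' b), <- (RInt_Chasles f a' b' b) by (apply ex_RInt_cont, Hc).
  unfold plus; simpl.
  assert (0 <= Rint f a a')
    by (apply RInt_ge_0; [lra | apply ex_RInt_cont, Hc | intros; apply Hp; lra]).
  assert (0 <= Rint f b' b)
    by (apply RInt_ge_0; [lra | apply ex_RInt_cont, Hc | intros; apply Hp; lra]).
  lra.
Qed.

Lemma is_derive_RInt_upper (f : R -> R) (a x : R) : (forall y, continuous f y) ->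
  is_derive (fun y => Rint f a y) x (f x).
Proof.
  intros Hc. apply (is_derive_RInt f (fun y => Rint f a y) a x); [|apply Hc].
  apply filter_forall. intros y. apply (RInt_correct (V := R_CompleteNormedModule)), ex_RInt_cont, Hc.
Qed.

(** Clamped functions need not be differentiable at the ends of the interval. The mean value theorem
    for the difference of F and a primitive of f only looks at the interior. *)
Lemma RInt_derive_open (F f : R -> R) (a b : R) : a < b ->
  (forall x, continuous F x) -> (forall x, continuous f x) ->
  (forall x, a < x < b -> is_derive F x (f x)) ->
  Rint f a b = F b - F a.
Proof.
  intros Hab HF Hf Hd.
  destruct (MVT_gen (fun x => Rint f a x - F x) a b (fun _ => 0)) as [c [_ Hc]].
  - rewrite Rmin_left, Rmax_right by lra. intros x Hx.
    replace 0 with (f x - f x) by ring.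
    apply (is_derive_minus (fun y => Rint f a y) F); [|apply Hd, Hx].
    apply is_derive_RInt_upper, Hf.
  - intros x _. apply continuity_pt_filterlim.
    apply (continuous_minus (fun y => Rint f a y) F); [|apply HF].
    apply (ex_derive_continuous (fun y => Rint f a y)).
    exists (f x). apply is_derive_RInt_upper, Hf.
  - rewrite RInt_point in Hc. unfold zero in Hc; simpl in Hc. lra.
Qed.

Lemma is_derive_RInt_cont2 (f ft : R -> R -> R) (a b t : R) :
  cont2 f -> cont2 ft -> (forall t x, is_derive (fun u => f u x) t (ft t x)) ->
  is_derive (fun u => Rint (f u) a b) t (Rint (ft t) a b).
Proof.
  intros Hf Hft Hd.
  replace (Rint (ft t) a b) with (Rint (fun x => Derive (fun u => f u x) t) a b).
  2: { apply RInt_ext. intros x _. apply is_derive_unique, Hd. }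
  apply is_derive_RInt_param.
  - apply filter_forall. intros u x _. exists (ft u x). apply Hd.
  - intros x _. apply (continuity_2d_pt_ext ft); [|apply Hft].
    intros u v. symmetry. apply is_derive_unique, Hd.
  - apply filter_forall. intros u. apply ex_RInt_cont, cont2_slice, Hf.
Qed.

Lemma gronwall (E E' : R -> R) (C t1 t2 : R) : t1 <= t2 ->
  (forall t, is_derive E t (E' t)) -> (forall t, t1 <= t <= t2 -> E' t <= C * E t) ->
  E t2 <= exp (C * (t2 - t1)) * E t1.
Proof.
  intros Ht Hd Hle.
  destruct (MVT_gen (fun t => exp (- (C * t)) * E t) t1 t2
     (fun t => exp (- (C * t)) * (E' t - C * E t))) as [c [Hc Heq]].
  - intros t _. pose proof (Hd t) as Hdt.
    auto_derive; [exists (E' t); exact Hdt|].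
    replace (Derive (fun x => E x) t) with (E' t)
      by (symmetry; apply is_derive_unique; exact Hdt).
    ring.
  - intros t _. apply continuity_pt_filterlim.
    apply (ex_derive_continuous (fun t => exp (- (C * t)) * E t)).
    auto_derive. exists (E' t); apply Hd.
  - rewrite Rmin_left, Rmax_right in Hc by lra.
    assert (exp (- (C * c)) * (E' c - C * E c) * (t2 - t1) <= 0).
    { pose proof (exp_pos (- (C * c))). pose proof (Hle c Hc).
      assert (0 <= exp (- (C * c)) * (C * E c - E' c) * (t2 - t1))
        by (repeat apply Rmult_le_pos; lra). lra. }
    apply (Rmult_le_reg_l (exp (- (C * t2)))); [apply exp_pos|].
    rewrite <- Rmult_assoc, <- exp_plus.
    replace (- (C * t2) + C * (t2 - t1)) with (- (C * t1)) by ring. lra.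
Qed.

(** Squaring removes the kink of the positive part; this is why the cutoff is a square. *)
Lemma is_derive_pos_part_sqr (u : R) : is_derive (fun v => Rmax 0 v ^ 2) u (2 * Rmax 0 u).
Proof.
  destruct (Rtotal_order u 0) as [Hu|[Hu|Hu]].
  - rewrite (Rmax_left 0 u), Rmult_0_r by lra.
    apply (is_derive_ext_loc (fun _ => 0)); [|apply @is_derive_const].
    assert (Hp : 0 < - u) by lra. exists (mkposreal _ Hp). intros v Hv.
    apply Rabs_lt_between' in Hv. simpl in Hv. rewrite Rmax_left by lra. simpl; symmetry; apply Rmult_0_l.
  - subst u. rewrite Rmax_left, Rmult_0_r by lra.
    apply is_derive_Reals. intros eps Heps. exists (mkposreal _ Heps).
    intros h Hh Hhe. simpl in Hhe. rewrite Rplus_0_l, (Rmax_left 0 0) by lra.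
    replace ((Rmax 0 h ^ 2 - 0 ^ 2) / h - 0) with (Rmax 0 h * (Rmax 0 h / h)) by (field; exact Hh).
    destruct (Rle_dec h 0).
    + rewrite Rmax_left by lra. rewrite Rmult_0_l, Rabs_R0. lra.
    + rewrite Rmax_right by lra. replace (h * (h / h)) with h by (field; lra). exact Hhe.
  - rewrite (Rmax_right 0 u) by lra.
    apply (is_derive_ext_loc (fun v => v ^ 2)).
    + exists (mkposreal _ Hu). intros v Hv.
      apply Rabs_lt_between' in Hv. simpl in Hv. rewrite Rmax_right by lra. reflexivity.
    + auto_derive; [exact I | ring].
Qed.

Lemma continuous_pos_part (u : R) : continuous (Rmax 0) u.
Proof.
  apply filterlim_locally. intros eps. exists eps. intros v Hv.
  eapply Rle_lt_trans; [|exact Hv]. unfold minus, plus, opp; simpl.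
  unfold abs; simpl. unfold Rmax, Rabs.
  repeat (destruct Rle_dec || destruct Rcase_abs); lra.
Qed.

(** Cauchy-Schwarz on an interval of length at most 1, for a function vanishing at 1. *)
Lemma sqr_le_RInt_derive_sqr (f f' : R -> R) (x : R) : 0 <= x <= 1 ->
  (forall y, continuous f y) -> (forall y, continuous f' y) ->
  (forall y, x < y < 1 -> is_derive f y (f' y)) -> f 1 = 0 ->
  f x ^ 2 <= Rint (fun y => f' y ^ 2) x 1.
Proof.
  intros Hx Hf Hf' Hd H1.
  destruct (Req_dec x 1) as [->|Hne].
  { rewrite H1, RInt_point. unfold zero; simpl; lra. }
  pose proof (RInt_derive_open f f' x 1 ltac:(lra) Hf Hf' Hd) as HI.
  set (v := - f x) in *. assert (Hv : Rint f' x 1 = v) by (unfold v; lra).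
  assert (Hc2 : forall y, continuous (fun y => f' y ^ 2) y).
  { intros y. apply (continuous_comp f' (fun w => w ^ 2)); [apply Hf'|].
    apply (ex_derive_continuous (fun w : R => w ^ 2)). auto_derive; exact I. }
  (* With v the integral of f', expanding this square gives v^2 (1 + x) <= the integral of f'^2. *)
  assert (H : 0 <= Rint (fun y => (f' y - v) ^ 2) x 1).
  { apply RInt_ge_0; [lra | | intros; apply pow2_ge_0].
    apply ex_RInt_cont. intros y.
    apply (continuous_comp f' (fun w => (w - v) ^ 2)); [apply Hf'|].
    apply (ex_derive_continuous (fun w : R => (w - v) ^ 2)). auto_derive; exact I. }
  assert (E : Rint (fun y => (f' y - v) ^ 2) x 1
              = Rint (fun y => f' y ^ 2) x 1 - 2 * v * v + v ^ 2 * (1 - x)).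
  { apply is_RInt_unique.
    apply (is_RInt_ext (fun y => plus (f' y ^ 2) (plus (scal (- 2 * v) (f' y)) (v ^ 2)))).
    - intros y _. unfold plus, scal; simpl; unfold mult; simpl. ring.
    - replace (Rint (fun y => f' y ^ 2) x 1 - 2 * v * v + v ^ 2 * (1 - x)) with
        (plus (Rint (fun y => f' y ^ 2) x 1) (plus (scal (- 2 * v) v) (scal (1 - x) (v ^ 2))))
        by (unfold plus, scal; simpl; unfold mult; simpl; ring).
      apply (is_RInt_plus (V := R_NormedModule)); [apply (RInt_correct (V := R_CompleteNormedModule)), ex_RInt_cont, Hc2|].
      apply (is_RInt_plus (V := R_NormedModule)); [|apply (is_RInt_const (V := R_NormedModule))].
      apply (is_RInt_scal (V := R_NormedModule)). rewrite <- Hv.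
      apply (RInt_correct (V := R_CompleteNormedModule)), ex_RInt_cont, Hf'. }
  rewrite E in H. replace (f x ^ 2) with (v ^ 2) by (unfold v; ring).
  pose proof (pow2_ge_0 v). assert (0 <= v ^ 2 * x) by (apply Rmult_le_pos; lra). lra.
Qed.

(** * Growth of the cut-off energy *)

Lemma sum_f_R0_ge_first (f : nat -> R) (M : nat) :
  (forall n, 0 <= f n) -> f 0%nat <= sum_f_R0 f M.
Proof.
  intros H. induction M as [|M IH]; simpl; [lra | pose proof (H (S M)); lra].
Qed.

Lemma gweight_0 (s : R) : gweight s 0 = 1.
Proof. unfold gweight; simpl; field. Qed.

Lemma is_derive_kap (s : R) (k : R -> R) (k' x : R) (n : nat) : 0 < s ->
  is_derive k x k' -> is_derive (fun y => kap s (k y) y n) x (kap_deriv s k' x n).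
Proof.
  intros Hs Hk. unfold kap, kap_deriv. auto_derive.
  - exists k'; exact Hk.
  - replace (Derive (fun y => k y) x) with k'
      by (symmetry; apply is_derive_unique; exact Hk).
    field. lra.
Qed.

(* Constant along the characteristics x' = x^2, along which 1/x + t is conserved,
   and zero at x = a: no boundary term appears at x = a. *)
Definition cutoff_root (a t x : R) : R := Rmax 0 (1 - a * (/ clamp a x + t)).
Definition cutoff (a t x : R) : R := cutoff_root a t x ^ 2.

Definition energy_density (s : R) (k : R -> R) (M : nat) (p q : nat -> R -> R) (x : R) : R :=
  sum_f_R0 (fun n => gweight s n * kap s (k x) x n * (p (S n) x ^ 2 + q (S n) x ^ 2)) M.

(** The factor is 1 + (1 + s): the energy itself, and the bound 1 + s for the integral of kap_0,
    which multiplies |psi|^2. *)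
Definition growth_const (C0 sigs s : R) : R := energy_const C0 sigs s * (2 + s).

Section Energy.

Context (C0 sigs s a : R) (HC0 : 0 < C0) (Hsigs : 0 < sigs) (Hs : 0 < s) (Hss : s < sigs)
  (Ha : 0 < a < 1) (M : nat) (k k' : R -> R)
  (Hk : forall x, is_derive k x (k' x)) (Hk'c : forall x, continuous k' x)
  (Hk0 : forall x, 0 <= x <= 1 -> 0 <= k x) (Hk'0 : forall x, 0 <= x <= 1 -> k' x <= 0)
  (Hk1 : Rint k 0 1 <= 1)
  (p q pt qt : nat -> R -> R -> R)
  (Cp : forall j, cont2 (p j)) (Cq : forall j, cont2 (q j))
  (Cpt : forall j, cont2 (pt j)) (Cqt : forall j, cont2 (qt j))
  (Hpd : forall j t x, is_derive (fun u => p j u x) t (pt j t x))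
  (Hqd : forall j t x, is_derive (fun u => q j u x) t (qt j t x))
  (Hpx : forall j t x, 0 <= t -> a < x < 1 -> is_derive (p j t) x (p (S j) t x))
  (Hqx : forall j t x, 0 <= t -> a < x < 1 -> is_derive (q j t) x (q (S j) t x))
  (gr gi : nat -> R -> R)
  (Hgr : forall i x, a < x < 1 -> Rabs (gr i x) <= gevrey_bound C0 sigs i)
  (Hgi : forall i x, a < x < 1 -> Rabs (gi i x) <= gevrey_bound C0 sigs i)
  (Hpt : forall n t x, 0 <= t -> a < x < 1 ->
     pt (S n) t x = - (x ^ 2 * p (S (S n)) t x + 2 * (INR n + 1) * x * p (S n) t x
                       + INR n * (INR n + 1) * p n t x)
       + (leibniz n (fun i => gr i x) (fun j => p j t x)
          - leibniz n (fun i => gi i x) (fun j => q j t x)))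
  (Hqt : forall n t x, 0 <= t -> a < x < 1 ->
     qt (S n) t x = - (x ^ 2 * q (S (S n)) t x + 2 * (INR n + 1) * x * q (S n) t x
                       + INR n * (INR n + 1) * q n t x)
       + (leibniz n (fun i => gr i x) (fun j => q j t x)
          + leibniz n (fun i => gi i x) (fun j => p j t x)))
  (Hp1 : forall t, 0 <= t -> p 0%nat t 1 = 0) (Hq1 : forall t, 0 <= t -> q 0%nat t 1 = 0).

Let dens (t x : R) : R := energy_density s k M (fun j => p j t) (fun j => q j t) x.

Let dens_t (t x : R) : R :=
  sum_f_R0 (fun n => gweight s n * kap s (k x) x n *
     (2 * p (S n) t x * pt (S n) t x + 2 * q (S n) t x * qt (S n) t x)) M.

(** A continuous function on the whole plane, but known to be the x-derivative of [dens] only for t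
    >= 0 and a < x < 1, where consecutive p and q are derivatives of each other. *)
Let dens_x (t x : R) : R :=
  sum_f_R0 (fun n => gweight s n *
     (kap_deriv s (k' x) x n * (p (S n) t x ^ 2 + q (S n) t x ^ 2)
      + kap s (k x) x n *
        (2 * p (S n) t x * p (S (S n)) t x + 2 * q (S n) t x * q (S (S n)) t x))) M.

Lemma cont_k : forall x, continuous k x.
Proof. intros x. apply (ex_derive_continuous k). exists (k' x). apply Hk. Qed.

Lemma cont_kap (n : nat) : forall x, continuous (fun y => kap s (k y) y n) x.
Proof.
  intros x. apply (ex_derive_continuous (fun y => kap s (k y) y n)).
  eexists. apply is_derive_kap; [exact Hs | apply Hk].
Qed.

Lemma cont2_kap (n : nat) : cont2 (fun _ x => kap s (k x) x n).
Proof. apply (cont2_x (fun x => kap s (k x) x n)), cont_kap. Qed.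

Lemma cont2_id : cont2 (fun _ x => x).
Proof. apply (cont2_x (fun x => x)). intros y. apply continuous_id. Qed.

Lemma cont2_kap_deriv (n : nat) : cont2 (fun _ x => kap_deriv s (k' x) x n).
Proof.
  unfold kap_deriv. repeat apply cont2_plus.
  - apply cont2_const.
  - apply (cont2_mult (fun _ _ => _)); [apply cont2_const | apply cont2_id].
  - apply (cont2_mult (fun _ _ => s)); [apply cont2_const | apply cont2_x, Hk'c].
Qed.

Lemma cont2_modsqr (n : nat) : cont2 (fun t x => p n t x ^ 2 + q n t x ^ 2).
Proof. apply cont2_plus; apply cont2_pow; auto. Qed.

Lemma cont2_dens : cont2 dens.
Proof.
  unfold dens, energy_density.
  apply (cont2_sum (fun n t x => gweight s n * kap s (k x) x n * (p (S n) t x ^ 2 + q (S n) t x ^ 2))).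
  intros n. apply cont2_mult; [|apply cont2_modsqr].
  apply (cont2_mult (fun _ _ => gweight s n)); [apply cont2_const | apply cont2_kap].
Qed.

Lemma cont2_bilin (f g f' g' : R -> R -> R) : cont2 f -> cont2 g -> cont2 f' -> cont2 g' ->
  cont2 (fun t x => 2 * f t x * f' t x + 2 * g t x * g' t x).
Proof.
  intros. apply cont2_plus; apply cont2_mult; auto;
    apply (cont2_mult (fun _ _ => 2)); auto; apply cont2_const.
Qed.

Lemma cont2_dens_t : cont2 dens_t.
Proof.
  unfold dens_t.
  apply (cont2_sum (fun n t x => gweight s n * kap s (k x) x n *
     (2 * p (S n) t x * pt (S n) t x + 2 * q (S n) t x * qt (S n) t x))).
  intros n. apply cont2_mult; [|apply cont2_bilin; auto].
  apply (cont2_mult (fun _ _ => gweight s n)); [apply cont2_const | apply cont2_kap].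
Qed.

Lemma cont2_dens_x : cont2 dens_x.
Proof.
  unfold dens_x.
  apply (cont2_sum (fun n t x => gweight s n *
     (kap_deriv s (k' x) x n * (p (S n) t x ^ 2 + q (S n) t x ^ 2)
      + kap s (k x) x n *
        (2 * p (S n) t x * p (S (S n)) t x + 2 * q (S n) t x * q (S (S n)) t x)))).
  intros n. apply (cont2_mult (fun _ _ => gweight s n)); [apply cont2_const|].
  apply cont2_plus; apply cont2_mult.
  - apply cont2_kap_deriv.
  - apply cont2_modsqr.
  - apply cont2_kap.
  - apply cont2_bilin; auto.
Qed.

Lemma cont2_cutoff_arg : cont2 (fun t x => 1 - a * (/ clamp a x + t)).
Proof.
  intros t x. apply (continuity_2d_pt_minus (fun _ _ => 1)); [apply continuity_2d_pt_const|].
  apply (continuity_2d_pt_mult (fun _ _ => a)); [apply continuity_2d_pt_const|].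
  apply continuity_2d_pt_plus; [|apply continuity_2d_pt_id1].
  apply continuity_2d_pt_inv.
  - apply (cont2_x (clamp a)). apply continuous_clamp.
  - pose proof (clamp_bounds a x). lra.
Qed.

Lemma cont2_cutoff_root : cont2 (cutoff_root a).
Proof.
  apply (cont2_comp (Rmax 0) (fun t x => 1 - a * (/ clamp a x + t)));
    [apply continuous_pos_part | apply cont2_cutoff_arg].
Qed.

Lemma cont2_cutoff : cont2 (cutoff a).
Proof. apply cont2_pow, cont2_cutoff_root. Qed.

Lemma is_derive_cutoff_t (t x : R) :
  is_derive (fun u => cutoff a u x) t (- 2 * a * cutoff_root a t x).
Proof.
  unfold cutoff, cutoff_root.
  replace (- 2 * a * Rmax 0 (1 - a * (/ clamp a x + t)))
    with (scal (- a) (2 * Rmax 0 (1 - a * (/ clamp a x + t))))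
    by (unfold scal; simpl; unfold mult; simpl; ring).
  apply (is_derive_comp (fun v => Rmax 0 v ^ 2) (fun u => 1 - a * (/ clamp a x + u))).
  - apply is_derive_pos_part_sqr.
  - auto_derive; [exact I | ring].
Qed.

(** Multiplied by x^2 this is the opposite of the t-derivative: the cutoff is invariant under the
    flow x' = x^2. *)
Lemma is_derive_cutoff_x (t x : R) : a < x < 1 ->
  is_derive (cutoff a t) x (2 * a * cutoff_root a t x / x ^ 2).
Proof.
  intros Hx. unfold cutoff, cutoff_root. rewrite clamp_id by lra.
  apply (is_derive_ext_loc (fun y => Rmax 0 (1 - a * (/ y + t)) ^ 2)).
  { assert (Hd : 0 < Rmin (x - a) (1 - x)) by (apply Rmin_pos; lra).
    exists (mkposreal _ Hd). intros y Hy. apply Rabs_lt_between' in Hy. simpl in Hy.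
    pose proof (Rmin_l (x - a) (1 - x)). pose proof (Rmin_r (x - a) (1 - x)).
    rewrite clamp_id by lra. reflexivity. }
  replace (2 * a * Rmax 0 (1 - a * (/ x + t)) / x ^ 2)
    with (scal (a / x ^ 2) (2 * Rmax 0 (1 - a * (/ x + t))))
    by (unfold scal; simpl; unfold mult; simpl; field; lra).
  apply (is_derive_comp (fun v => Rmax 0 v ^ 2) (fun y => 1 - a * (/ y + t))).
  - apply is_derive_pos_part_sqr.
  - auto_derive; [lra | field; lra].
Qed.

Lemma cutoff_nonneg (t x : R) : 0 <= cutoff a t x.
Proof. apply pow2_ge_0. Qed.

Lemma cutoff_mono (t x y : R) : a <= x -> x <= y -> y <= 1 -> cutoff a t x <= cutoff a t y.
Proof.
  intros H1 H2 H3. unfold cutoff, cutoff_root. rewrite !clamp_id by lra.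
  apply pow_incr. split; [apply Rmax_l|]. apply Rle_max_compat_l.
  assert (/ y <= / x) by (apply Rinv_le_contravar; lra). nra.
Qed.

Lemma kap_nonneg (x : R) (n : nat) : 0 <= x <= 1 -> 1 <= kap s (k x) x n.
Proof. intros Hx. apply kap_ge_1; auto. Qed.

Lemma dens_term_nonneg (t x : R) (n : nat) : 0 <= x <= 1 ->
  0 <= gweight s n * kap s (k x) x n * (p (S n) t x ^ 2 + q (S n) t x ^ 2).
Proof.
  intros Hx. pose proof (kap_nonneg x n Hx). pose proof (gweight_pos s n Hs).
  pose proof (pow2_ge_0 (p (S n) t x)). pose proof (pow2_ge_0 (q (S n) t x)).
  apply Rmult_le_pos; [apply Rmult_le_pos; lra | lra].
Qed.

Lemma dens_nonneg (t x : R) : 0 <= x <= 1 -> 0 <= dens t x.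
Proof. intros Hx. apply sum_f_R0_nonneg. intros n _. apply dens_term_nonneg, Hx. Qed.

Lemma dens_ge_first (t x : R) : 0 <= x <= 1 -> p 1%nat t x ^ 2 + q 1%nat t x ^ 2 <= dens t x.
Proof.
  intros Hx.
  apply Rle_trans with (gweight s 0 * kap s (k x) x 0 * (p 1%nat t x ^ 2 + q 1%nat t x ^ 2)).
  - rewrite gweight_0. pose proof (kap_nonneg x 0 Hx).
    pose proof (pow2_ge_0 (p 1%nat t x)). pose proof (pow2_ge_0 (q 1%nat t x)). nra.
  - apply (sum_f_R0_ge_first
      (fun n => gweight s n * kap s (k x) x n * (p (S n) t x ^ 2 + q (S n) t x ^ 2))).
    intros n. apply dens_term_nonneg, Hx.
Qed.

Lemma is_derive_dens_t (t x : R) : is_derive (fun u => dens u x) t (dens_t t x).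
Proof.
  unfold dens, energy_density, dens_t.
  apply (is_derive_sum_f_R0 (fun n u => gweight s n * kap s (k x) x n * (p (S n) u x ^ 2 + q (S n) u x ^ 2))).
  intros n. pose proof (Hpd (S n) t x) as Dp. pose proof (Hqd (S n) t x) as Dq.
  auto_derive.
  - split; [|split; [|exact I]]; eexists; [exact Dp | exact Dq].
  - replace (Derive (fun u => p (S n) u x) t) with (pt (S n) t x)
      by (symmetry; apply is_derive_unique, Dp).
    replace (Derive (fun u => q (S n) u x) t) with (qt (S n) t x)
      by (symmetry; apply is_derive_unique, Dq).
    ring.
Qed.

Lemma is_derive_dens_x (t x : R) : 0 <= t -> a < x < 1 -> is_derive (dens t) x (dens_x t x).
Proof.
  intros Ht Hx. unfold dens, energy_density, dens_x.
  apply (is_derive_sum_f_R0 (fun n y => gweight s n * kap s (k y) y n * (p (S n) t y ^ 2 + q (S n) t y ^ 2))).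
  intros n. pose proof (Hpx (S n) t x Ht Hx) as Dp. pose proof (Hqx (S n) t x Ht Hx) as Dq.
  pose proof (is_derive_kap s k (k' x) x n Hs (Hk x)) as Dk.
  set (ka := fun y => kap s (k y) y n) in *. change (kap s (k x) x n) with (ka x).
  apply (is_derive_ext (fun y => gweight s n * ka y * (p (S n) t y ^ 2 + q (S n) t y ^ 2)));
    [reflexivity|].
  auto_derive.
  - split; [|split; [|split; [|exact I]]]; eexists; [exact Dk | exact Dp | exact Dq].
  - replace (Derive (fun y => ka y) x) with (kap_deriv s (k' x) x n)
      by (symmetry; apply is_derive_unique, Dk).
    replace (Derive (fun y => p (S n) t y) x) with (p (S (S n)) t x)
      by (symmetry; apply is_derive_unique, Dp).
    replace (Derive (fun y => q (S n) t y) x) with (q (S (S n)) t x)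
      by (symmetry; apply is_derive_unique, Dq).
    ring.
Qed.

(** The last two terms on the left are the x-derivative of the flux x^2 dens, so this is a local
    balance law with a source. *)
Lemma dens_pointwise (t x : R) : 0 <= t -> a < x < 1 ->
  dens_t t x + 2 * x * dens t x + x ^ 2 * dens_x t x
    <= energy_const C0 sigs s *
       (dens t x + kap s (k x) x 0 * (p 0%nat t x ^ 2 + q 0%nat t x ^ 2)).
Proof.
  intros Ht Hx. assert (Hx' : 0 <= x <= 1) by lra.
  pose proof (pointwise_energy C0 sigs s HC0 Hsigs Hs Hss M x (k x) (k' x)
    (fun j => p j t x) (fun j => q j t x) (fun i => gr i x) (fun i => gi i x)
    (fun n => pt (S n) t x) (fun n => qt (S n) t x) Hx' (Hk0 x Hx') (Hk'0 x Hx')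
    (fun i => Hgr i x Hx) (fun i => Hgi i x Hx)
    (fun n => Hpt n t x Ht Hx) (fun n => Hqt n t x Ht Hx)) as H.
  eapply Rle_trans; [|exact H]. apply Req_le.
  unfold dens_t, dens, dens_x, energy_density.
  rewrite <- !sum_f_R0_mult_l, <- !plus_sum. apply sum_eq. intros n _. ring.
Qed.

(** The Dirichlet condition bounds |psi(x)|^2 by the integral of |phi_0|^2 over [x, 1]. On that
    interval the cutoff is at least its value at x, so it can be moved under the integral. The bound
    no longer depends on x. *)
Lemma psi_bound (t x : R) : 0 <= t -> a < x < 1 ->
  cutoff a t x * (p 0%nat t x ^ 2 + q 0%nat t x ^ 2)
    <= Rint (fun y => cutoff a t y * dens t y) a 1.
Proof.
  intros Ht Hx.
  assert (Hf : forall (f : nat -> R -> R -> R), (forall j, cont2 (f j)) ->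
     (forall j y, a < y < 1 -> is_derive (f j t) y (f (S j) t y)) -> f 0%nat t 1 = 0 ->
     f 0%nat t x ^ 2 <= Rint (fun y => f 1%nat t y ^ 2) x 1).
  { intros f Cf Df F1. apply sqr_le_RInt_derive_sqr; try lra; try assumption.
    - apply cont2_slice, Cf.
    - apply cont2_slice, Cf.
    - intros y Hy. apply Df; lra. }
  pose proof (Hf p Cp (fun j y => Hpx j t y Ht) (Hp1 t Ht)) as Bp.
  pose proof (Hf q Cq (fun j y => Hqx j t y Ht) (Hq1 t Ht)) as Bq. clear Hf.
  assert (Cs : forall f, cont2 f -> forall y, continuous (fun y => f t y ^ 2) y)
    by (intros f Cf; apply (cont2_slice (fun t y => f t y ^ 2)), cont2_pow, Cf).
  assert (Cd : forall y, continuous (fun y => cutoff a t y * dens t y) y)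
    by (apply (cont2_slice (fun t y => cutoff a t y * dens t y)), cont2_mult;
        [apply cont2_cutoff | apply cont2_dens]).
  pose proof (cutoff_nonneg t x) as Hc0.
  apply Rle_trans with (cutoff a t x * (Rint (fun y => p 1%nat t y ^ 2) x 1
                                         + Rint (fun y => q 1%nat t y ^ 2) x 1)).
  { apply Rmult_le_compat_l; lra. }
  apply Rle_trans with (Rint (fun y => cutoff a t y * dens t y) x 1).
  2: { apply RInt_mono_bounds; try lra; [exact Cd|].
       intros y Hy. apply Rmult_le_pos; [apply cutoff_nonneg | apply dens_nonneg; lra]. }
  assert (E : is_RInt (fun y => scal (cutoff a t x) (plus (p 1%nat t y ^ 2) (q 1%nat t y ^ 2))) x 1
    (scal (cutoff a t x) (plus (Rint (fun y => p 1%nat t y ^ 2) x 1)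
                               (Rint (fun y => q 1%nat t y ^ 2) x 1)))).
  { apply (is_RInt_scal (V := R_NormedModule)). apply (is_RInt_plus (V := R_NormedModule));
      apply (RInt_correct (V := R_CompleteNormedModule)), ex_RInt_cont, Cs; auto. }
  match type of E with is_RInt ?f _ _ ?v =>
    change (v <= Rint (fun y => cutoff a t y * dens t y) x 1);
    rewrite <- (is_RInt_unique f x 1 v E) end.
  apply RInt_le; [lra | eexists; exact E | apply ex_RInt_cont, Cd |].
  intros y Hy. unfold scal, plus; simpl; unfold mult; simpl.
  pose proof (cutoff_mono t x y ltac:(lra) ltac:(lra) ltac:(lra)).
  pose proof (dens_ge_first t y ltac:(lra)).
  pose proof (pow2_ge_0 (p 1%nat t y)). pose proof (pow2_ge_0 (q 1%nat t y)).
  change (p 1%nat t y * (p 1%nat t y * 1)) with (p 1%nat t y ^ 2).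
  change (q 1%nat t y * (q 1%nat t y * 1)) with (q 1%nat t y ^ 2).
  apply Rmult_le_compat; lra.
Qed.

(** The kernel is used through its mass alone, which makes the rate uniform in the approximation of
    the Dirac mass. *)
Lemma kap_0_integral : Rint (fun x => kap s (k x) x 0) a 1 <= 1 + s.
Proof.
  apply Rle_trans with (Rint (fun x => kap s (k x) x 0) 0 1).
  { apply RInt_mono_bounds; try lra; [apply cont_kap|].
    intros x Hx. pose proof (kap_nonneg x 0 ltac:(lra)). lra. }
  assert (E : is_RInt (fun x => kap s (k x) x 0) 0 1 (1 + s * Rint k 0 1)).
  { apply (is_RInt_ext (fun x => plus 1 (scal s (k x)))).
    - intros x _. rewrite kap_0. reflexivity.
    - replace (1 + s * Rint k 0 1) with (plus (scal (1 - 0) 1) (scal s (Rint k 0 1)))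
        by (unfold plus, scal; simpl; unfold mult; simpl; ring).
      apply (is_RInt_plus (V := R_NormedModule)).
      + apply (is_RInt_const (V := R_NormedModule)).
      + apply (is_RInt_scal (V := R_NormedModule)).
        apply (RInt_correct (V := R_CompleteNormedModule)), ex_RInt_cont, cont_k. }
  rewrite (is_RInt_unique _ _ _ _ E). nra.
Qed.

Lemma energy_const_nonneg : 0 <= energy_const C0 sigs s.
Proof.
  unfold energy_const. pose proof (kap_const_ge_2 s Hs).
  assert (0 <= / (1 - s / sigs) ^ 2).
  { destruct (Req_dec ((1 - s / sigs) ^ 2) 0) as [E|E].
    - rewrite E, Rinv_0. lra.
    - apply Rlt_le, Rinv_0_lt_compat. pose proof (pow2_ge_0 (1 - s / sigs)). lra. }
  assert (0 <= C0 * kap_const s * (1 + s) * (1 + / (1 - s / sigs) ^ 2)).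
  { apply Rmult_le_pos; [|lra]. apply Rmult_le_pos; [|lra]. apply Rmult_le_pos; lra. }
  assert (0 <= s * kap_const s) by (apply Rmult_le_pos; lra). lra.
Qed.

Lemma energy_derivative_bound (t : R) : 0 <= t ->
  Rint (fun x => - 2 * a * cutoff_root a t x * dens t x + cutoff a t x * dens_t t x) a 1
    <= growth_const C0 sigs s * Rint (fun x => cutoff a t x * dens t x) a 1.
Proof.
  intros Ht. set (J := Rint (fun x => cutoff a t x * dens t x) a 1).
  set (K := energy_const C0 sigs s). pose proof energy_const_nonneg as HK. fold K in HK.
  (* The cut-off flux, with derivative [Hd]. By invariance of the cutoff, the integrand to be
     estimated is -Hd plus the cutoff times the left side of [dens_pointwise]. *)
  set (H := fun x => x ^ 2 * (cutoff a t x * dens t x)).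
  set (Hd := fun x => 2 * x * (cutoff a t x * dens t x)
     + (2 * a * cutoff_root a t x * dens t x + x ^ 2 * (cutoff a t x * dens_x t x))).
  pose proof cont2_dens as CD. pose proof cont2_dens_t as CDt. pose proof cont2_dens_x as CDx.
  pose proof cont2_cutoff as CC. pose proof cont2_cutoff_root as CR. pose proof cont2_id as CI.
  assert (CCD : cont2 (fun t x => cutoff a t x * dens t x)) by (apply cont2_mult; assumption).
  assert (CRD : forall c, cont2 (fun t x => c * cutoff_root a t x * dens t x)).
  { intros c. apply cont2_mult; [|assumption].
    apply (cont2_mult (fun _ _ => c)); [apply cont2_const | assumption]. }
  assert (CH : forall x, continuous H x).
  { apply (cont2_slice (fun t x => x ^ 2 * (cutoff a t x * dens t x))), cont2_mult;
      [apply (cont2_pow (fun _ x => x)), CI | exact CCD]. }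
  assert (CHd : forall x, continuous Hd x).
  { apply (cont2_slice (fun t x => 2 * x * (cutoff a t x * dens t x)
     + (2 * a * cutoff_root a t x * dens t x + x ^ 2 * (cutoff a t x * dens_x t x)))).
    apply cont2_plus; [|apply cont2_plus].
    - apply cont2_mult; [|exact CCD].
      apply (cont2_mult (fun _ _ => 2)); [apply cont2_const | exact CI].
    - apply CRD.
    - apply cont2_mult; [apply (cont2_pow (fun _ x => x)), CI | apply cont2_mult; assumption]. }
  assert (DH : forall x, a < x < 1 -> is_derive H x (Hd x)).
  { intros x Hx. pose proof (is_derive_cutoff_x t x Hx) as D1.
    pose proof (is_derive_dens_x t x Ht Hx) as D2. unfold H, Hd.
    auto_derive.
    - split; [|split; [|exact I]]; eexists; [exact D1 | exact D2].
    - replace (Derive (fun y => cutoff a t y) x) with (2 * a * cutoff_root a t x / x ^ 2)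
        by (symmetry; apply is_derive_unique, D1).
      replace (Derive (fun y => dens t y) x) with (dens_x t x)
        by (symmetry; apply is_derive_unique, D2).
      field. lra. }
  pose proof (RInt_derive_open H Hd a 1 ltac:(lra) CH CHd DH) as IH.
  (* At x = a the argument of the positive part is -a t <= 0: nothing flows in on the left. *)
  assert (Ha0 : H a = 0).
  { unfold H, cutoff, cutoff_root. rewrite clamp_id by lra.
    rewrite Rmax_left; [ring|].
    replace (1 - a * (/ a + t)) with (- (a * t)) by (field; lra). nra. }
  (* Flow out through x = 1, which has the good sign and is discarded. *)
  assert (H10 : 0 <= H 1).
  { unfold H. apply Rmult_le_pos; [apply pow2_ge_0|].
    apply Rmult_le_pos; [apply cutoff_nonneg | apply dens_nonneg; lra]. }
  assert (HJ : 0 <= J).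
  { apply RInt_ge_0; [lra | apply ex_RInt_cont, (cont2_slice _ CCD) |].
    intros x Hx. apply Rmult_le_pos; [apply cutoff_nonneg | apply dens_nonneg; lra]. }
  (* Pointwise majorant of the integrand: [psi_bound] replaces the cut-off |psi|^2 by the number J,
     so kap_0 remains the only x-dependent factor of the last term. *)
  assert (E : is_RInt (fun x => plus (scal (-1) (Hd x)) (plus (scal K (cutoff a t x * dens t x))
        (scal (K * J) (kap s (k x) x 0)))) a 1
     (plus (scal (-1) (Rint Hd a 1)) (plus (scal K J)
        (scal (K * J) (Rint (fun x => kap s (k x) x 0) a 1))))).
  { apply (is_RInt_plus (V := R_NormedModule));
      [|apply (is_RInt_plus (V := R_NormedModule))];
      apply (is_RInt_scal (V := R_NormedModule));
      apply (RInt_correct (V := R_CompleteNormedModule)), ex_RInt_cont.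
    - exact CHd.
    - apply (cont2_slice _ CCD).
    - apply cont_kap. }
  apply Rle_trans with (plus (scal (-1) (Rint Hd a 1)) (plus (scal K J)
        (scal (K * J) (Rint (fun x => kap s (k x) x 0) a 1)))).
  - match type of E with is_RInt ?f _ _ ?v => rewrite <- (is_RInt_unique f a 1 v E) end.
    apply RInt_le; [lra | | eexists; exact E |].
    { apply ex_RInt_cont, (cont2_slice (fun t x =>
        - 2 * a * cutoff_root a t x * dens t x + cutoff a t x * dens_t t x)).
      apply cont2_plus; [apply CRD | apply cont2_mult; assumption]. }
    intros x Hx. unfold plus, scal; simpl; unfold mult; simpl.
    pose proof (dens_pointwise t x Ht Hx) as Hpw. fold K in Hpw.
    pose proof (psi_bound t x Ht Hx) as Hpsi. fold J in Hpsi.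
    pose proof (kap_nonneg x 0 ltac:(lra)) as Hkap. pose proof (cutoff_nonneg t x) as Hc.
    set (B := p 0%nat t x ^ 2 + q 0%nat t x ^ 2) in *.
    set (X := cutoff a t x) in *. set (k0 := kap s (k x) x 0) in *.
    assert (T1 : X * (dens_t t x + 2 * x * dens t x + x ^ 2 * dens_x t x)
                 <= X * (K * (dens t x + k0 * B))) by (apply Rmult_le_compat_l; assumption).
    assert (T2 : K * k0 * (X * B) <= K * k0 * J).
    { apply Rmult_le_compat_l; [apply Rmult_le_pos; lra | assumption]. }
    unfold Hd. fold X. simpl in *. lra.
  - unfold plus, scal; simpl; unfold mult; simpl. rewrite IH, Ha0.
    pose proof kap_0_integral as HI.
    assert (K * J * Rint (fun x => kap s (k x) x 0) a 1 <= K * J * (1 + s))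
      by (apply Rmult_le_compat_l; [apply Rmult_le_pos; assumption | assumption]).
    unfold growth_const. fold K. lra.
Qed.

Lemma energy_growth (t1 t2 : R) : 0 <= t1 -> t1 <= t2 ->
  Rint (fun x => cutoff a t2 x * energy_density s k M (fun j => p j t2) (fun j => q j t2) x) a 1
    <= exp (growth_const C0 sigs s * (t2 - t1)) *
       Rint (fun x => cutoff a t1 x * energy_density s k M (fun j => p j t1) (fun j => q j t1) x) a 1.
Proof.
  intros H1 H2.
  apply (gronwall (fun t => Rint (fun x => cutoff a t x * dens t x) a 1)
    (fun t => Rint (fun x => - 2 * a * cutoff_root a t x * dens t x
                             + cutoff a t x * dens_t t x) a 1)); [assumption | |].
  - intros t.
    apply (is_derive_RInt_cont2 (fun t x => cutoff a t x * dens t x)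
      (fun t x => - 2 * a * cutoff_root a t x * dens t x + cutoff a t x * dens_t t x)).
    + apply cont2_mult; [apply cont2_cutoff | apply cont2_dens].
    + apply cont2_plus; apply cont2_mult.
      * apply (cont2_mult (fun _ _ => - 2 * a)); [apply cont2_const | apply cont2_cutoff_root].
      * apply cont2_dens.
      * apply cont2_cutoff.
      * apply cont2_dens_t.
    + intros u x.
      apply (is_derive_mult (fun u => cutoff a u x) (fun u => dens u x)
               u (- 2 * a * cutoff_root a u x) (dens_t u x));
        [apply is_derive_cutoff_t | apply is_derive_dens_t | intros; apply Rmult_comm].
  - intros t Ht. apply energy_derivative_bound. lra.
Qed.

End Energy.

(** * Derivatives within a domain and extension *)

Lemma Rderiv_within_elim (f f' : R -> R) (D : R -> Prop) (x eps : R) :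
  Rderiv_within f f' D x -> 0 < eps -> exists d, 0 < d /\
  forall h, h <> 0 -> D (x + h) -> Rabs h < d -> Rabs ((f (x + h) - f x) / h - f' x) < eps.
Proof.
  intros H He. destruct (H eps He) as [d [Hd Hl]]. exists d. split; [exact Hd|].
  intros h Hh HD Hhd. apply (Hl h). split; [split; assumption|].
  simpl. unfold Rdist. rewrite Rminus_0_r. exact Hhd.
Qed.

Lemma Rderiv_within_intro (f f' : R -> R) (D : R -> Prop) (x : R) :
  (forall eps, 0 < eps -> exists d, 0 < d /\
   forall h, h <> 0 -> D (x + h) -> Rabs h < d -> Rabs ((f (x + h) - f x) / h - f' x) < eps) ->
  Rderiv_within f f' D x.
Proof.
  intros H eps He. destruct (H eps He) as [d [Hd Hl]]. exists d. split; [exact Hd|].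
  intros h [[Hh HD] Hhd]. simpl in *. unfold Rdist in *. rewrite Rminus_0_r in Hhd.
  apply Hl; assumption.
Qed.

Lemma Rderiv_within_is_derive (f f' : R -> R) (D : R -> Prop) (x : R) :
  Rderiv_within f f' D x -> locally x D -> is_derive f x (f' x).
Proof.
  intros H [r Hr]. apply is_derive_Reals. intros eps He.
  destruct (Rderiv_within_elim f f' D x eps H He) as [d [Hd Hl]].
  assert (Hm : 0 < Rmin d r) by (apply Rmin_pos; [assumption | apply cond_pos]).
  exists (mkposreal _ Hm). simpl. intros h Hh Hhd.
  pose proof (Rmin_l d r). pose proof (Rmin_r d r).
  apply Hl; [assumption | | lra]. apply Hr.
  change (Rabs (x + h - x) < r). replace (x + h - x) with h by ring. lra.
Qed.

Lemma locally_interval (a b x : R) (D : R -> Prop) : a < x < b ->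
  (forall y, a < y < b -> D y) -> locally x D.
Proof.
  intros Hx H. assert (Hd : 0 < Rmin (x - a) (b - x)) by (apply Rmin_pos; lra).
  exists (mkposreal _ Hd). intros y Hy. apply Rabs_lt_between' in Hy. simpl in Hy.
  pose proof (Rmin_l (x - a) (b - x)). pose proof (Rmin_r (x - a) (b - x)).
  apply H. lra.
Qed.

Definition Omega_cont (f : R -> R -> R) : Prop :=
  forall t x, Omega t x -> forall eps, 0 < eps -> exists delta, 0 < delta /\
    forall t' x', Omega t' x' -> Rabs (t' - t) < delta -> Rabs (x' - x) < delta ->
      Rabs (f t' x' - f t x) < eps.

Lemma pos_part_lipschitz (u v : R) : Rabs (Rmax 0 u - Rmax 0 v) <= Rabs (u - v).
Proof.
  unfold Rmax, Rabs. repeat (destruct Rle_dec || destruct Rcase_abs); lra.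
Qed.

Lemma Omega_clamp (a t x : R) : 0 < a < 1 -> Omega (Rmax 0 t) (clamp a x).
Proof.
  intros Ha. pose proof (clamp_bounds a x). split; [apply Rmax_l | lra].
Qed.

Lemma cont2_retract (a : R) (f : R -> R -> R) : 0 < a < 1 -> Omega_cont f ->
  cont2 (fun t x => f (Rmax 0 t) (clamp a x)).
Proof.
  intros Ha Hf t x eps.
  destruct (Hf _ _ (Omega_clamp a t x Ha) eps (cond_pos eps)) as [d [Hd H]].
  exists (mkposreal _ Hd). simpl. intros u v Hu Hv. apply H.
  - apply Omega_clamp, Ha.
  - eapply Rle_lt_trans; [apply pos_part_lipschitz | exact Hu].
  - eapply Rle_lt_trans; [apply clamp_lipschitz | exact Hv].
Qed.

(* First-order Taylor extension to t < 0, so that the extension is C^1 in t. *)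
Definition C1_ext (a : R) (f f' : R -> R -> R) (t x : R) : R :=
  f (Rmax 0 t) (clamp a x) + Rmin 0 t * f' 0 (clamp a x).

Lemma C1_ext_eq (a : R) (f f' : R -> R -> R) (t x : R) : 0 <= t -> a <= x <= 1 ->
  C1_ext a f f' t x = f t x.
Proof.
  intros Ht Hx. unfold C1_ext. rewrite clamp_id, Rmax_right, Rmin_left by assumption. ring.
Qed.

Lemma cont2_C1_ext (a : R) (f f' : R -> R -> R) : 0 < a < 1 ->
  Omega_cont f -> Omega_cont f' -> cont2 (C1_ext a f f').
Proof.
  intros Ha Hf Hf'. unfold C1_ext. apply cont2_plus; [apply cont2_retract; assumption|].
  apply cont2_mult.
  - apply (cont2_comp (Rmin 0) (fun t _ => t)); [|apply cont2_t].
    intros y. apply (continuous_ext (fun t => t - Rmax 0 t)).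
    + intros u. unfold Rmin, Rmax; destruct Rle_dec; lra.
    + apply (continuous_minus (fun t => t) (Rmax 0)); [apply continuous_id | apply continuous_pos_part].
  - apply (cont2_x (fun x => f' 0 (clamp a x))). intros y.
    pose proof (cont2_slice _ (cont2_retract a f' Ha Hf') 0 y) as H.
    cbv beta in H. rewrite Rmax_left in H by lra. exact H.
Qed.

(** Differentiation under the integral is applied with two-sided t-derivatives at every real t,
    whereas the solution is differentiable only within t >= 0. At t = 0 the linear branch supplies
    the left derivative. *)
Lemma is_derive_C1_ext (a : R) (f f' : R -> R -> R) (t x : R) : 0 < a < 1 ->
  (forall t x, Omega t x ->
     Rderiv_within (fun u => f u x) (fun u => f' u x) (fun u => Omega u x) t) ->
  is_derive (fun u => C1_ext a f f' u x) t (f' (Rmax 0 t) (clamp a x)).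
Proof.
  intros Ha Hd. unfold C1_ext. pose proof (clamp_bounds a x ltac:(lra)) as Hcl.
  set (X := clamp a x) in *.
  destruct (Rtotal_order t 0) as [Ht|[Ht|Ht]].
  - rewrite Rmax_left by lra.
    apply (is_derive_ext_loc (fun u => f 0 X + u * f' 0 X)).
    + apply (locally_interval (t - 1) 0); [lra|]. intros u Hu.
      rewrite Rmax_left, Rmin_right by lra. reflexivity.
    + auto_derive; [exact I | ring].
  - subst t. rewrite (Rmax_left 0 0) by lra. apply is_derive_Reals. intros eps He.
    destruct (Rderiv_within_elim _ _ _ 0 eps (Hd 0 X ltac:(split; lra)) He) as [d [Hdp Hl]].
    exists (mkposreal _ Hdp). simpl. intros h Hh Hhd.
    rewrite (Rmax_left 0 0), (Rmin_left 0 0) by lra.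
    destruct (Rlt_dec h 0).
    + rewrite Rplus_0_l, Rmax_left, Rmin_right by lra.
      replace ((f 0 X + h * f' 0 X - (f 0 X + 0 * f' 0 X)) / h - f' 0 X) with 0 by (field; lra).
      rewrite Rabs_R0. exact He.
    + rewrite Rplus_0_l, Rmax_right, Rmin_left by lra.
      replace ((f h X + 0 * f' 0 X - (f 0 X + 0 * f' 0 X)) / h - f' 0 X)
        with ((f (0 + h) X - f 0 X) / h - f' 0 X) by (rewrite Rplus_0_l; field; lra).
      apply Hl; [assumption | split; lra | assumption].
  - rewrite Rmax_right by lra.
    apply (is_derive_ext_loc (fun u => f u X)).
    + apply (locally_interval 0 (t + 1)); [lra|]. intros u Hu.
      rewrite Rmax_right, Rmin_left by lra. symmetry.
      rewrite Rmult_0_l. apply Rplus_0_r.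
    + apply (Rderiv_within_is_derive (fun u => f u X) (fun u => f' u X) (fun u => Omega u X)).
      * apply Hd. split; lra.
      * apply (locally_interval 0 (t + 1)); [lra|]. intros u Hu. split; lra.
Qed.

Lemma is_derive_C1_ext_x (a : R) (f f' : R -> R -> R) (t x l : R) : 0 <= t -> a < x < 1 ->
  is_derive (f t) x l -> is_derive (C1_ext a f f' t) x l.
Proof.
  intros Ht Hx Hd. apply (is_derive_ext_loc (f t)); [|exact Hd].
  apply (locally_interval a 1); [exact Hx|]. intros y Hy.
  symmetry. apply C1_ext_eq; lra.
Qed.

(** * The equation differentiated n times in x *)

Lemma is_derive_leibniz (n : nat) (g p : nat -> R -> R) (x : R) :
  (forall j, is_derive (g j) x (g (S j) x)) -> (forall j, is_derive (p j) x (p (S j) x)) ->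
  is_derive (fun y => leibniz n (fun i => g i y) (fun j => p j y)) x
    (leibniz (S n) (fun i => g i x) (fun j => p j x)).
Proof.
  intros Hg Hp. rewrite leibniz_succ. unfold leibniz. rewrite <- plus_sum.
  apply (is_derive_sum_f_R0 (fun i y => binom n i * g (n - i)%nat y * p i y)).
  intros i. pose proof (Hg (n - i)%nat) as Dg. pose proof (Hp i) as Dp.
  auto_derive.
  - split; [|split; [|exact I]]; eexists; [exact Dg | exact Dp].
  - replace (Derive (fun y => g (n - i)%nat y) x) with (g (S (n - i)) x)
      by (symmetry; apply is_derive_unique, Dg).
    replace (Derive (fun y => p i y) x) with (p (S i) x)
      by (symmetry; apply is_derive_unique, Dp).
    ring.
Qed.

(* Real part: [c = -1]; imaginary part: [p] and [q] exchanged and [c = 1]. *)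
Lemma pde_iterated (c : R) (p q pt gr gi : nat -> R -> R) :
  (forall j x, 0 < x < 1 -> is_derive (p j) x (p (S j) x)) ->
  (forall j x, 0 < x < 1 -> is_derive (q j) x (q (S j) x)) ->
  (forall j x, 0 < x < 1 -> is_derive (pt j) x (pt (S j) x)) ->
  (forall j x, 0 < x < 1 -> is_derive (gr j) x (gr (S j) x)) ->
  (forall j x, 0 < x < 1 -> is_derive (gi j) x (gi (S j) x)) ->
  (forall x, 0 < x < 1 -> pt 1%nat x = - (x ^ 2 * p 2%nat x + 2 * x * p 1%nat x)
     + (gr 0%nat x * p 0%nat x + c * (gi 0%nat x * q 0%nat x))) ->
  forall n x, 0 < x < 1 ->
    pt (S n) x = - (x ^ 2 * p (S (S n)) x + 2 * (INR n + 1) * x * p (S n) x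
                    + INR n * (INR n + 1) * p n x)
      + (leibniz n (fun i => gr i x) (fun j => p j x)
         + c * leibniz n (fun i => gi i x) (fun j => q j x)).
Proof.
  intros Hp Hq Hpt Hgr Hgi H0 n. induction n as [|n IH]; intros x Hx.
  - rewrite H0 by exact Hx. unfold leibniz. simpl. ring.
  - pose proof (Hpt (S n) x Hx) as D1.
    set (rhs := fun y => - (y ^ 2 * p (S (S n)) y + 2 * (INR n + 1) * y * p (S n) y
                    + INR n * (INR n + 1) * p n y)
      + (leibniz n (fun i => gr i y) (fun j => p j y)
         + c * leibniz n (fun i => gi i y) (fun j => q j y))).
    assert (D2 : is_derive rhs x (pt (S (S n)) x)).
    { apply (is_derive_ext_loc (pt (S n))); [|exact D1].
      apply (locally_interval 0 1); [exact Hx|]. intros y Hy. apply IH, Hy. }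
    rewrite <- (is_derive_unique _ _ _ D2). apply is_derive_unique. unfold rhs.
    pose proof (is_derive_leibniz n gr p x (fun j => Hgr j x Hx) (fun j => Hp j x Hx)) as L1.
    pose proof (is_derive_leibniz n gi q x (fun j => Hgi j x Hx) (fun j => Hq j x Hx)) as L2.
    set (l1 := fun y => leibniz n (fun i => gr i y) (fun j => p j y)) in *.
    set (l2 := fun y => leibniz n (fun i => gi i y) (fun j => q j y)) in *.
    apply (is_derive_ext (fun y => - (y ^ 2 * p (S (S n)) y + 2 * (INR n + 1) * y * p (S n) y
                    + INR n * (INR n + 1) * p n y) + (l1 y + c * l2 y))); [reflexivity|].
    pose proof (Hp n x Hx) as P0. pose proof (Hp (S n) x Hx) as P1.
    pose proof (Hp (S (S n)) x Hx) as P2.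
    (* The coefficients add up: 2 + 2(n+1) = 2(n+2) for the middle term, and 2(n+1) + n(n+1) =
       (n+1)(n+2) for the lowest. *)
    rewrite S_INR.
    auto_derive.
    + repeat split; eexists; eassumption.
    + replace (Derive (fun y => p n y) x) with (p (S n) x)
        by (symmetry; apply is_derive_unique, P0).
      replace (Derive (fun y => p (S n) y) x) with (p (S (S n)) x)
        by (symmetry; apply is_derive_unique, P1).
      replace (Derive (fun y => p (S (S n)) y) x) with (p (S (S (S n))) x)
        by (symmetry; apply is_derive_unique, P2).
      replace (Derive (fun y => l1 y) x)
        with (leibniz (S n) (fun i => gr i x) (fun j => p j x))
        by (symmetry; apply is_derive_unique, L1).
      replace (Derive (fun y => l2 y) x)
        with (leibniz (S n) (fun i => gi i x) (fun j => q j x))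
        by (symmetry; apply is_derive_unique, L2).
      ring.
Qed.

(** What the energy estimate uses of a weight at x = 0: it is C^1, nonnegative and nonincreasing on
    [0, 1], with mass at most 1. *)
Definition is_kernel (k k' : R -> R) : Prop :=
  (forall x, is_derive k x (k' x)) /\ (forall x, continuous k' x) /\
  (forall x, 0 <= x <= 1 -> 0 <= k x) /\ (forall x, 0 <= x <= 1 -> k' x <= 0) /\
  Rint k 0 1 <= 1.

Lemma energy_density_ext (s : R) (k : R -> R) (M : nat) (p q p' q' : nat -> R -> R) (x : R) :
  (forall j, p j x = p' j x) -> (forall j, q j x = q' j x) ->
  energy_density s k M p q x = energy_density s k M p' q' x.
Proof.
  intros Hp Hq. unfold energy_density. apply sum_eq. intros n _. rewrite Hp, Hq. reflexivity.
Qed.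

Lemma continuous_modsqr (f g : R -> R) (x : R) : continuous f x -> continuous g x ->
  continuous (fun y => f y ^ 2 + g y ^ 2) x.
Proof.
  intros Hf Hg.
  assert (Hs : forall h : R -> R, continuous h x -> continuous (fun y => h y ^ 2) x).
  { intros h Hh. apply (continuous_comp h (fun w => w ^ 2)); [exact Hh|].
    apply (ex_derive_continuous (fun w : R => w ^ 2)). auto_derive; exact I. }
  apply (continuous_plus (fun y => f y ^ 2) (fun y => g y ^ 2)); apply Hs; assumption.
Qed.

Lemma continuous_energy_density (s : R) (k k' : R -> R) (M : nat) (p q : nat -> R -> R) (x : R) :
  0 < s -> is_kernel k k' -> (forall j, continuous (p j) x) -> (forall j, continuous (q j) x) ->
  continuous (energy_density s k M p q) x.
Proof.
  intros Hs [Hk _] Hp Hq. unfold energy_density.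
  apply (continuous_sum_f_R0 (fun n y => gweight s n * kap s (k y) y n * (p (S n) y ^ 2 + q (S n) y ^ 2))).
  intros n. apply (continuous_mult (fun y => gweight s n * kap s (k y) y n)).
  - apply (continuous_scal_r (gweight s n) (fun y => kap s (k y) y n)).
    apply (cont_kap s Hs k k' Hk).
  - apply continuous_modsqr; auto.
Qed.

Lemma energy_density_nonneg (s : R) (k k' : R -> R) (M : nat) (p q : nat -> R -> R) (x : R) :
  0 < s -> is_kernel k k' -> 0 <= x <= 1 -> 0 <= energy_density s k M p q x.
Proof.
  intros Hs [_ [_ [Hk0 _]]] Hx. unfold energy_density. apply sum_f_R0_nonneg. intros n _.
  pose proof (kap_ge_1 s (k x) x Hs (Hk0 x Hx) Hx n). pose proof (gweight_pos s n Hs).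
  pose proof (pow2_ge_0 (p (S n) x)). pose proof (pow2_ge_0 (q (S n) x)).
  apply Rmult_le_pos; [apply Rmult_le_pos; lra | lra].
Qed.

Lemma Rabs_fst_le_Cmod (z : Cx) : Rabs (fst z) <= Cmod z.
Proof.
  unfold Cmod, Cmod2. rewrite <- (sqrt_pow2 (Rabs (fst z))) by apply Rabs_pos.
  apply sqrt_le_1_alt. rewrite pow2_abs. pose proof (pow2_ge_0 (snd z)). lra.
Qed.

Lemma Rabs_snd_le_Cmod (z : Cx) : Rabs (snd z) <= Cmod z.
Proof.
  unfold Cmod, Cmod2. rewrite <- (sqrt_pow2 (Rabs (snd z))) by apply Rabs_pos.
  apply sqrt_le_1_alt. rewrite pow2_abs. pose proof (pow2_ge_0 (fst z)). lra.
Qed.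

Lemma cutoff_le_1 (a t x : R) : 0 < a < 1 -> 0 <= t -> cutoff a t x <= 1.
Proof.
  intros Ha Ht. unfold cutoff, cutoff_root.
  pose proof (clamp_bounds a x ltac:(lra)) as Hc.
  assert (0 < / clamp a x) by (apply Rinv_0_lt_compat; lra).
  rewrite <- (pow1 2). apply pow_incr. split; [apply Rmax_l|].
  apply Rmax_lub; [lra|]. assert (0 <= a * (/ clamp a x + t)) by (apply Rmult_le_pos; lra). lra.
Qed.

Lemma cutoff_ge (a t x d : R) : 0 < a < 1 -> a < d -> d <= x <= 1 -> a * (/ d + t) <= 1 ->
  (1 - a * (/ d + t)) ^ 2 <= cutoff a t x.
Proof.
  intros Ha Hd Hx H1. unfold cutoff, cutoff_root. rewrite clamp_id by lra.
  apply pow_incr. split; [lra|]. eapply Rle_trans; [|apply Rmax_r].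
  assert (/ x <= / d) by (apply Rinv_le_contravar; lra). nra.
Qed.

(** The limit a -> 0 for the lower bound of [cutoff_ge], with c = 1/delta + t. *)
Lemma le_of_quadratic_factor (I B c d : R) : 0 <= I -> 0 <= B -> 0 < c -> 0 < d ->
  (forall a, 0 < a < d -> a * c <= 1 -> (1 - a * c) ^ 2 * I <= B) -> I <= B.
Proof.
  intros HI HB Hc Hd H. apply Rnot_lt_le. intros Hlt.
  assert (HI0 : 0 < I) by lra.
  (* With a <= e one gets a c I <= (I - B)/4, hence (1 - a c)^2 I >= I - 2 a c I >= (I + B)/2 >
     B. *)
  set (e := (I - B) / (4 * c * I)).
  assert (He : 0 < e) by (apply Rdiv_lt_0_compat; [lra|]; repeat apply Rmult_lt_0_compat; lra).
  set (a := Rmin (d / 2) e).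
  assert (Ha : 0 < a) by (apply Rmin_pos; lra).
  assert (Hd' : a <= d / 2) by apply Rmin_l.
  assert (Hac : a * c * I <= (I - B) / 4).
  { apply Rle_trans with (e * c * I).
    - apply Rmult_le_compat_r; [lra|]. apply Rmult_le_compat_r; [lra | apply Rmin_r].
    - unfold e. apply Req_le. field. lra. }
  assert (Hac1 : a * c <= 1) by nra.
  pose proof (H a ltac:(lra) Hac1) as Ha'.
  assert (0 <= (a * c) ^ 2 * I) by (apply Rmult_le_pos; [apply pow2_ge_0 | lra]).
  nra.
Qed.

(** * Removing the cutoff *)

Lemma RInt_mult_le (f h : R -> R) (c a b : R) : a <= b ->
  (forall x, continuous f x) -> (forall x, continuous h x) ->
  (forall x, a < x < b -> c * f x <= h x) -> c * Rint f a b <= Rint h a b.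
Proof.
  intros Hab Hf Hh H.
  pose proof (RInt_scal (V := R_CompleteNormedModule) f a b c (ex_RInt_cont _ _ _ Hf)) as E.
  change (c * Rint f a b) with (scal c (Rint f a b)). rewrite <- E.
  apply RInt_le; [exact Hab | | apply ex_RInt_cont, Hh | exact H].
  apply (ex_RInt_scal (V := R_NormedModule)), ex_RInt_cont, Hf.
Qed.

(** On [delta, 1] the cutoff at time t2 tends to 1 as a -> 0, while at time t1 it is at most 1. At
    t1 the functions are replaced by continuous versions up to x = 0, so the right side is an
    integral over all of [0, 1]. *)
Lemma truncated_energy (s : R) (k k' : R -> R) (M : nat) (t1 t2 X : R)
  (u1 v1 u2 v2 d e : nat -> R -> R) :
  0 < s -> is_kernel k k' -> 0 <= t1 -> 0 <= t2 -> 0 <= X ->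
  (forall a j x, 0 < a < 1 -> continuous (fun y => u2 j (clamp a y)) x) ->
  (forall a j x, 0 < a < 1 -> continuous (fun y => v2 j (clamp a y)) x) ->
  (forall j x, continuous (d j) x) -> (forall j x, continuous (e j) x) ->
  (forall j x, 0 < x < 1 -> u1 j x = d j x) -> (forall j x, 0 < x < 1 -> v1 j x = e j x) ->
  (forall a, 0 < a < 1 ->
    Rint (fun x => cutoff a t2 x * energy_density s k M u2 v2 x) a 1
     <= X * Rint (fun x => cutoff a t1 x * energy_density s k M u1 v1 x) a 1) ->
  forall delta, 0 < delta < 1 ->
    Rint (energy_density s k M u2 v2) delta 1 <= X * Rint (energy_density s k M d e) 0 1.
Proof.
  intros Hs Hker Ht1 Ht2 HX Cu Cv Cd Ce Hu Hv H delta Hdelta.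
  assert (Cde : forall x, continuous (energy_density s k M d e) x)
    by (intros x; apply (continuous_energy_density s k k'); auto).
  assert (Hde : 0 <= Rint (energy_density s k M d e) 0 1).
  { apply RInt_ge_0; [lra | apply ex_RInt_cont, Cde|].
    intros x Hx. apply (energy_density_nonneg s k k'); auto; lra. }
  (* The functions at t2 may be singular at 0; clamping at a makes the density continuous without
     changing it on [a, 1]. *)
  set (w := fun a => energy_density s k M (fun j y => u2 j (clamp a y)) (fun j y => v2 j (clamp a y))).
  assert (Cw : forall a x, 0 < a < 1 -> continuous (w a) x).
  { intros a x Ha. apply (continuous_energy_density s k k'); auto. }
  assert (Hw0 : forall a x, 0 <= x <= 1 -> 0 <= w a x)
    by (intros a x Hx; apply (energy_density_nonneg s k k'); auto).
  assert (Ew : forall a x, a <= x <= 1 -> energy_density s k M u2 v2 x = w a x).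
  { intros a x Hx. unfold w. apply energy_density_ext; intros j; rewrite clamp_id by lra; reflexivity. }
  assert (Ed : forall a, 0 < a <= delta -> Rint (energy_density s k M u2 v2) delta 1 = Rint (w a) delta 1).
  { intros a Ha. apply RInt_ext. rewrite Rmin_left, Rmax_right by lra. intros x Hx. apply Ew. lra. }
  apply (le_of_quadratic_factor _ _ (/ delta + t2) delta).
  - rewrite (Ed delta) by lra. apply RInt_ge_0; [lra | apply ex_RInt_cont; intros; apply Cw; lra|].
    intros x Hx. apply Hw0. lra.
  - apply Rmult_le_pos; assumption.
  - pose proof (Rinv_0_lt_compat delta ltac:(lra)). lra.
  - lra.
  - intros a Ha Hac. assert (Ha1 : 0 < a < 1) by lra.
    assert (Ccut : forall t f, (forall x, continuous f x) ->
              forall x, continuous (fun y => cutoff a t y * f y) x).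
    { intros t f Cf x. apply (continuous_mult (fun y => cutoff a t y) f); [|apply Cf].
      apply (cont2_slice (cutoff a)), cont2_cutoff, Ha1. }
    rewrite (Ed a) by lra.
    apply Rle_trans with (Rint (fun x => cutoff a t2 x * w a x) delta 1).
    { apply RInt_mult_le; [lra | intros; apply Cw, Ha1 | |].
      - apply Ccut. intros; apply Cw, Ha1.
      - intros x Hx. apply Rmult_le_compat_r; [apply Hw0; lra | apply cutoff_ge; lra]. }
    apply Rle_trans with (Rint (fun x => cutoff a t2 x * w a x) a 1).
    { apply RInt_mono_bounds; try lra.
      - apply Ccut. intros; apply Cw, Ha1.
      - intros x Hx. apply Rmult_le_pos; [apply pow2_ge_0 | apply Hw0; lra]. }
    apply Rle_trans with (X * Rint (fun x => cutoff a t1 x * energy_density s k M u1 v1 x) a 1).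
    { eapply Rle_trans; [|apply H, Ha1]. apply Req_le. apply RInt_ext.
      rewrite Rmin_left, Rmax_right by lra. intros x Hx. rewrite (Ew a) by lra. reflexivity. }
    apply Rmult_le_compat_l; [exact HX|].
    apply Rle_trans with (Rint (energy_density s k M d e) a 1).
    + rewrite (RInt_ext _ (fun x => cutoff a t1 x * energy_density s k M d e x)).
      2: { rewrite Rmin_left, Rmax_right by lra. intros x Hx. f_equal.
           apply energy_density_ext; intros j; [apply Hu | apply Hv]; lra. }
      apply RInt_le; [lra | apply ex_RInt_cont, Ccut, Cde | apply ex_RInt_cont, Cde |].
      intros x Hx.
      pose proof (energy_density_nonneg s k k' M d e x Hs Hker ltac:(lra)).
      pose proof (cutoff_le_1 a t1 x Ha1 Ht1).
      rewrite <- (Rmult_1_l (energy_density s k M d e x)) at 2.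
      apply Rmult_le_compat_r; assumption.
    + apply RInt_mono_bounds; try lra; [exact Cde|].
      intros x Hx. apply (energy_density_nonneg s k k'); auto; lra.
Qed.

Lemma RInt_le_of_truncations (f : R -> R) (B : R) : (forall x, continuous f x) ->
  (forall delta, 0 < delta < 1 -> Rint f delta 1 <= B) -> Rint f 0 1 <= B.
Proof.
  intros Cf H. apply Rnot_lt_le. intros Hlt.
  assert (Hc : continuous (fun y => Rint f 0 y) 0).
  { apply (ex_derive_continuous (fun y => Rint f 0 y)). exists (f 0).
    apply is_derive_RInt_upper, Cf. }
  assert (He : 0 < Rint f 0 1 - B) by lra.
  destruct (proj1 (filterlim_locally _ _) Hc (mkposreal _ He)) as [d Hd].
  set (x := Rmin (1 / 2) (d / 2)).
  pose proof (cond_pos d).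
  assert (Hx : 0 < x) by (apply Rmin_pos; lra).
  assert (x <= 1 / 2) by apply Rmin_l. assert (x <= d / 2) by apply Rmin_r.
  assert (Hb : ball 0 d x).
  { change (Rabs (x - 0) < d). rewrite Rminus_0_r, Rabs_right; lra. }
  specialize (Hd x Hb). change (Rabs (Rint f 0 x - Rint f 0 0) < Rint f 0 1 - B) in Hd.
  rewrite RInt_point in Hd. unfold zero in Hd; simpl in Hd. rewrite Rminus_0_r in Hd.
  apply Rabs_lt_between in Hd.
  pose proof (RInt_Chasles f 0 x 1 (ex_RInt_cont _ _ _ Cf) (ex_RInt_cont _ _ _ Cf)) as E.
  unfold plus in E; simpl in E. pose proof (H x ltac:(lra)). lra.
Qed.

(** * Smooth extension to x = 0 *)

Lemma Rderiv_within_of_continuous (f g : R -> R) (x : R) :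
  (forall y, continuous f y) -> (forall y, continuous g y) ->
  (forall y, 0 < y < 1 -> is_derive f y (g y)) -> closed01 x ->
  Rderiv_within f g closed01 x.
Proof.
  intros Cf Cg Hd Hx. apply Rderiv_within_intro. intros eps He.
  destruct (proj1 (filterlim_locally _ _) (Cg x) (mkposreal _ He)) as [d Hball].
  exists d. split; [apply cond_pos|]. intros h Hh Hxh Hhd.
  destruct Hx as [Hx0 Hx1]. destruct Hxh as [Hy0 Hy1].
  (* The difference quotient is a value of g between x and x + h; continuity of g then gives the
     one-sided derivatives at 0 and 1. *)
  destruct (MVT_gen f x (x + h) g) as [c [Hc E]].
  - intros y Hy. apply Hd. revert Hy. unfold Rmin, Rmax. destruct Rle_dec; lra.
  - intros y _. apply continuity_pt_filterlim, Cf.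
  - rewrite E. replace (g c * (x + h - x) / h - g x) with (g c - g x) by (field; exact Hh).
    apply Hball. change (Rabs (c - x) < d). apply Rle_lt_trans with (Rabs h); [|exact Hhd].
    revert Hc. unfold Rmin, Rmax. unfold Rabs.
    destruct Rle_dec; repeat destruct Rcase_abs; lra.
Qed.

(** Every f x - B x lies below every f y + B y, so the supremum of the former is the limit at 0,
    with the rate attached. *)
Lemma lipschitz_limit_0 (f : R -> R) (B : R) : 0 <= B ->
  (forall x y, 0 < x <= 1 -> 0 < y <= 1 -> Rabs (f x - f y) <= B * Rabs (x - y)) ->
  exists l, forall x, 0 < x <= 1 -> Rabs (f x - l) <= B * x.
Proof.
  intros HB H.
  assert (Hxy : forall x y, 0 < x <= 1 -> 0 < y <= 1 -> f x - B * x <= f y + B * y).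
  { intros x y Hx Hy. pose proof (Rle_abs (f x - f y)). pose proof (H x y Hx Hy).
    assert (Rabs (x - y) <= x + y) by (unfold Rabs; destruct Rcase_abs; lra).
    assert (B * Rabs (x - y) <= B * (x + y)) by (apply Rmult_le_compat_l; assumption).
    lra. }
  destruct (completeness (fun z => exists x, 0 < x <= 1 /\ z = f x - B * x)) as [l [Hu Hl]].
  - exists (f 1 + B * 1). intros z [x [Hx ->]]. apply Hxy; lra.
  - exists (f 1 - B * 1). exists 1. split; [lra | reflexivity].
  - exists l. intros x Hx. apply Rabs_le_between'.
    assert (f x - B * x <= l) by (apply Hu; exists x; split; [assumption | reflexivity]).
    assert (l <= f x + B * x).
    { apply Hl. intros z [y [Hy ->]]. apply Hxy; assumption. }
    lra.
Qed.

Lemma continuous_of_lipschitz (f : R -> R) (B : R) :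
  (forall x y, Rabs (f x - f y) <= B * Rabs (x - y)) -> forall x, continuous f x.
Proof.
  intros H x. apply filterlim_locally. intros eps.
  assert (HB : 0 < Rabs B + 1) by (pose proof (Rabs_pos B); lra).
  assert (Hd : 0 < eps / (Rabs B + 1)) by (apply Rdiv_lt_0_compat; [apply cond_pos | exact HB]).
  exists (mkposreal _ Hd). intros y Hy. change (Rabs (y - x) < eps / (Rabs B + 1)) in Hy.
  change (Rabs (f y - f x) < eps). eapply Rle_lt_trans; [apply H|].
  pose proof (Rabs_pos (y - x)). pose proof (Rle_abs B).
  apply Rle_lt_trans with ((Rabs B + 1) * Rabs (y - x)); [nra|].
  apply (Rmult_lt_compat_l (Rabs B + 1)) in Hy; [|exact HB].
  replace ((Rabs B + 1) * (eps / (Rabs B + 1))) with (pos eps) in Hy by (field; lra). exact Hy.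
Qed.

(** From |f| <= 1 + f^2; only finiteness matters where this is applied. *)
Lemma RInt_Rabs_le_sqr (f : R -> R) (a b : R) : a <= b -> b - a <= 1 ->
  (forall x, continuous f x) ->
  Rabs (Rint f a b) <= 1 + Rint (fun x => f x ^ 2) a b.
Proof.
  intros Hab Hba Cf.
  assert (Cs : forall x, continuous (fun y => f y ^ 2) x).
  { intros x. apply (continuous_comp f (fun w => w ^ 2)); [apply Cf|].
    apply (ex_derive_continuous (fun w : R => w ^ 2)). auto_derive; exact I. }
  assert (E : is_RInt (fun x => plus 1 (f x ^ 2)) a b (plus (scal (b - a) 1) (Rint (fun x => f x ^ 2) a b))).
  { apply (is_RInt_plus (V := R_NormedModule)); [apply (is_RInt_const (V := R_NormedModule))|].
    apply (RInt_correct (V := R_CompleteNormedModule)), ex_RInt_cont, Cs. }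
  apply Rle_trans with (plus (scal (b - a) 1) (Rint (fun x => f x ^ 2) a b)).
  - match type of E with is_RInt ?g _ _ ?v => rewrite <- (is_RInt_unique g a b v E) end.
    eapply Rle_trans; [apply abs_RInt_le; [exact Hab | apply ex_RInt_cont, Cf]|].
    apply RInt_le; [exact Hab | | eexists; exact E |].
    + apply (ex_RInt_norm f), ex_RInt_cont, Cf.
    + intros x _. unfold plus; simpl. unfold Rabs; destruct Rcase_abs; nra.
  - unfold plus, scal; simpl; unfold mult; simpl. lra.
Qed.

(** Two derivatives are spent: square integrability at order j+2 bounds order j+1 near 0, which
    makes order j Lipschitz on (0, 1] and gives it a limit at 0. Since all orders are available,
    nothing is lost. *)
Lemma smooth_extension (u : nat -> R -> R) :
  (forall a j x, 0 < a < 1 -> continuous (fun y => u j (clamp a y)) x) ->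
  (forall j x, 0 < x < 1 -> is_derive (u j) x (u (S j) x)) ->
  (forall j, exists K, forall delta, 0 < delta < 1 -> Rint (fun x => u (S j) x ^ 2) delta 1 <= K) ->
  exists d : nat -> R -> R, (forall j x, 0 < x <= 1 -> d j x = u j x) /\
    (forall j x, continuous (d j) x) /\
    (forall j x, 0 < x < 1 -> is_derive (d j) x (d (S j) x)).
Proof.
  intros Cu Du HK.
  assert (Dcl : forall a j x, 0 < a -> a < x < 1 ->
            is_derive (fun y => u j (clamp a y)) x (u (S j) (clamp a x))).
  { intros a j x Ha Hx. rewrite (clamp_id a x) by lra.
    apply (is_derive_ext_loc (u j)); [|apply Du; lra].
    apply (locally_interval a 1); [exact Hx|]. intros y Hy. rewrite clamp_id by lra. reflexivity. }
  assert (HB : forall j, exists B, 0 <= B /\ forall x, 0 < x <= 1 -> Rabs (u (S j) x) <= B).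
  { intros j. destruct (HK (S j)) as [K HKj]. exists (Rabs (u (S j) 1) + 1 + Rabs K).
    pose proof (Rabs_pos (u (S j) 1)). pose proof (Rabs_pos K). split; [lra|].
    intros x Hx. destruct (Req_dec x 1) as [->|Hne]; [lra|].
    assert (Hx1 : 0 < x < 1) by lra.
    pose proof (RInt_derive_open (fun y => u (S j) (clamp x y)) (fun y => u (S (S j)) (clamp x y))
      x 1 ltac:(lra) (fun y => Cu x (S j) y Hx1) (fun y => Cu x (S (S j)) y Hx1)
      (fun y Hy => Dcl x (S j) y ltac:(lra) Hy)) as E.
    cbv beta in E. rewrite !clamp_id in E by lra.
    pose proof (RInt_Rabs_le_sqr (fun y => u (S (S j)) (clamp x y)) x 1 ltac:(lra) ltac:(lra)
      (fun y => Cu x (S (S j)) y Hx1)) as Hi.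
    rewrite E in Hi.
    rewrite (RInt_ext (fun y => u (S (S j)) (clamp x y) ^ 2) (fun y => u (S (S j)) y ^ 2)) in Hi.
    2: { rewrite Rmin_left, Rmax_right by lra. intros y Hy. rewrite clamp_id by lra. reflexivity. }
    pose proof (HKj x Hx1). pose proof (Rle_abs K).
    pose proof (Rabs_triang (u (S j) 1) (- (u (S j) 1 - u (S j) x))) as T.
    rewrite Rabs_Ropp in T.
    replace (u (S j) 1 + - (u (S j) 1 - u (S j) x)) with (u (S j) x) in T by ring. lra. }
  assert (HL : forall j, exists B, 0 <= B /\ forall x y, 0 < x <= 1 -> 0 < y <= 1 ->
             Rabs (u j x - u j y) <= B * Rabs (x - y)).
  { intros j. destruct (HB j) as [B [HB0 HBj]]. exists B. split; [exact HB0|].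
    assert (Hlt : forall x y, 0 < x -> x < y -> y <= 1 -> Rabs (u j x - u j y) <= B * Rabs (x - y)).
    { intros x y Hx Hxy Hy. assert (Hx1 : 0 < x < 1) by lra.
      destruct (MVT_gen (fun z => u j (clamp x z)) x y (fun z => u (S j) (clamp x z))) as [c [Hc E]].
      - rewrite Rmin_left, Rmax_right by lra. intros z Hz. apply Dcl; lra.
      - intros z _. apply continuity_pt_filterlim, Cu, Hx1.
      - rewrite Rmin_left, Rmax_right in Hc by lra. rewrite !clamp_id in E by lra.
        rewrite (Rabs_minus_sym (u j x)), E, Rabs_mult, (Rabs_minus_sym x).
        apply Rmult_le_compat_r; [apply Rabs_pos | apply HBj; lra]. }
    intros x y Hx Hy. destruct (Rtotal_order x y) as [H|[H|H]].
    - apply Hlt; lra.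
    - subst y. rewrite !Rminus_diag, Rabs_R0. lra.
    - rewrite (Rabs_minus_sym (u j x)), (Rabs_minus_sym x). apply Hlt; lra. }
  assert (Hl : forall j, exists l, exists B, 0 <= B /\
     (forall x y, 0 < x <= 1 -> 0 < y <= 1 -> Rabs (u j x - u j y) <= B * Rabs (x - y)) /\
     forall x, 0 < x <= 1 -> Rabs (u j x - l) <= B * x).
  { intros j. destruct (HL j) as [B [HB0 HBj]].
    destruct (lipschitz_limit_0 (u j) B HB0 HBj) as [l Hlj]. exists l, B. auto. }
  set (l := fun j => proj1_sig (constructive_indefinite_description _ (Hl j))).
  (* Constant outside [0, 1], with the limit [l j] as value for x <= 0, so that the Lipschitz bound
     holds on the whole line. *)
  set (d := fun j x => if Rle_dec (clamp 0 x) 0 then l j else u j (clamp 0 x)).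
  assert (Ed : forall j x, 0 < x <= 1 -> d j x = u j x).
  { intros j x Hx. unfold d. rewrite clamp_id by lra. destruct Rle_dec; [lra | reflexivity]. }
  exists d. split; [exact Ed|]. split.
  - intros j. pose proof (proj2_sig (constructive_indefinite_description _ (Hl j))) as Hj.
    fold (l j) in Hj. cbv beta in Hj.
    destruct Hj as [B [HB0 [HBj Hlj]]].
    apply (continuous_of_lipschitz (d j) B). intros x y.
    pose proof (clamp_lipschitz 0 x y) as Hc.
    pose proof (clamp_bounds 0 x ltac:(lra)). pose proof (clamp_bounds 0 y ltac:(lra)).
    apply Rle_trans with (B * Rabs (clamp 0 x - clamp 0 y));
      [|apply Rmult_le_compat_l; assumption].
    unfold d. set (X := clamp 0 x) in *. set (Y := clamp 0 y) in *.
    destruct (Rle_dec X 0), (Rle_dec Y 0).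
    + rewrite Rminus_diag, Rabs_R0. apply Rmult_le_pos; [assumption | apply Rabs_pos].
    + replace X with 0 by lra. rewrite Rabs_minus_sym.
      replace (Rabs (0 - Y)) with Y by (rewrite Rabs_minus_sym, Rminus_0_r, Rabs_right; lra).
      apply Hlj; lra.
    + replace Y with 0 by lra. rewrite Rminus_0_r, (Rabs_right X) by lra. apply Hlj; lra.
    + apply HBj; lra.
  - intros j x Hx. rewrite (Ed (S j) x) by lra.
    apply (is_derive_ext_loc (u j)); [|apply Du, Hx].
    apply (locally_interval 0 1); [exact Hx|]. intros y Hy. symmetry. apply Ed. lra.
Qed.

Lemma continuous_clamp_of_Rderiv_within (f f' : R -> R) :
  (forall x, closed01 x -> Rderiv_within f f' closed01 x) ->
  forall x, continuous (fun y => f (clamp 0 y)) x.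
Proof.
  intros H x. apply filterlim_locally. intros eps.
  pose proof (clamp_bounds 0 x ltac:(lra)) as Hx.
  destruct (Rderiv_within_elim f f' closed01 (clamp 0 x) 1 (H _ Hx) Rlt_0_1) as [d [Hd Hl]].
  set (X := clamp 0 x) in *. set (K := Rabs (f' X) + 1).
  assert (HK : 0 < K) by (unfold K; pose proof (Rabs_pos (f' X)); lra).
  assert (Hm : 0 < Rmin d (eps / K)).
  { apply Rmin_pos; [exact Hd|]. apply Rdiv_lt_0_compat; [apply cond_pos | exact HK]. }
  exists (mkposreal _ Hm). intros y Hy. change (Rabs (y - x) < Rmin d (eps / K)) in Hy.
  change (Rabs (f (clamp 0 y) - f X) < eps).
  pose proof (clamp_lipschitz 0 y x) as Hc. fold X in Hc.
  pose proof (clamp_bounds 0 y ltac:(lra)) as HY. set (Y := clamp 0 y) in *.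
  pose proof (Rmin_l d (eps / K)). pose proof (Rmin_r d (eps / K)).
  destruct (Req_dec Y X) as [E|E].
  { rewrite E, Rminus_diag, Rabs_R0. apply cond_pos. }
  assert (Hh : Y - X <> 0) by lra.
  pose proof (Hl (Y - X) Hh) as Hq. replace (X + (Y - X)) with Y in Hq by ring.
  specialize (Hq HY ltac:(lra)).
  set (Q := (f Y - f X) / (Y - X)) in *.
  assert (HQ : Rabs Q < K).
  { pose proof (Rabs_triang (Q - f' X) (f' X)) as T.
    replace (Q - f' X + f' X) with Q in T by ring. unfold K. lra. }
  replace (f Y - f X) with (Q * (Y - X)) by (unfold Q; field; exact Hh).
  rewrite Rabs_mult.
  apply Rle_lt_trans with (K * Rabs (Y - X)).
  - apply Rmult_le_compat_r; [apply Rabs_pos | lra].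
  - replace (pos eps) with (K * (eps / K)) by (field; lra).
    apply Rmult_lt_compat_l; lra.
Qed.

(** Identifies the x-derivatives of the solution on (0, 1) with those of a smooth function on [0, 1]
    by uniqueness of derivatives. *)
Lemma derivative_families_agree (u d : nat -> R -> R) :
  (forall x, 0 < x < 1 -> u 0%nat x = d 0%nat x) ->
  (forall j x, 0 < x < 1 -> is_derive (u j) x (u (S j) x)) ->
  (forall j x, 0 < x < 1 -> is_derive (d j) x (d (S j) x)) ->
  forall j x, 0 < x < 1 -> u j x = d j x.
Proof.
  intros H0 Hu Hd j. induction j as [|j IH]; intros x Hx; [apply H0, Hx|].
  rewrite <- (is_derive_unique _ _ _ (Hu j x Hx)). apply is_derive_unique.
  apply (is_derive_ext_loc (d j)); [|apply Hd, Hx].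
  apply (locally_interval 0 1); [exact Hx|]. intros y Hy. symmetry. apply IH, Hy.
Qed.

(** * Approximation of the Dirac mass *)

Definition dirac_approx (m : nat) (x : R) : R := (INR m + 1) * (1 - x) ^ m.

(** The explicit tail gives both the total mass 1, at a = 0, and the concentration at 0, for 0 < a <
    1. *)
Lemma dirac_approx_RInt (m : nat) (a : R) : Rint (dirac_approx m) a 1 = (1 - a) ^ S m.
Proof.
  apply is_RInt_unique.
  replace ((1 - a) ^ S m) with (minus (- (1 - 1) ^ S m) (- (1 - a) ^ S m)).
  2: { unfold minus, plus, opp; simpl. ring. }
  apply (is_RInt_derive (fun x => - (1 - x) ^ S m) (dirac_approx m)).
  - intros x _. unfold dirac_approx. auto_derive; [exact I|].
    change (match m with O => 1 | S _ => INR m + 1 end) with (INR (S m)).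
    rewrite S_INR. change (1 + - x) with (1 - x). generalize ((1 - x) ^ m); intros w. ring.
  - intros x _. apply (ex_derive_continuous (dirac_approx m)). unfold dirac_approx.
    auto_derive. exact I.
Qed.

(** For m = 0 the factor [INR m] makes the derivative vanish, whatever [pred 0] is. *)
Lemma dirac_approx_kernel (m : nat) :
  is_kernel (dirac_approx m) (fun x => - ((INR m + 1) * (INR m * (1 - x) ^ pred m))).
Proof.
  pose proof (pos_INR m). unfold is_kernel. split; [|split; [|split; [|split]]].
  - intros x. unfold dirac_approx. auto_derive; [exact I|].
    change (1 + - x) with (1 - x). generalize ((1 - x) ^ pred m); intros w. ring.
  - intros x. apply (ex_derive_continuous (fun x => - ((INR m + 1) * (INR m * (1 - x) ^ pred m)))).
    auto_derive. exact I.
  - intros x Hx. unfold dirac_approx. apply Rmult_le_pos; [lra | apply pow_le; lra].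
  - intros x Hx.
    assert (0 <= (INR m + 1) * (INR m * (1 - x) ^ pred m)).
    { apply Rmult_le_pos; [lra|]. apply Rmult_le_pos; [lra | apply pow_le; lra]. }
    lra.
  - rewrite dirac_approx_RInt, Rminus_0_r, pow1. lra.
Qed.

(** The integral of k (f - f 0) is split at d: near 0 the second factor is small and the mass is at
    most 1; beyond d it is bounded and the mass (1 - d)^(m+1) tends to 0. *)
Lemma dirac_approx_limit (f : R -> R) : (forall x, continuous f x) ->
  Un_cv (fun m => Rint (fun x => dirac_approx m x * f x) 0 1) (f 0).
Proof.
  intros Cf eps He.
  assert (Ck : forall m x, continuous (dirac_approx m) x).
  { intros m x. apply (ex_derive_continuous (dirac_approx m)). unfold dirac_approx.
    auto_derive. exact I. }
  assert (He2 : 0 < eps / 2) by lra.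
  destruct (proj1 (filterlim_locally _ _) (Cf 0) (mkposreal _ He2)) as [d' Hd'].
  set (d := Rmin (1 / 2) (d' / 2)). pose proof (cond_pos d') as Hdp.
  assert (Hd : 0 < d <= 1 / 2) by (split; [apply Rmin_pos; lra | apply Rmin_l]).
  assert (Hdd : d <= d' / 2) by apply Rmin_r.
  assert (Hnear : forall x, 0 <= x <= d -> Rabs (f x - f 0) < eps / 2).
  { intros x Hx. apply Hd'. change (Rabs (x - 0) < d').
    rewrite Rminus_0_r, Rabs_right; lra. }
  assert (HB : exists B, 0 < B /\ forall x, 0 <= x <= 1 -> Rabs (f x - f 0) <= B).
  { destruct (continuity_ab_maj (fun x => Rabs (f x - f 0)) 0 1) as [c [Hc _]]; [lra| |].
    - intros x _. apply continuity_pt_filterlim.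
      apply (continuous_comp (fun y => f y - f 0) Rabs).
      + apply (continuous_minus f (fun _ => f 0)); [apply Cf | apply continuous_const].
      + apply continuous_Rabs.
    - exists (Rabs (f c - f 0) + 1). pose proof (Rabs_pos (f c - f 0)). split; [lra|].
      intros x Hx. pose proof (Hc x Hx). lra. }
  destruct HB as [B [HB0 HB]].
  destruct (pow_lt_1_zero (1 - d) ltac:(rewrite Rabs_right; lra) (eps / (2 * B))
     ltac:(apply Rdiv_lt_0_compat; lra)) as [n0 Hn0].
  exists n0. intros m Hm. unfold Rdist.
  set (g := fun x => f x - f 0).
  assert (Cg : forall x, continuous g x)
    by (intros x; apply (continuous_minus f (fun _ => f 0)); [apply Cf | apply continuous_const]).
  assert (Ckg : forall h x, (forall x, continuous h x) -> continuous (fun y => dirac_approx m y * h y) x)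
    by (intros h x Ch; apply (continuous_mult (dirac_approx m) h); [apply Ck | apply Ch]).
  assert (E : Rint (fun x => dirac_approx m x * f x) 0 1 - f 0
              = Rint (fun x => dirac_approx m x * g x) 0 1).
  { assert (E1 : is_RInt (fun x => plus (dirac_approx m x * g x) (scal (f 0) (dirac_approx m x))) 0 1
       (plus (Rint (fun x => dirac_approx m x * g x) 0 1) (scal (f 0) (Rint (dirac_approx m) 0 1)))).
    { apply (is_RInt_plus (V := R_NormedModule)).
      - apply (RInt_correct (V := R_CompleteNormedModule)), ex_RInt_cont. intros; apply Ckg, Cg.
      - apply (is_RInt_scal (V := R_NormedModule)).
        apply (RInt_correct (V := R_CompleteNormedModule)), ex_RInt_cont, Ck. }
    apply (is_RInt_unique (V := R_CompleteNormedModule)) in E1.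
    rewrite (RInt_ext (fun x => dirac_approx m x * f x)
       (fun x => plus (dirac_approx m x * g x) (scal (f 0) (dirac_approx m x)))).
    - rewrite E1, dirac_approx_RInt, Rminus_0_r, pow1.
      unfold plus, scal; simpl; unfold mult; simpl. ring.
    - intros x _. unfold g, plus, scal; simpl; unfold mult; simpl. ring. }
  rewrite E.
  assert (Hk0 : forall x, 0 <= x <= 1 -> 0 <= dirac_approx m x)
    by apply (dirac_approx_kernel m).
  assert (Iabs : forall a b K, a <= b -> 0 <= a -> b <= 1 ->
     (forall x, a < x < b -> Rabs (g x) <= K) ->
     Rabs (Rint (fun x => dirac_approx m x * g x) a b) <= K * Rint (dirac_approx m) a b).
  { intros a b K Hab Ha0 Hb1 Hg.
    eapply Rle_trans; [apply abs_RInt_le; [exact Hab | apply ex_RInt_cont; intros; apply Ckg, Cg]|].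
    change (K * Rint (dirac_approx m) a b) with (scal K (Rint (dirac_approx m) a b)).
    rewrite <- (RInt_scal (V := R_CompleteNormedModule) (dirac_approx m) a b K)
      by (apply ex_RInt_cont, Ck).
    apply RInt_le; [exact Hab | | apply (ex_RInt_scal (V := R_NormedModule)), ex_RInt_cont, Ck |].
    - apply (ex_RInt_norm (fun x => dirac_approx m x * g x)), ex_RInt_cont. intros; apply Ckg, Cg.
    - intros x Hx. rewrite Rabs_mult. pose proof (Hk0 x ltac:(lra)) as Hkx.
      rewrite (Rabs_right (dirac_approx m x)) by lra. unfold scal; simpl; unfold mult; simpl.
      rewrite Rmult_comm. apply Rmult_le_compat_r; [exact Hkx | apply Hg, Hx]. }
  assert (Ch : Rint (fun x => dirac_approx m x * g x) 0 1
     = Rint (fun x => dirac_approx m x * g x) 0 d + Rint (fun x => dirac_approx m x * g x) d 1).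
  { symmetry. apply (RInt_Chasles (fun x => dirac_approx m x * g x) 0 d 1);
      apply ex_RInt_cont; intros; apply Ckg, Cg. }
  assert (Ck2 : Rint (dirac_approx m) 0 1 = Rint (dirac_approx m) 0 d + Rint (dirac_approx m) d 1).
  { symmetry. apply (RInt_Chasles (dirac_approx m) 0 d 1); apply ex_RInt_cont, Ck. }
  rewrite !dirac_approx_RInt, Rminus_0_r, pow1 in Ck2.
  pose proof (Iabs 0 d (eps / 2) ltac:(lra) ltac:(lra) ltac:(lra)
    (fun x Hx => Rlt_le _ _ (Hnear x ltac:(lra)))) as I1.
  pose proof (Iabs d 1 B ltac:(lra) ltac:(lra) ltac:(lra) (fun x Hx => HB x ltac:(lra))) as I2.
  rewrite dirac_approx_RInt in I2.
  pose proof (Hn0 (S m) ltac:(lia)) as Hp.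
  assert (Hpp : 0 < (1 - d) ^ S m) by (apply pow_lt; lra).
  rewrite Rabs_right in Hp by lra.
  assert (B * (1 - d) ^ S m < eps / 2).
  { apply (Rmult_lt_compat_l B) in Hp; [|exact HB0].
    replace (B * (eps / (2 * B))) with (eps / 2) in Hp by (field; lra). exact Hp. }
  rewrite Ch. eapply Rle_lt_trans; [apply Rabs_triang|].
  assert (eps / 2 * Rint (dirac_approx m) 0 d <= eps / 2).
  { assert (Rint (dirac_approx m) 0 d <= 1) by lra. nra. }
  lra.
Qed.

Lemma Un_cv_const (c : R) : Un_cv (fun _ => c) c.
Proof.
  intros eps He. exists 0%nat. intros n _. unfold Rdist. rewrite Rminus_diag, Rabs_R0. exact He.
Qed.

Lemma Defs_RInt_eq (f g : R -> R) : (forall x, continuous g x) ->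
  (forall x, 0 < x < 1 -> f x = g x) -> Defs.RInt f 0 1 = Rint g 0 1.
Proof.
  intros Cg Hfg.
  assert (Ex : ex_RInt f 0 1).
  { apply (ex_RInt_ext g); [|apply ex_RInt_cont, Cg].
    rewrite Rmin_left, Rmax_right by lra. intros x Hx. symmetry. apply Hfg, Hx. }
  rewrite (RInt_ext g f).
  2: { rewrite Rmin_left, Rmax_right by lra. intros x Hx. symmetry. apply Hfg, Hx. }
  unfold Defs.RInt. destruct excluded_middle_informative as [H|H].
  - symmetry. apply RInt_Reals.
  - exfalso. apply H. exists (ex_RInt_Reals_0 _ _ _ Ex). exact I.
Qed.

(** * Norm as a limit of energies *)

(** With the four series merged, one energy limit produces all of them at once; nonnegativity of the
    terms allows them to be separated again. *)
Definition norm_term (s : R) (v : nat -> R -> Cx) (n : nat) : R :=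
  seminorm_term s 0 0 v n + seminorm_term s 1 0 v n + seminorm_term s 2 0 v n
    + boundary_term s v n.

Section NormTerms.

Context (s : R) (Hs : 0 < s) (v : nat -> R -> Cx) (d e : nat -> R -> R)
  (Cd : forall j x, continuous (d j) x) (Ce : forall j x, continuous (e j) x)
  (Hv : forall n x, 0 <= x <= 1 -> v n x = (d (S n) x, e (S n) x)).

Lemma continuous_weighted_modsqr (w : R -> R) (n : nat) (x : R) : continuous w x ->
  continuous (fun y => w y * (d (S n) y ^ 2 + e (S n) y ^ 2)) x.
Proof.
  intros Hw. apply (continuous_mult w (fun y => d (S n) y ^ 2 + e (S n) y ^ 2)); [exact Hw|].
  apply continuous_modsqr; auto.
Qed.

Lemma continuous_div_pow (i : nat) (x : R) : continuous (fun y => (y / s) ^ i) x.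
Proof.
  apply (ex_derive_continuous (fun y => (y / s) ^ i)). auto_derive. exact I.
Qed.

Lemma seminorm_term_eq (i n : nat) : seminorm_term s i 0 v n =
  gweight s n * INR n ^ i * Rint (fun x => (x / s) ^ i * (d (S n) x ^ 2 + e (S n) x ^ 2)) 0 1.
Proof.
  unfold seminorm_term. rewrite Nat.add_0_r. f_equal.
  apply Defs_RInt_eq.
  - intros x. apply continuous_weighted_modsqr, continuous_div_pow.
  - intros x Hx. rewrite Hv by lra. reflexivity.
Qed.

Lemma boundary_term_eq (n : nat) :
  boundary_term s v n = gweight s n * (s * (d (S n) 0 ^ 2 + e (S n) 0 ^ 2)).
Proof.
  unfold boundary_term, gweight. rewrite Hv by lra. unfold Cmod2. simpl fst; simpl snd.
  rewrite pow_add, pow_1. unfold Rdiv. ring.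
Qed.

Lemma seminorm_term_nonneg (i n : nat) : 0 <= seminorm_term s i 0 v n.
Proof.
  rewrite seminorm_term_eq. pose proof (gweight_pos s n Hs).
  apply Rmult_le_pos; [apply Rmult_le_pos; [lra | apply pow_le, pos_INR]|].
  apply RInt_ge_0; [lra | |].
  - apply ex_RInt_cont. intros x. apply continuous_weighted_modsqr, continuous_div_pow.
  - intros x Hx. apply Rmult_le_pos.
    + apply pow_le. apply Rlt_le, Rdiv_lt_0_compat; lra.
    + pose proof (pow2_ge_0 (d (S n) x)). pose proof (pow2_ge_0 (e (S n) x)). lra.
Qed.

Lemma boundary_term_nonneg (n : nat) : 0 <= boundary_term s v n.
Proof.
  rewrite boundary_term_eq. pose proof (gweight_pos s n Hs).
  pose proof (pow2_ge_0 (d (S n) 0)). pose proof (pow2_ge_0 (e (S n) 0)).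
  apply Rmult_le_pos; [lra|]. apply Rmult_le_pos; lra.
Qed.

(** The summands of [kap] match the seminorms one by one, and the factor s in front of k supplies
    the odd power s^(2n+1) of the boundary term. *)
Lemma energy_term_RInt (m n : nat) :
  is_RInt (fun x => gweight s n * kap s (dirac_approx m x) x n * (d (S n) x ^ 2 + e (S n) x ^ 2)) 0 1
    (seminorm_term s 0 0 v n + seminorm_term s 1 0 v n + seminorm_term s 2 0 v n
     + gweight s n * s * Rint (fun x => dirac_approx m x * (d (S n) x ^ 2 + e (S n) x ^ 2)) 0 1).
Proof.
  rewrite !seminorm_term_eq.
  set (B := fun x => d (S n) x ^ 2 + e (S n) x ^ 2).
  assert (HI : forall w, (forall x, continuous w x) ->
     is_RInt (fun x => w x * B x) 0 1 (Rint (fun x => w x * B x) 0 1)).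
  { intros w Hw. apply (RInt_correct (V := R_CompleteNormedModule)), ex_RInt_cont.
    intros x. apply continuous_weighted_modsqr, Hw. }
  assert (Ck : forall x, continuous (dirac_approx m) x).
  { intros x. apply (ex_derive_continuous (dirac_approx m)).
    eexists. apply (proj1 (dirac_approx_kernel m)). }
  pose proof (is_RInt_scal (V := R_NormedModule) _ _ _ (gweight s n * INR n ^ 0) _ (HI _ (continuous_div_pow 0))) as I0.
  pose proof (is_RInt_scal (V := R_NormedModule) _ _ _ (gweight s n * INR n ^ 1) _ (HI _ (continuous_div_pow 1))) as I1.
  pose proof (is_RInt_scal (V := R_NormedModule) _ _ _ (gweight s n * INR n ^ 2) _ (HI _ (continuous_div_pow 2))) as I2.
  pose proof (is_RInt_scal (V := R_NormedModule) _ _ _ (gweight s n * s) _ (HI _ Ck)) as I3.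
  pose proof (is_RInt_plus (V := R_NormedModule) _ _ _ _ _ _
    (is_RInt_plus (V := R_NormedModule) _ _ _ _ _ _
      (is_RInt_plus (V := R_NormedModule) _ _ _ _ _ _ I0 I1) I2) I3) as I4.
  eapply is_RInt_ext; [|exact I4].
  intros x _. unfold plus, scal; simpl; unfold mult; simpl. unfold kap. fold (B x).
  change (d (S n) x * (d (S n) x * 1) + e (S n) x * (e (S n) x * 1)) with (B x). ring.
Qed.

(** At fixed M the sum is finite, so the limit m -> oo is taken term by term, and only the Dirac
    part depends on m. *)
Lemma energy_limit (M : nat) :
  Un_cv (fun m => Rint (energy_density s (dirac_approx m) M d e) 0 1)
        (sum_f_R0 (norm_term s v) M).
Proof.
  set (term := fun m n => seminorm_term s 0 0 v n + seminorm_term s 1 0 v n + seminorm_term s 2 0 v n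
     + gweight s n * s * Rint (fun x => dirac_approx m x * (d (S n) x ^ 2 + e (S n) x ^ 2)) 0 1).
  assert (E : forall m, Rint (energy_density s (dirac_approx m) M d e) 0 1 = sum_f_R0 (term m) M).
  { intros m. apply is_RInt_unique. unfold energy_density.
    induction M as [|M' IH]; simpl sum_f_R0; [apply energy_term_RInt|].
    apply (is_RInt_plus (V := R_NormedModule)
      (fun x => sum_f_R0 (fun n => gweight s n * kap s (dirac_approx m x) x n *
                                   (d (S n) x ^ 2 + e (S n) x ^ 2)) M'));
      [exact IH | apply energy_term_RInt]. }
  apply (Un_cv_ext (fun m => sum_f_R0 (term m) M)); [intros m; symmetry; apply E|].
  assert (T : forall n, Un_cv (fun m => term m n) (norm_term s v n)).
  { intros n. unfold term, norm_term. rewrite boundary_term_eq.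
    apply CV_plus; [apply Un_cv_const|].
    replace (gweight s n * (s * (d (S n) 0 ^ 2 + e (S n) 0 ^ 2)))
      with (gweight s n * s * (d (S n) 0 ^ 2 + e (S n) 0 ^ 2)) by ring.
    apply CV_mult; [apply Un_cv_const|].
    apply (dirac_approx_limit (fun x => d (S n) x ^ 2 + e (S n) x ^ 2)).
    intros x. apply continuous_modsqr; auto. }
  clear E. induction M as [|M' IH]; simpl; [apply T | apply CV_plus; [exact IH | apply T]].
Qed.

End NormTerms.

Lemma series_sum_of_bounded (a : nat -> R) (B : R) : (forall n, 0 <= a n) ->
  (forall M, sum_f_R0 a M <= B) -> exists S, series_sum a S.
Proof.
  intros Ha HB. destruct (growing_cv (fun M => sum_f_R0 a M)) as [l Hl].
  - intros n. simpl. pose proof (Ha (S n)). lra.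
  - exists B. intros x [n ->]. apply HB.
  - exists l. exact Hl.
Qed.

Lemma series_sum_partial_le (a : nat -> R) (S : R) (M : nat) : (forall n, 0 <= a n) ->
  series_sum a S -> sum_f_R0 a M <= S.
Proof.
  intros Ha HS. apply (growing_ineq (fun M => sum_f_R0 a M)); [|exact HS].
  intros n. simpl. pose proof (Ha (Datatypes.S n)). lra.
Qed.

Lemma series_sum_plus (a b : nat -> R) (A B : R) : series_sum a A -> series_sum b B ->
  series_sum (fun n => a n + b n) (A + B).
Proof.
  intros HA HB. unfold series_sum.
  apply (Un_cv_ext (fun M => sum_f_R0 a M + sum_f_R0 b M)); [intros n; symmetry; apply plus_sum|].
  apply CV_plus; assumption.
Qed.

(** * Integrability of monotone functions *)

(** Cauchy's criterion: on fine subdivisions the Riemann sums of f differ from those of g by at most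
    those of h. *)
Lemma ex_RInt_sandwich (f : R -> R) (a b : R) : a <= b ->
  (forall eps, 0 < eps -> exists g h, ex_RInt g a b /\ ex_RInt h a b /\
     (forall x, a <= x <= b -> Rabs (f x - g x) <= h x) /\ Rint h a b < eps) ->
  ex_RInt f a b.
Proof.
  intros Hab H. destruct (Req_dec a b) as [->|Hne]; [apply ex_RInt_point|].
  assert (Hlt : a < b) by lra.
  apply (filterlim_locally_cauchy (U := R_CompleteSpace) (F := Riemann_fine a b)
     (fun ptd => scal (sign (b - a)) (Riemann_sum f ptd))).
  (* Three errors of eps/6: g against its integral, h against its integral, and the integral of h
     itself. They keep each sum of f within eps/2 of the integral of g. *)
  intros eps. assert (He : 0 < eps / 6) by (pose proof (cond_pos eps); lra).
  destruct (H (eps / 6) He) as [g [h [[Ig Hg] [Hh [Hfg Hsmall]]]]].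
  pose proof (RInt_correct (V := R_CompleteNormedModule) h a b Hh) as HIh.
  set (Ih := Rint h a b) in *.
  assert (Hsg : sign (b - a) = 1) by (apply sign_eq_1; lra).
  pose proof (proj1 (filterlim_locally _ _) Hg (mkposreal _ He)) as Fg.
  pose proof (proj1 (filterlim_locally _ _) HIh (mkposreal _ He)) as Fh.
  exists (fun ptd => Rabs (Riemann_sum f ptd - Ig) < eps / 2). split.
  - assert (Fsub : Riemann_fine a b (fun ptd => pointed_subdiv ptd /\ SF_h ptd = Rmin a b /\
        seq.last (SF_h ptd) (SF_lx ptd) = Rmax a b)).
    { exists (mkposreal 1 Rlt_0_1). intros ptd _ Hp. exact Hp. }
    apply (filter_imp (F := Riemann_fine a b) (fun ptd =>
      (ball Ig (eps / 6) (scal (sign (b - a)) (Riemann_sum g ptd)) /\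
       ball Ih (eps / 6) (scal (sign (b - a)) (Riemann_sum h ptd))) /\
      (pointed_subdiv ptd /\ SF_h ptd = Rmin a b /\
        seq.last (SF_h ptd) (SF_lx ptd) = Rmax a b))).
    2: { apply filter_and; [apply filter_and; [exact Fg | exact Fh] | exact Fsub]. }
    intros ptd [[B1 B2] [Hs [H1 H2]]].
    rewrite Rmin_left in H1 by lra. rewrite Rmax_right in H2 by lra. rewrite Hsg in B1, B2.
    change (Rabs (1 * Riemann_sum g ptd - Ig) < eps / 6) in B1.
    change (Rabs (1 * Riemann_sum h ptd - Ih) < eps / 6) in B2.
    rewrite Rmult_1_l in B1, B2.
    pose proof (Riemann_sum_norm (V := R_NormedModule) (fun x => minus (f x) (g x)) h ptd Hs) as Hn.
    assert (Hd : Rabs (Riemann_sum f ptd - Riemann_sum g ptd) <= Riemann_sum h ptd).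
    { pose proof (Riemann_sum_minus (V := NormedModule.ModuleSpace R_AbsRing R_NormedModule) f g ptd) as Em.
      assert (Hr : forall z : R, z = Riemann_sum f ptd - Riemann_sum g ptd ->
                Rabs z <= Riemann_sum h ptd -> Rabs (Riemann_sum f ptd - Riemann_sum g ptd) <= Riemann_sum h ptd)
        by (intros z -> Hz; exact Hz).
      apply (Hr _ Em).
      apply Hn. rewrite H2, H1. intros t Ht. apply Hfg, Ht. }
    apply Rabs_lt_between in B2.
    pose proof (Rabs_triang (Riemann_sum f ptd - Riemann_sum g ptd) (Riemann_sum g ptd - Ig)) as T.
    replace (Riemann_sum f ptd - Riemann_sum g ptd + (Riemann_sum g ptd - Ig))
      with (Riemann_sum f ptd - Ig) in T by ring. lra.
  - intros u v Hu Hv. rewrite Hsg.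
    change (Rabs (1 * Riemann_sum f v - 1 * Riemann_sum f u) < eps). rewrite !Rmult_1_l.
    pose proof (Rabs_triang (Riemann_sum f v - Ig) (- (Riemann_sum f u - Ig))) as T.
    rewrite Rabs_Ropp in T.
    replace (Riemann_sum f v - Ig + - (Riemann_sum f u - Ig))
      with (Riemann_sum f v - Riemann_sum f u) in T by ring. lra.
Qed.

(** By dyadic bisection, g takes the left-end value of f on each piece and h the increment of f over
    the piece. The increments telescope, so the integral of h is known exactly. *)
Lemma monotone_step_approx (f : R -> R) (n : nat) : forall a b, a <= b ->
  (forall x y, a <= x -> x <= y -> y <= b -> f x <= f y) ->
  exists g h, ex_RInt g a b /\ ex_RInt h a b /\
     (forall x, a <= x <= b -> Rabs (f x - g x) <= h x) /\
     Rint h a b = (f b - f a) * (b - a) * (/ 2) ^ n.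
Proof.
  induction n as [|n IH]; intros a b Hab Hf.
  - exists (fun _ => f a), (fun _ => f b - f a).
    split; [apply ex_RInt_const|]. split; [apply ex_RInt_const|]. split.
    + intros x Hx. pose proof (Hf a x ltac:(lra) ltac:(lra) ltac:(lra)).
      pose proof (Hf x b ltac:(lra) ltac:(lra) ltac:(lra)). rewrite Rabs_right; lra.
    + rewrite RInt_const. unfold scal; simpl; unfold mult; simpl. ring.
  - set (c := (a + b) / 2). assert (Hc : a <= c <= b) by (unfold c; lra).
    destruct (IH a c) as [g1 [h1 [Eg1 [Eh1 [B1 I1]]]]]; [lra | intros; apply Hf; lra|].
    destruct (IH c b) as [g2 [h2 [Eg2 [Eh2 [B2 I2]]]]]; [lra | intros; apply Hf; lra|].
    (* At the common point c the left function wins; a single point does not affect the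
       integrals. *)
    assert (Glue : forall u v : R -> R, ex_RInt u a c -> ex_RInt v c b ->
       ex_RInt (fun x => if Rle_dec x c then u x else v x) a b /\
       Rint (fun x => if Rle_dec x c then u x else v x) a b = Rint u a c + Rint v c b).
    { intros u v Hu Hv. set (w := fun x => if Rle_dec x c then u x else v x).
      assert (Eu : forall x, Rmin a c < x < Rmax a c -> u x = w x).
      { rewrite Rmin_left, Rmax_right by lra. intros x Hx. unfold w. destruct Rle_dec; [reflexivity | lra]. }
      assert (Ev : forall x, Rmin c b < x < Rmax c b -> v x = w x).
      { rewrite Rmin_left, Rmax_right by lra. intros x Hx. unfold w. destruct Rle_dec; [lra | reflexivity]. }
      pose proof (ex_RInt_ext u w a c Eu Hu) as W1. pose proof (ex_RInt_ext v w c b Ev Hv) as W2.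
      split; [apply (ex_RInt_Chasles w a c b); assumption|].
      rewrite (RInt_ext u w a c Eu), (RInt_ext v w c b Ev).
      symmetry. apply (RInt_Chasles w a c b W1 W2). }
    destruct (Glue g1 g2 Eg1 Eg2) as [Eg _]. destruct (Glue h1 h2 Eh1 Eh2) as [Eh Ih].
    eexists. eexists. split; [exact Eg|]. split; [exact Eh|]. split.
    + intros x Hx. cbv beta. destruct Rle_dec; [apply B1 | apply B2]; lra.
    + eapply eq_trans; [exact Ih|]. rewrite I1, I2. replace (c - a) with ((b - a) / 2) by (unfold c; field).
      replace (b - c) with ((b - a) / 2) by (unfold c; field). simpl. field.
Qed.

Lemma ex_RInt_monotone (f : R -> R) (a b : R) : a <= b ->
  (forall x y, a <= x -> x <= y -> y <= b -> f x <= f y) -> ex_RInt f a b.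
Proof.
  intros Hab Hf. apply ex_RInt_sandwich; [exact Hab|]. intros eps He.
  set (K := (f b - f a) * (b - a)).
  assert (HK : 0 <= K).
  { apply Rmult_le_pos; [|lra]. pose proof (Hf a b ltac:(lra) Hab ltac:(lra)). lra. }
  destruct (pow_lt_1_zero (/ 2) ltac:(rewrite Rabs_right; lra) (eps / (K + 1))
     ltac:(apply Rdiv_lt_0_compat; lra)) as [n Hn].
  destruct (monotone_step_approx f n a b Hab Hf) as [g [h [Eg [Eh [B E]]]]].
  exists g, h. split; [exact Eg|]. split; [exact Eh|]. split; [exact B|].
  rewrite E. fold K. pose proof (Hn n (le_n n)) as Hp.
  assert (Hpos : 0 < (/ 2) ^ n) by (apply pow_lt; lra).
  rewrite Rabs_right in Hp by lra.
  apply Rle_lt_trans with ((K + 1) * (/ 2) ^ n); [nra|].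
  apply (Rmult_lt_compat_l (K + 1)) in Hp; [|lra].
  replace ((K + 1) * (eps / (K + 1))) with eps in Hp by (field; lra). exact Hp.
Qed.

(** * From exponential growth to the integral inequality *)

Lemma exp_minus_1_le (y : R) : exp y - 1 <= y * exp y.
Proof.
  assert (H : 1 - y <= exp (- y)) by (pose proof (exp_ineq1_le (- y)); lra).
  apply (Rmult_le_compat_r (exp y)) in H; [|left; apply exp_pos].
  rewrite <- exp_plus, Rplus_opp_l, exp_0 in H. lra.
Qed.

(* [N] grows at most linearly, so [K t - N t] is monotone and [N] is integrable even
   though it need not be continuous. *)
Lemma exponential_growth_integral (N : R -> R) (c t1 t2 : R) : 0 <= c -> t1 <= t2 ->
  (forall t, t1 <= t <= t2 -> 0 <= N t) ->
  (forall u t, t1 <= u -> u <= t -> t <= t2 -> N t <= exp (c * (t - u)) * N u) ->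
  exists pr : Riemann_integrable N t1 t2, N t2 - N t1 <= c * RiemannInt pr.
Proof.
  intros Hc Ht HN HG.
  set (E := exp (c * (t2 - t1))). set (B := E * N t1). set (K := c * E * B).
  assert (HE : 0 < E) by apply exp_pos.
  assert (HEm : forall h, 0 <= h <= t2 - t1 -> exp (c * h) <= E).
  { intros h Hh. destruct (Req_dec (c * h) (c * (t2 - t1))) as [e|e].
    - unfold E. rewrite e. lra.
    - left. apply exp_increasing. assert (c * h <= c * (t2 - t1)) by (apply Rmult_le_compat_l; lra). lra. }
  assert (HB : forall t, t1 <= t <= t2 -> N t <= B).
  { intros t Htt. eapply Rle_trans; [apply (HG t1 t); lra|].
    apply Rmult_le_compat_r; [apply HN; lra | apply HEm; lra]. }
  assert (HL : forall u t, t1 <= u -> u <= t -> t <= t2 -> N t - N u <= K * (t - u)).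
  { intros u t H1 H2 H3. pose proof (HG u t H1 H2 H3) as Hg.
    pose proof (HN u ltac:(lra)) as Hu0. pose proof (HB u ltac:(lra)) as HuB.
    pose proof (exp_minus_1_le (c * (t - u))) as Hx. pose proof (HEm (t - u) ltac:(lra)) as He.
    assert (Hct : 0 <= c * (t - u)) by (apply Rmult_le_pos; lra).
    assert (X1 : (exp (c * (t - u)) - 1) <= c * (t - u) * E).
    { eapply Rle_trans; [exact Hx|]. apply Rmult_le_compat_l; assumption. }
    assert (X2 : 0 <= c * (t - u) * E) by (apply Rmult_le_pos; lra).
    assert (X3 : (exp (c * (t - u)) - 1) * N u <= c * (t - u) * E * N u)
      by (apply Rmult_le_compat_r; assumption).
    assert (X4 : c * (t - u) * E * N u <= c * (t - u) * E * B)
      by (apply Rmult_le_compat_l; assumption).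
    unfold K. lra. }
  assert (Ex : ex_RInt N t1 t2).
  { apply (ex_RInt_ext (fun t => minus (K * t) (K * t - N t))).
    - intros t _. unfold minus, plus, opp; simpl. ring.
    - apply (ex_RInt_minus (V := R_NormedModule)).
      + apply ex_RInt_cont. intros t. apply (ex_derive_continuous (fun t => K * t)).
        auto_derive. exact I.
      + apply ex_RInt_monotone; [exact Ht|]. intros x y H1 H2 H3.
        pose proof (HL x y H1 H2 H3). lra. }
  set (pr := ex_RInt_Reals_0 N t1 t2 Ex). exists pr. rewrite <- (RInt_Reals N t1 t2 pr).
  (* Reading the growth bound backwards from t2 gives F <= N, with equality at t2. Since F' = f = c
     F, integrating f <= c N yields N t2 - F t1 <= c times the integral of N, and F t1 <= N t1. *)
  set (F := fun t => N t2 * exp (- (c * (t2 - t)))).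
  set (f := fun t => N t2 * (c * exp (- (c * (t2 - t))))).
  assert (If : is_RInt f t1 t2 (minus (F t2) (F t1))).
  { apply (is_RInt_derive F f).
    - intros t _. unfold F, f. auto_derive; [exact I | unfold Rminus; ring].
    - intros t _. apply (ex_derive_continuous f). unfold f. auto_derive. exact I. }
  assert (Hle : Rint f t1 t2 <= c * Rint N t1 t2).
  { change (c * Rint N t1 t2) with (scal c (Rint N t1 t2)).
    rewrite <- (RInt_scal (V := R_CompleteNormedModule) N t1 t2 c Ex).
    apply RInt_le; [exact Ht | eexists; exact If | apply (ex_RInt_scal (V := R_NormedModule)), Ex |].
    intros t Htt. unfold f, scal; simpl; unfold mult; simpl.
    assert (N t2 * exp (- (c * (t2 - t))) <= N t).
    { pose proof (HG t t2 ltac:(lra) ltac:(lra) ltac:(lra)) as Hg.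
      apply (Rmult_le_compat_l (exp (- (c * (t2 - t))))) in Hg; [|left; apply exp_pos].
      rewrite <- Rmult_assoc, <- exp_plus, Rplus_opp_l, exp_0 in Hg. lra. }
    nra. }
  rewrite (is_RInt_unique f t1 t2 _ If) in Hle. unfold minus, plus, opp in Hle; simpl in Hle.
  unfold F in Hle. rewrite Rminus_diag, Rmult_0_r, Ropp_0, exp_0 in Hle.
  pose proof (HG t1 t2 ltac:(lra) Ht ltac:(lra)) as Hg.
  apply (Rmult_le_compat_l (exp (- (c * (t2 - t1))))) in Hg; [|left; apply exp_pos].
  rewrite <- Rmult_assoc, <- exp_plus, Rplus_opp_l, exp_0 in Hg. lra.
Qed.

(** Since kap >= 1, a single nonnegative term of the energy controls one derivative. This feeds
    [smooth_extension]. *)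
Lemma RInt_sqr_le_energy (s : R) (k k' : R -> R) (j : nat) (u v : nat -> R -> R) (delta : R) :
  0 < s -> is_kernel k k' -> 0 < delta < 1 ->
  (forall i x, continuous (fun y => u i (clamp delta y)) x) ->
  (forall i x, continuous (fun y => v i (clamp delta y)) x) ->
  gweight s j * Rint (fun x => u (S j) x ^ 2) delta 1 <= Rint (energy_density s k j u v) delta 1.
Proof.
  intros Hs Hker Hd Cu Cv.
  rewrite (RInt_ext (fun x => u (S j) x ^ 2) (fun x => u (S j) (clamp delta x) ^ 2)).
  2: { rewrite Rmin_left, Rmax_right by lra. intros x Hx. rewrite clamp_id by lra. reflexivity. }
  rewrite (RInt_ext (energy_density s k j u v)
    (energy_density s k j (fun i y => u i (clamp delta y)) (fun i y => v i (clamp delta y)))).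
  2: { rewrite Rmin_left, Rmax_right by lra. intros x Hx.
       apply energy_density_ext; intros i; rewrite clamp_id by lra; reflexivity. }
  apply RInt_mult_le; [lra | | |].
  - intros x. apply (continuous_comp (fun y => u (S j) (clamp delta y)) (fun w => w ^ 2)); [apply Cu|].
    apply (ex_derive_continuous (fun w : R => w ^ 2)). auto_derive; exact I.
  - intros x. apply (continuous_energy_density s k k'); auto.
  - intros x Hx. unfold energy_density. rewrite clamp_id by lra.
    assert (Hn : forall n, 1 <= kap s (k x) x n)
      by (intros n; destruct Hker as [_ [_ [Hk0 _]]]; apply kap_ge_1; [exact Hs | apply Hk0; lra | lra]).
    pose proof (fun n => gweight_pos s n Hs) as Hg.
    assert (Hsq : forall n, 0 <= u (S n) x ^ 2 + v (S n) x ^ 2)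
      by (intros n; pose proof (pow2_ge_0 (u (S n) x)); pose proof (pow2_ge_0 (v (S n) x)); lra).
    assert (Hterm : forall n, 0 <= gweight s n * kap s (k x) x n * (u (S n) x ^ 2 + v (S n) x ^ 2)).
    { intros n. pose proof (Hn n). pose proof (Hg n). pose proof (Hsq n).
      apply Rmult_le_pos; [apply Rmult_le_pos; lra | lra]. }
    apply Rle_trans with (gweight s j * kap s (k x) x j * (u (S j) x ^ 2 + v (S j) x ^ 2)).
    + pose proof (Hn j). pose proof (Hg j). pose proof (pow2_ge_0 (u (S j) x)).
      pose proof (pow2_ge_0 (v (S j) x)). rewrite Rmult_assoc. apply Rmult_le_compat_l; [lra|]. nra.
    + destruct j as [|j']; [apply Rle_refl|]. rewrite tech5.
      assert (0 <= sum_f_R0 (fun n => gweight s n * kap s (k x) x n * (u (S n) x ^ 2 + v (S n) x ^ 2)) j')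
        by (apply sum_f_R0_nonneg; intros; apply Hterm).
      cbv beta. lra.
Qed.

Lemma energy_density_sym (s : R) (k : R -> R) (M : nat) (u v : nat -> R -> R) (x : R) :
  energy_density s k M u v x = energy_density s k M v u x.
Proof. unfold energy_density. apply sum_eq. intros n _. ring. Qed.

(** * Solutions of the equation *)

Section Solution.

Context (W : R -> Cx) (sigs s C0 : R) (HC0 : 0 < C0) (Hsigs : 0 < sigs) (Hs : 0 < s)
  (Hss : s < sigs) (G : nat -> R -> Cx)
  (HG0 : forall x, closed01 x -> G 0%nat x = W x)
  (HGd : forall n x, closed01 x -> Cderiv_within (G n) (G (S n)) closed01 x)
  (HGb : forall n x, open01 x -> Cmod (G n x) <= C0 * / (sigs ^ n) * (INR (fact n)) ^ 2)
  (psi : R -> R -> Cx) (P : nat -> nat -> R -> R -> Cx)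
  (HP : smooth_family_Omega psi P)
  (Hpde : forall t x, Omega t x ->
       fst (P 0%nat 1%nat t x) * (2 * x) + x ^ 2 * fst (P 0%nat 2%nat t x)
         + fst (P 1%nat 1%nat t x) - fst (Cmul (W x) (psi t x)) = 0 /\
       snd (P 0%nat 1%nat t x) * (2 * x) + x ^ 2 * snd (P 0%nat 2%nat t x)
         + snd (P 1%nat 1%nat t x) - snd (Cmul (W x) (psi t x)) = 0)
  (Hdir : forall t, 0 <= t -> psi t 1 = (0, 0)).

Lemma Omega_cont_fst (i j : nat) : Omega_cont (fun t x => fst (P i j t x)).
Proof.
  intros t x Hx eps He. destruct HP as [_ H]. destruct (H i j t x Hx) as [_ [_ Hc]].
  destruct (Hc eps He) as [d [Hd Hl]]. exists d. split; [exact Hd|]. intros t' x' H1 H2 H3.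
  eapply Rle_lt_trans; [|apply (Hl t' x' H1 H2 H3)].
  apply (Rabs_fst_le_Cmod (Csub (P i j t' x') (P i j t x))).
Qed.

Lemma Omega_cont_snd (i j : nat) : Omega_cont (fun t x => snd (P i j t x)).
Proof.
  intros t x Hx eps He. destruct HP as [_ H]. destruct (H i j t x Hx) as [_ [_ Hc]].
  destruct (Hc eps He) as [d [Hd Hl]]. exists d. split; [exact Hd|]. intros t' x' H1 H2 H3.
  eapply Rle_lt_trans; [|apply (Hl t' x' H1 H2 H3)].
  apply (Rabs_snd_le_Cmod (Csub (P i j t' x') (P i j t x))).
Qed.

Lemma is_derive_P (i j : nat) (t x : R) : 0 <= t -> 0 < x < 1 ->
  is_derive (fun y => fst (P i j t y)) x (fst (P i (S j) t x)) /\
  is_derive (fun y => snd (P i j t y)) x (snd (P i (S j) t x)).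
Proof.
  intros Ht Hx. destruct HP as [_ H].
  destruct (H i j t x ltac:(split; lra)) as [_ [[H1 H2] _]].
  split.
  - apply (Rderiv_within_is_derive (fun y => fst (P i j t y)) (fun y => fst (P i (S j) t y))
             (fun y => Omega t y)); [exact H1|].
    apply (locally_interval 0 1); [exact Hx|]. intros y Hy. split; lra.
  - apply (Rderiv_within_is_derive (fun y => snd (P i j t y)) (fun y => snd (P i (S j) t y))
             (fun y => Omega t y)); [exact H2|].
    apply (locally_interval 0 1); [exact Hx|]. intros y Hy. split; lra.
Qed.

Lemma is_derive_G (j : nat) (x : R) : 0 < x < 1 ->
  is_derive (fun y => fst (G j y)) x (fst (G (S j) x)) /\
  is_derive (fun y => snd (G j y)) x (snd (G (S j) x)).
Proof.
  intros Hx. destruct (HGd j x ltac:(split; lra)) as [H1 H2].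
  split.
  - apply (Rderiv_within_is_derive (fun y => fst (G j y)) (fun y => fst (G (S j) y)) closed01);
      [exact H1|].
    apply (locally_interval 0 1); [exact Hx|]. intros y Hy. split; lra.
  - apply (Rderiv_within_is_derive (fun y => snd (G j y)) (fun y => snd (G (S j) y)) closed01);
      [exact H2|].
    apply (locally_interval 0 1); [exact Hx|]. intros y Hy. split; lra.
Qed.

Lemma pde_re (n : nat) (t x : R) : 0 <= t -> 0 < x < 1 ->
  fst (P 1 (S n) t x) = - (x ^ 2 * fst (P 0 (S (S n)) t x)
     + 2 * (INR n + 1) * x * fst (P 0 (S n) t x) + INR n * (INR n + 1) * fst (P 0%nat n t x))
   + (leibniz n (fun i => fst (G i x)) (fun j => fst (P 0%nat j t x))
      - leibniz n (fun i => snd (G i x)) (fun j => snd (P 0%nat j t x))).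
Proof.
  intros Ht Hx.
  rewrite (pde_iterated (-1) (fun j y => fst (P 0%nat j t y)) (fun j y => snd (P 0%nat j t y))
    (fun j y => fst (P 1%nat j t y)) (fun j y => fst (G j y)) (fun j y => snd (G j y)));
    try (intros j y Hy; first [apply is_derive_P; assumption | apply is_derive_G; assumption]);
    try exact Hx; [ring|].
  intros y Hy. destruct (Hpde t y ltac:(split; lra)) as [E _].
  rewrite <- (HG0 y) in E by (split; lra). destruct HP as [HP0 _].
  rewrite <- (HP0 t y) in E by (split; lra). unfold Cmul in E. simpl in E |- *. lra.
Qed.

Lemma pde_im (n : nat) (t x : R) : 0 <= t -> 0 < x < 1 ->
  snd (P 1 (S n) t x) = - (x ^ 2 * snd (P 0 (S (S n)) t x)
     + 2 * (INR n + 1) * x * snd (P 0 (S n) t x) + INR n * (INR n + 1) * snd (P 0%nat n t x))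
   + (leibniz n (fun i => fst (G i x)) (fun j => snd (P 0%nat j t x))
      + leibniz n (fun i => snd (G i x)) (fun j => fst (P 0%nat j t x))).
Proof.
  intros Ht Hx.
  rewrite (pde_iterated 1 (fun j y => snd (P 0%nat j t y)) (fun j y => fst (P 0%nat j t y))
    (fun j y => snd (P 1%nat j t y)) (fun j y => fst (G j y)) (fun j y => snd (G j y)));
    try (intros j y Hy; first [apply is_derive_P; assumption | apply is_derive_G; assumption]);
    try exact Hx; [ring|].
  intros y Hy. destruct (Hpde t y ltac:(split; lra)) as [_ E].
  rewrite <- (HG0 y) in E by (split; lra). destruct HP as [HP0 _].
  rewrite <- (HP0 t y) in E by (split; lra). unfold Cmul in E. simpl in E |- *. lra.
Qed.

Let p (j : nat) (t x : R) : R := fst (P 0%nat j t x).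
Let q (j : nat) (t x : R) : R := snd (P 0%nat j t x).

Lemma P_at_1 (t : R) : 0 <= t -> P 0%nat 0%nat t 1 = (0, 0).
Proof.
  intros Ht. destruct HP as [HP0 _]. rewrite HP0 by (split; lra). apply Hdir, Ht.
Qed.

Lemma leibniz_ext (n : nat) (g p1 p2 : nat -> R) : (forall j, p1 j = p2 j) ->
  leibniz n g p1 = leibniz n g p2.
Proof. intros H. unfold leibniz. apply sum_eq. intros i _. rewrite H. reflexivity. Qed.

(** [energy_growth] asks for functions on the whole plane. [C1_ext] provides them, and integrals
    over [a, 1] at times t >= 0 do not see the extension. *)
Lemma solution_energy_cutoff (a : R) (M : nat) (k k' : R -> R) (t1 t2 : R) :
  0 < a < 1 -> is_kernel k k' -> 0 <= t1 -> t1 <= t2 ->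
  Rint (fun x => cutoff a t2 x * energy_density s k M (fun j => p j t2) (fun j => q j t2) x) a 1
    <= exp (growth_const C0 sigs s * (t2 - t1)) *
       Rint (fun x => cutoff a t1 x * energy_density s k M (fun j => p j t1) (fun j => q j t1) x) a 1.
Proof.
  intros Ha Hker Ht1 Ht2. pose proof Hker as [Hk [Hk'c [Hk0 [Hk'0 Hk1]]]].
  set (ep := fun j => C1_ext a (p j) (fun t x => fst (P 1%nat j t x))).
  set (eq := fun j => C1_ext a (q j) (fun t x => snd (P 1%nat j t x))).
  assert (Eext : forall t, 0 <= t ->
    Rint (fun x => cutoff a t x * energy_density s k M (fun j => p j t) (fun j => q j t) x) a 1
    = Rint (fun x => cutoff a t x * energy_density s k M (fun j => ep j t) (fun j => eq j t) x) a 1).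
  { intros t Ht. apply RInt_ext. rewrite Rmin_left, Rmax_right by lra. intros x Hx.
    f_equal. apply energy_density_ext; intros j; symmetry; apply C1_ext_eq; lra. }
  rewrite !Eext by lra.
  apply (energy_growth C0 sigs s a HC0 Hsigs Hs Hss Ha M k k' Hk Hk'c Hk0 Hk'0 Hk1 ep eq
    (fun j t x => fst (P 1%nat j (Rmax 0 t) (clamp a x)))
    (fun j t x => snd (P 1%nat j (Rmax 0 t) (clamp a x))))
    with (gr := fun i x => fst (G i x)) (gi := fun i x => snd (G i x));
    try assumption.
  - intros j. apply cont2_C1_ext; [exact Ha | apply Omega_cont_fst | apply Omega_cont_fst].
  - intros j. apply cont2_C1_ext; [exact Ha | apply Omega_cont_snd | apply Omega_cont_snd].
  - intros j. apply (cont2_retract a (fun t x => fst (P 1%nat j t x)) Ha), Omega_cont_fst.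
  - intros j. apply (cont2_retract a (fun t x => snd (P 1%nat j t x)) Ha), Omega_cont_snd.
  - intros j t x. apply (is_derive_C1_ext a (p j) (fun t x => fst (P 1%nat j t x)) t x Ha).
    intros u y Hu. destruct HP as [_ H]. apply (H 0%nat j u y Hu).
  - intros j t x. apply (is_derive_C1_ext a (q j) (fun t x => snd (P 1%nat j t x)) t x Ha).
    intros u y Hu. destruct HP as [_ H]. apply (H 0%nat j u y Hu).
  - intros j t x Ht Hx. unfold ep at 2. rewrite C1_ext_eq by lra.
    apply is_derive_C1_ext_x; [exact Ht | exact Hx |]. apply is_derive_P; lra.
  - intros j t x Ht Hx. unfold eq at 2. rewrite C1_ext_eq by lra.
    apply is_derive_C1_ext_x; [exact Ht | exact Hx |]. apply is_derive_P; lra.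
  - intros i x Hx. eapply Rle_trans; [apply Rabs_fst_le_Cmod | apply HGb; split; lra].
  - intros i x Hx. eapply Rle_trans; [apply Rabs_snd_le_Cmod | apply HGb; split; lra].
  - intros n t x Ht Hx. rewrite Rmax_right, clamp_id by lra.
    rewrite pde_re by lra. unfold ep. rewrite !C1_ext_eq by lra. unfold p.
    f_equal. f_equal; apply leibniz_ext; intros j; unfold ep, eq;
      rewrite C1_ext_eq by lra; reflexivity.
  - intros n t x Ht Hx. rewrite Rmax_right, clamp_id by lra.
    rewrite pde_im by lra. unfold eq. rewrite !C1_ext_eq by lra. unfold q.
    f_equal. f_equal; apply leibniz_ext; intros j; unfold ep, eq;
      rewrite C1_ext_eq by lra; reflexivity.
  - intros t Ht. unfold ep. rewrite C1_ext_eq by lra. unfold p. rewrite P_at_1 by lra. reflexivity.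
  - intros t Ht. unfold eq. rewrite C1_ext_eq by lra. unfold q. rewrite P_at_1 by lra. reflexivity.
Qed.

(** Continuous versions, up to x = 0, of the real and imaginary parts of all x-derivatives of
    psi(t); equality is asked on the open interval because P carries no information at x = 0. *)
Definition trace (t : R) (d e : nat -> R -> R) : Prop :=
  (forall j x, 0 < x < 1 -> p j t x = d j x) /\ (forall j x, 0 < x < 1 -> q j t x = e j x) /\
  (forall j x, continuous (d j) x) /\ (forall j x, continuous (e j) x).

Lemma continuous_clamp_p (a t : R) (j : nat) (x : R) : 0 < a < 1 -> 0 <= t ->
  continuous (fun y => p j t (clamp a y)) x /\ continuous (fun y => q j t (clamp a y)) x.
Proof.
  intros Ha Ht.
  pose proof (cont2_slice _ (cont2_retract a _ Ha (Omega_cont_fst 0 j)) t x) as H1.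
  pose proof (cont2_slice _ (cont2_retract a _ Ha (Omega_cont_snd 0 j)) t x) as H2.
  cbv beta in H1, H2. rewrite Rmax_right in H1, H2 by exact Ht. split; assumption.
Qed.

(** Only regularity at t1 is assumed, so the left side has to stay at distance delta from 0; this
    one-sided form is what allows regularity to be derived at t2. *)
Lemma solution_energy_truncated (M : nat) (k k' : R -> R) (t1 t2 : R) (d e : nat -> R -> R)
  (delta : R) : is_kernel k k' -> 0 <= t1 -> t1 <= t2 -> trace t1 d e -> 0 < delta < 1 ->
  Rint (energy_density s k M (fun j => p j t2) (fun j => q j t2)) delta 1
    <= exp (growth_const C0 sigs s * (t2 - t1)) * Rint (energy_density s k M d e) 0 1.
Proof.
  intros Hker Ht1 Ht2 [Hd [He [Cd Ce]]] Hdelta.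
  apply (truncated_energy s k k' M t1 t2 _ (fun j => p j t1) (fun j => q j t1));
    try assumption; try lra.
  - left; apply exp_pos.
  - intros a j x Ha. apply continuous_clamp_p; [exact Ha | lra].
  - intros a j x Ha. apply continuous_clamp_p; [exact Ha | lra].
  - intros a Ha. apply (solution_energy_cutoff a M k k'); assumption.
Qed.

(** With traces at both times, delta -> 0 and then m -> oo are taken at fixed M; the rate depends on
    neither. *)
Lemma trace_norm_growth (t1 t2 : R) (d1 e1 d2 e2 : nat -> R -> R) (v1 v2 : nat -> R -> Cx) (M : nat) :
  0 <= t1 -> t1 <= t2 -> trace t1 d1 e1 -> trace t2 d2 e2 ->
  (forall n x, 0 <= x <= 1 -> v1 n x = (d1 (S n) x, e1 (S n) x)) ->
  (forall n x, 0 <= x <= 1 -> v2 n x = (d2 (S n) x, e2 (S n) x)) ->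
  sum_f_R0 (norm_term s v2) M
    <= exp (growth_const C0 sigs s * (t2 - t1)) * sum_f_R0 (norm_term s v1) M.
Proof.
  intros Ht1 Ht2 T1 T2 Hv1 Hv2. pose proof T1 as [_ [_ [Cd1 Ce1]]].
  pose proof T2 as [Hd2 [He2 [Cd2 Ce2]]].
  set (X := exp (growth_const C0 sigs s * (t2 - t1))).
  apply (@Rle_cv_lim (fun m => Rint (energy_density s (dirac_approx m) M d2 e2) 0 1)
    (fun m => X * Rint (energy_density s (dirac_approx m) M d1 e1) 0 1)).
  - intros m. apply RInt_le_of_truncations.
    + intros x. apply (continuous_energy_density s _ _ M d2 e2 x Hs (dirac_approx_kernel m)); auto.
    + intros delta Hdelta.
      rewrite (RInt_ext (energy_density s (dirac_approx m) M d2 e2)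
        (energy_density s (dirac_approx m) M (fun j => p j t2) (fun j => q j t2))).
      * apply (solution_energy_truncated M _ _ t1 t2 d1 e1 delta (dirac_approx_kernel m)); assumption.
      * rewrite Rmin_left, Rmax_right by lra. intros x Hx. symmetry.
        apply energy_density_ext; intros j; [apply Hd2 | apply He2]; lra.
  - apply energy_limit; assumption.
  - apply CV_mult; [apply Un_cv_const | apply energy_limit; assumption].
Qed.

(** Propagation of smoothness up to x = 0: the truncated energy at time t is bounded, uniformly in
    delta, by the finite energy of the data. *)
Lemma trace_exists (t : R) (d0 e0 : nat -> R -> R) : 0 <= t -> trace 0 d0 e0 ->
  exists d e, trace t d e /\
    (forall j x, 0 < x <= 1 -> p j t x = d j x) /\ (forall j x, 0 < x <= 1 -> q j t x = e j x) /\
    (forall j x, 0 < x < 1 -> is_derive (d j) x (d (S j) x)) /\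
    (forall j x, 0 < x < 1 -> is_derive (e j) x (e (S j) x)).
Proof.
  intros Ht T0.
  (* The energy with M = j and m = 0 suffices, since it already contains the derivative of order j +
     1 with the positive weight [gweight s j]; the kernel is then the constant 1. *)
  assert (HK : forall j, exists K, forall delta, 0 < delta < 1 ->
     Rint (fun x => p (S j) t x ^ 2) delta 1 <= K /\ Rint (fun x => q (S j) t x ^ 2) delta 1 <= K).
  { intros j. set (B := exp (growth_const C0 sigs s * (t - 0)) *
                        Rint (energy_density s (dirac_approx 0) j d0 e0) 0 1).
    exists (B / gweight s j). intros delta Hd.
    pose proof (solution_energy_truncated j _ _ 0 t d0 e0 delta (dirac_approx_kernel 0)
      (Rle_refl 0) Ht T0 Hd) as HE. fold B in HE.
    pose proof (gweight_pos s j Hs) as Hg.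
    pose proof (RInt_sqr_le_energy s _ _ j (fun i => p i t) (fun i => q i t) delta Hs
      (dirac_approx_kernel 0) Hd (fun i x => proj1 (continuous_clamp_p delta t i x Hd Ht))
      (fun i x => proj2 (continuous_clamp_p delta t i x Hd Ht))) as H1.
    pose proof (RInt_sqr_le_energy s _ _ j (fun i => q i t) (fun i => p i t) delta Hs
      (dirac_approx_kernel 0) Hd (fun i x => proj2 (continuous_clamp_p delta t i x Hd Ht))
      (fun i x => proj1 (continuous_clamp_p delta t i x Hd Ht))) as H2.
    rewrite (RInt_ext (energy_density s (dirac_approx 0) j (fun i => q i t) (fun i => p i t))
      (energy_density s (dirac_approx 0) j (fun i => p i t) (fun i => q i t))) in H2
      by (intros; apply energy_density_sym).
    split; apply (Rmult_le_reg_l (gweight s j)); try exact Hg;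
      replace (gweight s j * (B / gweight s j)) with B by (field; lra); lra. }
  destruct (smooth_extension (fun j => p j t)) as [d [Ed [Cd Dd]]].
  - intros a j x Ha. apply continuous_clamp_p; assumption.
  - intros j x Hx. apply is_derive_P; assumption.
  - intros j. destruct (HK j) as [K H]. exists K. intros delta Hd. apply H, Hd.
  - destruct (smooth_extension (fun j => q j t)) as [e [Ee [Ce De]]].
    + intros a j x Ha. apply continuous_clamp_p; assumption.
    + intros j x Hx. apply is_derive_P; assumption.
    + intros j. destruct (HK j) as [K H]. exists K. intros delta Hd. apply H, Hd.
    + exists d, e. split; [|split; [|split; [|split]]]; try assumption.
      * split; [|split; [|split]]; try assumption; intros j x Hx; symmetry;
          [apply Ed | apply Ee]; lra.
      * intros j x Hx. symmetry. apply Ed, Hx.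
      * intros j x Hx. symmetry. apply Ee, Hx.
Qed.

Lemma trace_of_smooth_cl (D : nat -> R -> Cx) (t : R) : 0 <= t -> smooth_cl (psi t) D ->
  trace t (fun j x => fst (D j (clamp 0 x))) (fun j x => snd (D j (clamp 0 x))).
Proof.
  intros Ht [HD0 HDd].
  assert (Dd : forall j x, 0 < x < 1 ->
     is_derive (fun y => fst (D j (clamp 0 y))) x (fst (D (S j) (clamp 0 x))) /\
     is_derive (fun y => snd (D j (clamp 0 y))) x (snd (D (S j) (clamp 0 x)))).
  { intros j x Hx. rewrite clamp_id by lra. destruct (HDd j x ltac:(split; lra)) as [H1 H2].
    assert (Hl : locally x closed01) by (apply (locally_interval 0 1); [exact Hx | intros y Hy; split; lra]).
    assert (Hcl : locally x (fun y => y = clamp 0 y)).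
    { apply (locally_interval 0 1); [exact Hx|]. intros y Hy. rewrite clamp_id by lra. reflexivity. }
    split.
    - apply (is_derive_ext_loc (fun y => fst (D j y))).
      + revert Hcl. apply filter_imp. intros y Hy. f_equal. f_equal. exact Hy.
      + apply (Rderiv_within_is_derive _ (fun y => fst (D (S j) y)) _ _ H1 Hl).
    - apply (is_derive_ext_loc (fun y => snd (D j y))).
      + revert Hcl. apply filter_imp. intros y Hy. f_equal. f_equal. exact Hy.
      + apply (Rderiv_within_is_derive _ (fun y => snd (D (S j) y)) _ _ H2 Hl). }
  assert (H00 : forall x, 0 < x < 1 -> P 0%nat 0%nat t x = D 0%nat (clamp 0 x)).
  { intros x Hx. rewrite clamp_id, HD0 by lra. destruct HP as [HP0 _]. apply HP0. split; lra. }
  split; [|split; [|split]].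
  - apply (derivative_families_agree (fun j => p j t)).
    + intros x Hx. unfold p. rewrite H00 by exact Hx. reflexivity.
    + intros j x Hx. apply is_derive_P; assumption.
    + intros j x Hx. apply Dd, Hx.
  - apply (derivative_families_agree (fun j => q j t)).
    + intros x Hx. unfold q. rewrite H00 by exact Hx. reflexivity.
    + intros j x Hx. apply is_derive_P; assumption.
    + intros j x Hx. apply Dd, Hx.
  - intros j. apply (continuous_clamp_of_Rderiv_within (fun y => fst (D j y)) (fun y => fst (D (S j) y))).
    intros x Hx. apply (HDd j x Hx).
  - intros j. apply (continuous_clamp_of_Rderiv_within (fun y => snd (D j y)) (fun y => snd (D (S j) y))).
    intros x Hx. apply (HDd j x Hx).
Qed.

Lemma norm_terms_bounded (D : nat -> R -> Cx) (S0 S1 S2 Sb : R) (d e : nat -> R -> R) (M : nat) :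
  (forall j x, continuous (d j) x) -> (forall j x, continuous (e j) x) ->
  (forall n x, 0 <= x <= 1 -> D (S n) x = (d (S n) x, e (S n) x)) ->
  series_sum (seminorm_term s 0 0 (fun n => D (S n))) S0 ->
  series_sum (seminorm_term s 1 0 (fun n => D (S n))) S1 ->
  series_sum (seminorm_term s 2 0 (fun n => D (S n))) S2 ->
  series_sum (boundary_term s (fun n => D (S n))) Sb ->
  series_sum (norm_term s (fun n => D (S n))) (S0 + S1 + S2 + Sb) /\
  sum_f_R0 (norm_term s (fun n => D (S n))) M <= S0 + S1 + S2 + Sb.
Proof.
  intros Cd Ce Hv H0 H1 H2 Hb.
  assert (HS : series_sum (norm_term s (fun n => D (S n))) (S0 + S1 + S2 + Sb)).
  { unfold norm_term. repeat apply series_sum_plus; assumption. }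
  split; [exact HS|]. apply series_sum_partial_le; [|exact HS]. intros n. unfold norm_term.
  pose proof (fun i => seminorm_term_nonneg s Hs (fun n => D (S n)) d e Cd Ce Hv i n) as Hn.
  pose proof (boundary_term_nonneg s Hs (fun n => D (S n)) d e Hv n).
  pose proof (Hn 0%nat). pose proof (Hn 1%nat). pose proof (Hn 2%nat). lra.
Qed.

(** Growth from time 0 bounds the partial sums of [norm_term] uniformly in M, hence each of the four
    nonnegative series. [Xnorm_is] hides its derivative family, so d and e are returned together
    with N: comparing two times needs a series that sums to exactly this N^2. *)
Lemma Xnorm_exists (t N0 : R) : 0 <= t -> Xnorm_is s (psi 0) N0 ->
  exists N d e, 0 <= N /\ Xnorm_is s (psi t) N /\ trace t d e /\
    series_sum (norm_term s (fun n x => (d (S n) x, e (S n) x))) (N ^ 2).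
Proof.
  intros Ht [D0 [S0 [S1 [S2 [Sb [HD0 [_ [H0 [H1 [H2 [Hb _]]]]]]]]]]].
  pose proof (trace_of_smooth_cl D0 0 (Rle_refl 0) HD0) as T0.
  set (d0 := fun j x => fst (D0 j (clamp 0 x))) in *.
  set (e0 := fun j x => snd (D0 j (clamp 0 x))) in *.
  assert (Hv0 : forall n x, 0 <= x <= 1 -> D0 (S n) x = (d0 (S n) x, e0 (S n) x)).
  { intros n x Hx. unfold d0, e0. rewrite clamp_id by lra. apply surjective_pairing. }
  pose proof T0 as [_ [_ [Cd0 Ce0]]].
  destruct (trace_exists t d0 e0 Ht T0) as [d [e [T [Ep [Eq [Dd De]]]]]].
  pose proof T as [_ [_ [Cd Ce]]].
  set (D := fun n x => (d n x, e n x) : Cx).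
  assert (Hv : forall n x, 0 <= x <= 1 -> D (S n) x = (d (S n) x, e (S n) x)) by reflexivity.
  set (X := exp (growth_const C0 sigs s * (t - 0))).
  set (B := X * (S0 + S1 + S2 + Sb)).
  assert (HX : 0 < X) by apply exp_pos.
  assert (HM : forall M, sum_f_R0 (norm_term s (fun n => D (S n))) M <= B).
  { intros M. eapply Rle_trans.
    - apply (trace_norm_growth 0 t d0 e0 d e (fun n => D0 (S n)) (fun n => D (S n)) M);
        try assumption; lra.
    - fold X. apply Rmult_le_compat_l; [lra|].
      apply (norm_terms_bounded D0 S0 S1 S2 Sb d0 e0 M); assumption. }
  pose proof (fun i n => seminorm_term_nonneg s Hs (fun n => D (S n)) d e Cd Ce Hv i n) as Hn.
  pose proof (fun n => boundary_term_nonneg s Hs (fun n => D (S n)) d e Hv n) as Hbn.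
  assert (Hsn : forall i, (i <= 2)%nat -> exists T, series_sum (seminorm_term s i 0 (fun n => D (S n))) T).
  { intros i Hi. apply (series_sum_of_bounded _ B); [apply Hn|]. intros M.
    eapply Rle_trans; [|apply (HM M)]. apply sum_f_R0_le_le. intros n _. unfold norm_term.
    pose proof (Hn 0%nat n). pose proof (Hn 1%nat n). pose proof (Hn 2%nat n). pose proof (Hbn n).
    destruct i as [|[|[|i]]]; [| | |lia]; lra. }
  destruct (Hsn 0%nat ltac:(lia)) as [A0 HA0]. destruct (Hsn 1%nat ltac:(lia)) as [A1 HA1].
  destruct (Hsn 2%nat ltac:(lia)) as [A2 HA2].
  destruct (series_sum_of_bounded (boundary_term s (fun n => D (S n))) B) as [Ab HAb]; [exact Hbn| |].
  { intros M. eapply Rle_trans; [|apply (HM M)]. apply sum_f_R0_le_le. intros n _. unfold norm_term.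
    pose proof (Hn 0%nat n). pose proof (Hn 1%nat n). pose proof (Hn 2%nat n). lra. }
  assert (Hpos : 0 <= A0 + A1 + A2 + Ab).
  { eapply Rle_trans; [|apply (norm_terms_bounded D A0 A1 A2 Ab d e 0); assumption].
    simpl. unfold norm_term. pose proof (Hn 0%nat 0%nat). pose proof (Hn 1%nat 0%nat).
    pose proof (Hn 2%nat 0%nat). pose proof (Hbn 0%nat). lra. }
  exists (sqrt (A0 + A1 + A2 + Ab)), d, e. split; [apply sqrt_pos|].
  split; [|split; [exact T|]].
  - exists D, A0, A1, A2, Ab. split; [|split].
    + split.
      * intros x Hx. unfold D. rewrite <- Ep, <- Eq by exact Hx. unfold p, q.
        rewrite <- surjective_pairing. destruct HP as [HP0 _]. apply HP0. split; lra.
      * intros n x Hx. split.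
        -- apply (Rderiv_within_of_continuous (d n) (d (S n))); auto.
        -- apply (Rderiv_within_of_continuous (e n) (e (S n))); auto.
    + unfold D. rewrite <- Ep, <- Eq by lra. unfold p, q. rewrite P_at_1 by exact Ht. reflexivity.
    + repeat split; assumption.
  - rewrite pow2_sqrt by exact Hpos.
    apply (norm_terms_bounded D A0 A1 A2 Ab d e 0); assumption.
Qed.

Lemma Xnorm_sqr_growth (t1 t2 N1 N2 : R) (d1 e1 d2 e2 : nat -> R -> R) :
  0 <= t1 -> t1 <= t2 -> trace t1 d1 e1 -> trace t2 d2 e2 ->
  series_sum (norm_term s (fun n x => (d1 (S n) x, e1 (S n) x))) (N1 ^ 2) ->
  series_sum (norm_term s (fun n x => (d2 (S n) x, e2 (S n) x))) (N2 ^ 2) ->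
  N2 ^ 2 <= exp (growth_const C0 sigs s * (t2 - t1)) * N1 ^ 2.
Proof.
  intros Ht1 Ht2 T1 T2 H1 H2.
  apply (@Rle_cv_lim (fun M => sum_f_R0 (norm_term s (fun n x => (d2 (S n) x, e2 (S n) x))) M)
    (fun M => exp (growth_const C0 sigs s * (t2 - t1)) *
              sum_f_R0 (norm_term s (fun n x => (d1 (S n) x, e1 (S n) x))) M)).
  - intros M. apply (trace_norm_growth t1 t2 d1 e1 d2 e2); try assumption; reflexivity.
  - exact H2.
  - apply CV_mult; [apply Un_cv_const | exact H1].
Qed.

End Solution.

Theorem mainTheorem7 (W : R -> Cx) (sigs sig : R) :
  0 < sigs -> gevrey sigs 2 W -> 0 < sig -> sig < sigs ->
  exists c : R, 0 <= c /\
  forall (psi : R -> R -> Cx) (P : nat -> nat -> R -> R -> Cx),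
    smooth_family_Omega psi P ->

    (forall t x, Omega t x ->
       fst (P 0%nat 1%nat t x) * (2 * x) + x ^ 2 * fst (P 0%nat 2%nat t x)
         + fst (P 1%nat 1%nat t x) - fst (Cmul (W x) (psi t x)) = 0 /\
       snd (P 0%nat 1%nat t x) * (2 * x) + x ^ 2 * snd (P 0%nat 2%nat t x)
         + snd (P 1%nat 1%nat t x) - snd (Cmul (W x) (psi t x)) = 0) ->

    (forall t, 0 <= t -> psi t 1 = (0, 0)) ->
    (exists N0, Xnorm_is sig (psi 0) N0) ->
    exists N : R -> R,
      (forall t, 0 <= t -> Xnorm_is sig (psi t) (N t)) /\
      forall t1 t2, 0 <= t1 -> t1 <= t2 ->
        exists pr : Riemann_integrable N t1 t2,
          N t2 - N t1 <= c * RiemannInt pr.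
Proof.
  intros Hsigs [G [HG0 [HGd [C0 [HC0 HGb]]]]] Hs Hss.
  set (C := growth_const C0 sigs sig).
  assert (HC : 0 <= C).
  { apply Rmult_le_pos; [apply energy_const_nonneg; assumption | lra]. }
  (* C is the rate for the square of the norm; the norm itself grows at half that rate. *)
  exists (C / 2). split; [lra|].
  intros psi P HP Hpde Hdir [N0 HN0].
  (* The condition 0 <= t stands inside the existential, so that a value can be chosen for every
     real t; for t < 0 the choice is arbitrary. *)
  assert (Hex : forall t, exists N, 0 <= t -> exists d e, 0 <= N /\ Xnorm_is sig (psi t) N /\
     trace P t d e /\ series_sum (norm_term sig (fun n x => (d (S n) x, e (S n) x))) (N ^ 2)).
  { intros t. destruct (Rle_dec 0 t) as [Ht|Ht]; [|exists 0; lra].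
    destruct (Xnorm_exists W sigs sig C0 HC0 Hsigs Hs Hss G HG0 HGd HGb psi P HP Hpde Hdir t N0 Ht HN0)
      as [N [d [e H]]].
    exists N. intros _. exists d, e. exact H. }
  set (N := fun t => proj1_sig (constructive_indefinite_description _ (Hex t))).
  assert (HN : forall t, 0 <= t -> exists d e, 0 <= N t /\ Xnorm_is sig (psi t) (N t) /\
     trace P t d e /\ series_sum (norm_term sig (fun n x => (d (S n) x, e (S n) x))) (N t ^ 2)).
  { intros t. apply (proj2_sig (constructive_indefinite_description _ (Hex t))). }
  exists N. split.
  - intros t Ht. destruct (HN t Ht) as [d [e [_ [H _]]]]. exact H.
  - intros t1 t2 Ht1 Ht2. apply exponential_growth_integral; [lra | exact Ht2 | |].
    + intros t Ht. destruct (HN t ltac:(lra)) as [d [e [H _]]]. exact H.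
    + intros u t Hu Hut _.
      destruct (HN u ltac:(lra)) as [d1 [e1 [P1 [_ [T1 S1]]]]].
      destruct (HN t ltac:(lra)) as [d2 [e2 [P2 [_ [T2 S2]]]]].
      pose proof (Xnorm_sqr_growth W sigs sig C0 HC0 Hsigs Hs Hss G HG0 HGd HGb psi P HP Hpde Hdir
        u t (N u) (N t) d1 e1 d2 e2 ltac:(lra) Hut T1 T2 S1 S2) as H.
      fold C in H.
      pose proof (exp_pos (C / 2 * (t - u))) as He.
      (* The exponential is written as a square, so that square roots can be taken on both sides. *)
      replace (C * (t - u)) with (C / 2 * (t - u) + C / 2 * (t - u)) in H by field.
      rewrite exp_plus in H.
      apply Rsqr_incr_0_var; [unfold Rsqr; lra | apply Rmult_le_pos; lra].
Qed.
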